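(* There is a universal constant $C>0$ such that for every integer $k \geq 2$ and every HST metric $(\mathcal L, d_w)$, there is a randomized online algorithm for the $k$-server problem on $(\mathcal L,d_w)$ that is $C(\log k)^2$-competitive. In particular the competitive ratio does not depend on the size of the HST.
   Context: The $k$-server problem on a metric space $(X,d)$: a request sequence is $\bm r=(r_1,r_2,\ldots)$ with $r_t\in X$. A configuration $\rho\in X^k$ services $r$ if $r\in\{\rho_1,\ldots,\rho_k\}$. An online algorithm, given an initial configuration $\rho_0\in X^k$, is a sequence of maps $\rho_t : X^t\to X^k$ such that $\rho_t(r_1,\ldots,r_t)$ services $r_t$. Its cost on $\bm r$ is $\sum_{t\ge1} d_{X^k}(\rho_t(r_1,\ldots,r_t),\rho_{t-1}(r_1,\ldots,r_{t-1}))$, where $d_{X^k}((x_i),(y_i))=\sum_{i=1}^k d(x_i,y_i)$. The offline optimum $\mathsf{cost}^*(\bm r;k)$ is the infimum of $\sum_{t\ge1}d_{X^k}(\rho_t,\rho_{t-1})$ over all sequences $\rho_1,\rho_2,\ldots\in X^k$ (starting from $\rho_0$) with $\rho_t$ servicing $r_t$ for all $t$. A randomized online algorithm is a random online algorithm that is feasible with probability one; it is $\alpha$-competitive if for every $\rho_0\in X^k$ there is a constant $c>0$ such that for every request sequence $\bm r$, $\mathbb E[\text{cost}]\le \alpha\,\mathsf{cost}^*(\bm r;k)+c$. HST metrics: let $\mathcal T=(V,E)$ be a finite rooted tree with leaf set $\mathcal L$ and vertex weights $w:V\to\mathbb R_+$ that are non-increasing along every root-leaf path. Define $d_w(\ell,\ell')=w_{\mathsf{lca}(\ell,\ell')}$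 for distinct leaves $\ell,\ell'$ (and $0$ if $\ell=\ell'$). If $w_v\le w_u/\tau$ whenever $v$ is a child of $u$, $(\mathcal T,w)$ is a $\tau$-HST and $(\mathcal L,d_w)$ a $\tau$-HST metric; an HST metric is a $\tau$-HST metric for some $\tau>1$. *)

(* Defs.v *)
From HB Require Import structures.
From mathcomp Require Import all_boot all_order all_algebra.
From mathcomp Require Import all_classical all_reals all_analysis.
Set Implicit Arguments.
Unset Strict Implicit.
Unset Printing Implicit Defensive.
Import Order.TTheory GRing.Theory Num.Theory.
Local Open Scope classical_set_scope.
Local Open Scope ring_scope.

(** * The k-server problem *)

Definition config (k : nat) (X : Type) := k.-tuple X.

Definition config_dist (R : realType) (k : nat) (X : Type) (d : X -> X -> R)
    (x y : config k X) : R :=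
  \sum_(i < k) d (tnth x i) (tnth y i).

Definition services (k : nat) (X : eqType) (rho : config k X) (r : X) : Prop :=
  r \in rho.

(** A request sequence is a function [r : nat -> X] with [r t] denoting the
    request of index [t + 1]; a trajectory [rho : nat -> config k X] starts with
    the initial configuration [rho 0]. *)
Definition trajectory_cost (R : realType) (k : nat) (X : Type)
    (d : X -> X -> R) (rho : nat -> config k X) : \bar R :=
  (\sum_(0 <= t <oo) (config_dist d (rho t.+1) (rho t))%:E)%E.

Definition offline_opt (R : realType) (k : nat) (X : eqType)
    (d : X -> X -> R) (rho0 : config k X) (r : nat -> X) : \bar R :=
  ereal_inf [set trajectory_cost d rho | rho in
    [set rho : nat -> config k X |
      rho 0%N = rho0 /\ forall t, services (rho t.+1) (r t)]].

(** [A rho0 s] is the configuration reached from [rho0] after the finite history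
    of requests [s]: the restriction of [A rho0] to sequences of size [t] is the
    map from [X^t] to [X^k] used at time [t]. *)
Definition online_algorithm (k : nat) (X : Type) :=
  config k X -> seq X -> config k X.

Definition feasible_from (k : nat) (X : eqType) (A : online_algorithm k X)
    (rho0 : config k X) : Prop :=
  A rho0 [::] = rho0 /\
  forall (s : seq X) (r : X), services (A rho0 (rcons s r)) r.

Definition algorithm_cost (R : realType) (k : nat) (X : Type)
    (d : X -> X -> R) (A : online_algorithm k X) (rho0 : config k X)
    (r : nat -> X) : \bar R :=
  trajectory_cost d (fun t => A rho0 (mkseq r t)).

(** [X] being finite, [X^k] carries the discrete sigma-algebra, so measurability
    of a random configuration is measurability of its level sets. *)
Record randomized_online_algorithm (R : realType) (k : nat) (X : finType)
    (disp : measure_display) (Omega : measurableType disp)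
    (P : probability Omega R) (A : Omega -> online_algorithm k X) : Prop := {
  roa_measurable : forall (rho0 : config k X) (s : seq X) (rho : config k X),
    measurable [set omega | A omega rho0 s = rho] ;
  roa_feasible : forall rho0 : config k X,
    {ae P, forall omega, feasible_from (A omega) rho0} }.

Definition competitive (R : realType) (k : nat) (X : finType)
    (d : X -> X -> R) (disp : measure_display) (Omega : measurableType disp)
    (P : probability Omega R) (A : Omega -> online_algorithm k X)
    (alpha : R) : Prop :=
  forall rho0 : config k X, exists2 c : R, 0 < c &
    forall r : nat -> X,
      (\int[P]_omega algorithm_cost d (A omega) rho0 r
         <= alpha%:E * offline_opt d rho0 r + c%:E)%E.

(** * Rooted trees and HST metrics *)

(** The edges are the pairs [(v, parent v)] for [v] distinct from the root.
    Since the root is a fixed point of [parent] that every vertex reaches, there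
    is no other cycle of [parent]. *)
Record rooted_tree := RootedTree {
  vertex :> finType ;
  tree_root : vertex ;
  parent : vertex -> vertex ;
  parent_root : parent tree_root = tree_root ;
  to_root : forall v : vertex, exists n : nat, iter n parent v = tree_root }.

Definition child (T : rooted_tree) (v u : T) : bool :=
  (v != tree_root T) && (parent v == u).

Definition is_leaf (T : rooted_tree) (u : T) : bool :=
  [forall v : T, ~~ child v u].

Definition leaf (T : rooted_tree) : finType := {v : T | is_leaf v}.

Definition ancestor (T : rooted_tree) (u v : T) : bool :=
  fconnect (@parent T) v u.

Definition depth (T : rooted_tree) (v : T) : nat :=
  findex (@parent T) v (tree_root T).

Definition lca (T : rooted_tree) (u v : T) : T :=
  [arg max_(x > tree_root T | ancestor x u && ancestor x v) depth x]%N.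

Definition hst_dist (R : realType) (T : rooted_tree) (w : T -> R)
    (l l' : leaf T) : R :=
  if l == l' then 0 else w (lca (val l) (val l')).

Record is_tau_HST (R : realType) (tau : R) (T : rooted_tree) (w : T -> R)
    : Prop := {
  hst_ge0 : forall v : T, 0 <= w v ;
  hst_nonincreasing : forall u v : T, ancestor u v -> w v <= w u ;
  hst_separated : forall u v : T, child v u -> w v <= w u / tau }.

Definition is_HST (R : realType) (T : rooted_tree) (w : T -> R) : Prop :=
  exists2 tau : R, 1 < tau & is_tau_HST tau w.

(* Main.v *)
Require Import Defs.
From HB Require Import structures.
From mathcomp Require Import all_boot all_order all_algebra.
From mathcomp Require Import all_classical all_reals all_analysis.
From mathcomp Require Import measurable_realfun ring lra zify.
Set Implicit Arguments.
Unset Strict Implicit.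
Unset Printing Implicit Defensive.
Import Order.TTheory GRing.Theory Num.Theory.
Import numFieldNormedType.Exports.
Local Open Scope ring_scope.

(** Up to a constant factor the metric is given by a tree whose levels have
    geometrically growing weights.  Let [z (n, x, i)] be the probability that the
    subtree of the node [x] of level [n] contains more than [i] servers.  A request
    moves [z] to its projection, for a weighted entropy of [1 - z + dl] with
    [dl = 1 / (4 k)], onto the part of the server polytope where the requested leaf
    carries mass [1 - dl].  By the optimality conditions the relative entropy to the
    offline position drops by a gain [D] that bounds, up to a factor 2, the weighted
    inflow into every ancestor of the request; the conditional entropy of the server
    mass along the levels turns this into a bound [O(log k) D] on the total movement.
    As the relative entropy grows by at most [O(log k)] per unit of offline movement,
    the fractional algorithm is [O(log k)^2]-competitive.  Scaled by [1 / (1 - dl)],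
    the masses are followed by a Markov chain of integral configurations whose subtree
    counts stay within 1 of their means, at a constant factor in the expected
    movement. *)

(** * Minimizers over compact polyhedra *)

(** The optimality conditions bound the weighted inflow of each level separately by [2 * D]; adding
    this up would cost a factor equal to the depth. The conditional entropy removes it: where the
    ancestor of the request already holds mass at least 1/2, the inflow is paid by a decrease of
    entropy and by [D] times the growth of the logarithm of that mass, which telescopes to O(log k)
    along the path; the other levels have geometric weights of total O(D). The second logarithm is
    the slope of the potential in the offline position, at most ln((1 + dl) / dl) = ln(4 k + 1). So
    [dl] must be inverse polynomial in [k], yet small enough that scaling by 1 / (1 - dl) adds at
    most half a server in total. The scaling turns closeness to the mean into service: the request
    gets scaled mass at least 1, and an integer less than 1 away is positive. Rounding each node on
    its own breaks the conservation of mass between levels; an exact penalty restores it at a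
    constant factor. *)

Definition row_continuous (R : realType) (I : finType) (F : (I -> R) -> R) :=
  continuous (fun v : 'rV[R]_#|I| => F (fun i => v ord0 (enum_rank i))).

Section RowContinuous.
Local Open Scope classical_set_scope.
Variables (R : realType) (I : finType).
Implicit Types F G : (I -> R) -> R.

Lemma row_continuous_proj i : row_continuous (fun f : I -> R => f i).
Proof. by move=> v; exact: (@coord_continuous R 1 _ ord0 (enum_rank i) v). Qed.

Lemma row_continuous_cst c : row_continuous (fun _ : I -> R => c).
Proof. by move=> v; exact: (@cst_continuous _ _ c v). Qed.

Lemma row_continuousD F G :
  row_continuous F -> row_continuous G -> row_continuous (fun f => F f + G f).
Proof. by move=> cF cG v; exact: (continuousD (cF v) (cG v)). Qed.

Lemma row_continuousB F G :
  row_continuous F -> row_continuous G -> row_continuous (fun f => F f - G f).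
Proof. by move=> cF cG v; exact: (continuousB (cF v) (cG v)). Qed.

Lemma row_continuous_comp F (g : R -> R) :
  row_continuous F -> continuous g -> row_continuous (fun f => g (F f)).
Proof.
move=> cF cg v.
exact: (@continuous_comp _ _ _ (fun v : 'rV[R]_#|I| => _) g v (cF v) (cg _)).
Qed.

Lemma row_continuousZ c F :
  row_continuous F -> row_continuous (fun f => c * F f).
Proof.
move=> cF; apply: (row_continuous_comp (g := fun x => c * x)) => // x.
exact: mulrl_continuous.
Qed.

Lemma row_continuous_norm F :
  row_continuous F -> row_continuous (fun f => `|F f|).
Proof.
move=> cF; apply: (row_continuous_comp (g := fun x => `|x|)) => // x.
exact: norm_continuous.
Qed.

Lemma row_continuous_sum (J : Type) (r : seq J) (P : pred J)
    (F : J -> (I -> R) -> R) :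
  (forall j, P j -> row_continuous (F j)) ->
  row_continuous (fun f => \sum_(j <- r | P j) F j f).
Proof.
move=> cF; elim: r => [|j r IH].
  rewrite (_ : (fun _ => _) = (fun=> 0)); first exact: row_continuous_cst.
  by apply/funext => f; rewrite big_nil.
have [Pj|Pj] := boolP (P j); last first.
  rewrite (_ : (fun _ => _) = (fun f => \sum_(j <- r | P j) F j f))//.
  by apply/funext => f; rewrite big_cons (negbTE Pj).
rewrite (_ : (fun _ => _) = (fun f => F j f + \sum_(j <- r | P j) F j f)).
  by apply: row_continuousD => //; exact: cF.
by apply/funext => f; rewrite big_cons Pj.
Qed.

(** Functions on [I] are carried to row vectors, where the box is a compact product of segments and
    the constraints cut out a closed part. *)
Lemma argmin_box (J : Type) (a b : I -> R) (h : J -> (I -> R) -> R) F :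
  (forall j, row_continuous (h j)) -> row_continuous F ->
  (exists2 f, forall i, a i <= f i <= b i & forall j, 0 <= h j f) ->
  exists f, [/\ forall i, a i <= f i <= b i, forall j, 0 <= h j f
    & forall g, (forall i, a i <= g i <= b i) -> (forall j, 0 <= h j g) ->
      F f <= F g].
Proof.
move=> ch cF [f0 bf0 hf0].
pose fn (v : 'rV[R]_#|I|) (i : I) := v ord0 (enum_rank i).
pose rw (f : I -> R) : 'rV[R]_#|I| := \row_j f (enum_val j).
have rwK f : fn (rw f) = f by apply/funext => i; rewrite /fn mxE enum_rankK.
pose B := [set v : 'rV[R]_#|I| |
  forall j, `[a (enum_val j), b (enum_val j)]%classic (v ord0 j)].
pose C := [set v : 'rV[R]_#|I| | forall j, 0 <= h j (fn v)].
have cB : compact B.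
  apply: (@rV_compact _ _
    (fun j => `[a (enum_val j), b (enum_val j)]%classic)) => j.
  exact: segment_compact.
have clC : closed C.
  have -> : C = \bigcap_(j in [set: J]) ((fun v => h j (fn v)) @^-1` [set x | 0 <= x]).
    by apply/seteqP; split => v /= Cv j => [_|]; exact: Cv.
  apply: closed_bigI => j _; apply: preimage_closed; last exact: closed_ge.
  by move=> v _; exact: ch.
have cBC : compact (B `&` C).
  by apply: compact_closedI.
have BCP f : (forall i, a i <= f i <= b i) -> (forall j, 0 <= h j f) ->
    (B `&` C) (rw f).
  by move=> bf hf; split => j /=; rewrite ?rwK // mxE in_itv/= bf.
have [v] := EVT_min_rV (ex_intro _ _ (BCP _ bf0 hf0)) cBC
  (continuous_subspaceT cF).
rewrite inE => -[Bv Cv] vmin; exists (fn v); split => //.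
  by move=> i; have := Bv (enum_rank i); rewrite /= in_itv/= enum_rankK.
move=> g bg hg; have := vmin (rw g) _; rewrite inE => /(_ (BCP _ bg hg)).
by rewrite -[X in _ <= F X -> _]/(fn (rw g)) rwK.
Qed.

End RowContinuous.

(** * Farkas' lemma *)

Definition linear_fun (R : realType) (T : Type) (f : (T -> R) -> R) :=
  forall (c : R) (u v : T -> R), f (fun t => c * u t + v t) = c * f u + f v.

Lemma linear_fun0 (R : realType) (T : Type) (f : (T -> R) -> R) :
  linear_fun f -> f (fun=> 0) = 0.
Proof.
move=> lf; have := lf 1 (fun=> 0) (fun=> 0); rewrite mulr0 addr0 mul1r.
by lra.
Qed.

Lemma linear_funN (R : realType) (T : Type) (f : (T -> R) -> R) d :
  linear_fun f -> f (fun t => - d t) = - f d.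
Proof.
move=> lf; have := lf (-1) d (fun=> 0); rewrite linear_fun0// addr0 mulN1r => <-.
by congr f; apply/funext => t /=; rewrite addr0 mulN1r.
Qed.

(* Bartl's induction: either the last functional is redundant, or it is negative
   at a point [d0] where all the others are nonnegative, and one projects along
   [d0] onto its kernel. *)
Lemma farkas (R : realType) (T : Type) (J : eqType) (s : seq J)
    (a : J -> (T -> R) -> R) (b : (T -> R) -> R) :
  uniq s -> (forall j, linear_fun (a j)) -> linear_fun b ->
  (forall d, (forall j, j \in s -> 0 <= a j d) -> 0 <= b d) ->
  exists2 l : J -> R, forall j, 0 <= l j &
    forall d, b d = \sum_(j <- s) l j * a j d.
Proof.
elim: s a b => [|j0 s IH] a b /=.
  move=> _ la lb H; exists (fun=> 0) => // d; rewrite big_nil.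
  by apply/eqP; rewrite eq_le H// -oppr_ge0 -linear_funN// H.
case/andP=> js us la lb H.
have [|/existsNP[d0]] :=
    pselect (forall d, (forall j, j \in s -> 0 <= a j d) -> 0 <= b d).
  move/(IH a b us la lb) => [l l0 lE].
  exists (fun j => if j == j0 then 0 else l j) => [j|d]; first by case: ifP.
  rewrite big_cons eqxx mul0r add0r lE; apply: eq_big_seq => j jin.
  by rewrite ifN//; apply: contraNneq js => <-.
rewrite not_implyP => -[ad0 /negP]; rewrite -ltNge => bd0.
have aj0 : a j0 d0 < 0.
  rewrite ltNge; apply/negP => a0.
  have : 0 <= b d0.
    by apply: H => j; rewrite inE => /orP[/eqP->//|]; exact: ad0.
  by rewrite leNgt bd0.
have aj0n : a j0 d0 != 0 by rewrite lt_eqF.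
pose pr (d : T -> R) := fun t => - (a j0 d / a j0 d0) * d0 t + d t.
have prE f d : linear_fun f -> f (pr d) = - (a j0 d / a j0 d0) * f d0 + f d.
  by move=> lf; rewrite lf.
pose a' j d := a j (pr d); pose b' d := b (pr d).
have lpr f : linear_fun f -> linear_fun (fun d => f (pr d)).
  by move=> lf c u v; rewrite !prE// lf la; field.
have [| | |l l0 lE] := IH a' b' us.
- by move=> j; exact: lpr.
- exact: lpr.
- move=> d ad; apply: H => j; rewrite inE => /orP[/eqP->|]; last exact: ad.
  by rewrite prE// mulNr divfK// addNr.
(* Evaluating the desired identity at [d0] forces this multiplier. It is nonnegative because [b d0]
   and [a j0 d0] are negative and the other functionals are nonnegative there. *)
pose c := b d0 / a j0 d0 - \sum_(j <- s) l j * (a j d0 / a j0 d0).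
exists (fun j => if j == j0 then c else l j) => [j|d].
  case: ifP => // _; rewrite subr_ge0; apply: (@le_trans _ _ 0).
    rewrite big_seq; apply: sumr_le0 => i iin; apply: mulr_ge0_le0 => //.
    by rewrite mulr_ge0_le0 ?ad0// invr_le0 ltW.
  by rewrite nmulr_rge0// invr_le0 ltW.
rewrite big_cons eqxx; have := lE d; rewrite /b' prE// => bE.
have -> : \sum_(j <- s) (if j == j0 then c else l j) * a j d =
    \sum_(j <- s) l j * a j d.
  by apply: eq_big_seq => j jin; rewrite ifN//; apply: contraNneq js => <-.
have E : \sum_(j <- s) l j * a' j d = - (\sum_(j <- s) l j * (a j d0 / a j0 d0))
    * a j0 d + \sum_(j <- s) l j * a j d.
  rewrite mulNr mulr_suml -sumrN -big_split/=; apply: eq_bigr => j _.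
  by rewrite /a' prE//; field.
rewrite E in bE; rewrite /c mulrBl.
have -> : b d = (a j0 d / a j0 d0) * b d0 + (- (a j0 d / a j0 d0) * b d0 + b d).
  by ring.
by rewrite bE; field.
Qed.

(** * The server polytope of a levelled tree *)

(** Level [0] of the tree consists of the leaves and level [H] of the root [o];
    the nodes of every level are indexed by [X], and [par n] sends a node of level
    [n] to its parent in level [n.+1].  Indices without a leaf below them are
    harmless: they never carry any server mass. *)
Fixpoint anc (X : Type) (par : nat -> X -> X) (n : nat) (x : X) : X :=
  if n is m.+1 then par m (anc par m x) else x.

(** Generic in the values: it is applied to natural counts, to integer surpluses and to real
    masses. *)
Definition mass (V : nmodType) (X : finType) (par : nat -> X -> X) (m : X -> V)
    (n : nat) (x : X) : V :=
  \sum_(l | anc par n l == x) m l.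

Lemma massS (V : nmodType) (X : finType) (par : nat -> X -> X) (m : X -> V) n p :
  mass par m n.+1 p = \sum_(x | par n x == p) mass par m n x.
Proof.
rewrite /mass (partition_big (anc par n) (fun x => par n x == p))//=.
apply: eq_bigr => x /eqP xp; apply: eq_bigl => l.
by have [->|] := eqVneq (anc par n l) x; rewrite ?andbF// andbT xp eqxx.
Qed.

Lemma sum_mass (V : nmodType) (X : finType) (par : nat -> X -> X) (m : X -> V) n :
  \sum_x mass par m n x = \sum_l m l.
Proof. by rewrite /mass [RHS](partition_big (anc par n) predT). Qed.

Lemma sum_delta (V : nzSemiRingType) (X : finType) (c : X) : \sum_x (c == x)%:R = 1 :> V.
Proof. by rewrite (bigD1 c)//= eqxx big1 ?addr0// => x; rewrite eq_sym => /negbTE->. Qed.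

Section Polytope.
Variables (R : realType) (X : finType) (H : nat) (par : nat -> X -> X) (o : X).
Variable k : nat.
Hypotheses (H_gt0 : (0 < H)%N) (par_root : forall x, par H.-1 x = o).
Local Notation T := (nat * X * 'I_k)%type.
Implicit Types (z d : T -> R) (S : {set X * 'I_k}).

Lemma ancH x : anc par H x = o.
Proof. by case: H H_gt0 par_root => //= n _; apply. Qed.

Lemma mass_root (V : nmodType) (f : X -> V) x :
  mass par f H x = if x == o then \sum_l f l else 0.
Proof.
rewrite /mass; case: eqVneq => [->|xo].
  by apply: eq_bigl => l; rewrite ancH eqxx.
by rewrite big1// => l; rewrite ancH eq_sym (negbTE xo).
Qed.

Definition cnt n (p : X) S : nat := #|[set e in S | par n e.1 == p]|.

(** The variable [z (n, x, i)] is the probability that the subtree of the node [x]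
    of level [n] contains more than [i] servers. *)
Definition slack n S z : R :=
  \sum_p \sum_(i < k | (i < cnt n p S)%N) z (n.+1, p, i)
  - \sum_(e in S) z (n, e.1, e.2).

Definition rooted z := forall x i, z (H, x, i) = (x == o)%:R.

(** Nonnegativity, monotonicity in the slot and conservation of mass are not imposed. The projection
    inherits them from the previous point, so the only multipliers are those of the set constraints
    and of the request. *)
Definition polytope z :=
  rooted z /\ forall n S, (n < H)%N -> 0 <= slack n S z.

Definition below d : T -> R := fun t => if (t.1.1 < H)%N then d t else 0.

Definition tsum (f : T -> R) : R :=
  \sum_(n < H) \sum_x \sum_(i < k) f (n : nat, x, i).

Lemma eq_tsum f g : (forall n x i, (n < H)%N -> f (n, x, i) = g (n, x, i)) ->
  tsum f = tsum g.
Proof.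
move=> E; apply: eq_bigr => n _; apply: eq_bigr => x _; apply: eq_bigr => i _.
exact: E.
Qed.

Lemma ler_tsum f g : (forall n x i, (n < H)%N -> f (n, x, i) <= g (n, x, i)) ->
  tsum f <= tsum g.
Proof.
move=> E; apply: ler_sum => n _; apply: ler_sum => x _; apply: ler_sum => i _.
exact: E.
Qed.

Lemma tsum_linear : linear_fun tsum.
Proof.
move=> c u v; rewrite /tsum mulr_sumr -big_split; apply: eq_bigr => n _ /=.
rewrite mulr_sumr -big_split; apply: eq_bigr => x _ /=.
by rewrite mulr_sumr -big_split; apply: eq_bigr => i _ /=.
Qed.

Lemma tsumD f g : tsum (fun t => f t + g t) = tsum f + tsum g.
Proof.
rewrite -[tsum f]mul1r -tsum_linear; apply: eq_tsum => n x i _.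
by rewrite mul1r.
Qed.

Lemma tsumZ c f : tsum (fun t => c * f t) = c * tsum f.
Proof.
have t0 := linear_fun0 tsum_linear.
by rewrite -[RHS]addr0 -t0 -tsum_linear; apply: eq_tsum => n x i _; rewrite addr0.
Qed.

Lemma slack_linear n S : linear_fun (slack n S).
Proof.
move=> c u v; rewrite /slack mulrBr addrACA; congr (_ + _).
  rewrite mulr_sumr -big_split; apply: eq_bigr => p _ /=.
  by rewrite mulr_sumr -big_split; apply: eq_bigr => i _ /=.
by rewrite -opprD mulr_sumr -big_split.
Qed.

Lemma slack_below_linear n S : linear_fun (fun d => slack n S (below d)).
Proof.
move=> c u v; rewrite -slack_linear; congr (slack n S).
by apply/funext => t; rewrite /below; case: ifP; rewrite ?mulr0 ?addr0.
Qed.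

Lemma slackDbelow n S z d c :
  slack n S (fun t => c * below d t + z t) = c * slack n S (below d) + slack n S z.
Proof. exact: slack_linear. Qed.

Lemma rootedDbelow z d c : rooted z -> rooted (fun t => c * below d t + z t).
Proof. by move=> rz x i; rewrite /below/= ltnn mulr0 add0r rz. Qed.

Lemma cnt_set1 n e p : cnt n p [set e] = (par n e.1 == p).
Proof.
rewrite /cnt; case: eqVneq => [<-|ne]; last first.
  apply/eqP; rewrite cards_eq0; apply/eqP/setP => e'; rewrite !inE.
  by apply/negP => /andP[/eqP->]; apply/negP.
apply: etrans (cards1 e); apply: eq_card => e'; rewrite !inE.
by case: eqVneq => // ->; rewrite eqxx.
Qed.

Lemma polytope_le_parent z n x i (k0 : 'I_k) : polytope z -> (n < H)%N ->
  k0 = 0%N :> nat -> z (n, x, i) <= z (n.+1, par n x, k0).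
Proof.
move=> [_ Kz] nH k00; have := Kz n [set (x, i)] nH.
rewrite /slack big_set1/= (bigD1 (par n x))//= [X in _ + X - _]big1 ?addr0.
  rewrite (bigD1 k0) ?cnt_set1 ?eqxx ?k00//= big1 ?addr0 ?subr_ge0// => j.
  rewrite ltnS leqn0 => /andP[/eqP j0] /eqP[]; apply: val_inj.
  by rewrite /= j0 k00.
by move=> p np; rewrite big1// => j; rewrite cnt_set1/= eq_sym (negbTE np).
Qed.

(** Singleton sets bound a child by the first variable of its parent, and the root has value 1. *)
Lemma polytope_le1 z n x i : polytope z -> (n <= H)%N -> z (n, x, i) <= 1.
Proof.
move=> Kz nH; have k_gt0 : (0 < k)%N by case: (k) i => [[]|].
have [m ->] : exists m, n = (H - m)%N by exists (H - n)%N; rewrite subKn.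
elim: m x i => [|m IH] x i; first by rewrite subn0 Kz.1 lern1 leq_b1.
have [mH|Hm] := ltnP m H; last first.
  by have := IH x i; rewrite (eqP Hm) (eqP (leqW Hm)).
have nE : (H - m.+1).+1 = (H - m)%N by rewrite subnSK.
have nlt : (H - m.+1 < H)%N by rewrite ltn_subrL.
apply: le_trans (polytope_le_parent x i Kz nlt (erefl : Ordinal k_gt0 = 0%N :> nat)) _.
by rewrite nE.
Qed.

(** The truncated constraint for [S] follows from the original one for the slots of [S] with
    nonnegative value. With [obj_max0] this yields nonnegative minimizers without a multiplier for
    nonnegativity. *)
Lemma polytope_max0 z : polytope z -> polytope (fun t => Num.max (z t) 0).
Proof.
move=> [rz Kz]; split=> [x i|n S nH]; first by rewrite rz max_l.
pose S' := [set e in S | 0 <= z (n, e.1, e.2)].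
have := Kz n S' nH; rewrite /slack !subr_ge0 => zS'.
have -> : \sum_(e in S) Num.max (z (n, e.1, e.2)) 0 = \sum_(e in S') z (n, e.1, e.2).
  rewrite big_mkcond [RHS]big_mkcond; apply: eq_bigr => e _; rewrite inE.
  by case: (e \in S) => //=; case: leP => [/max_l|/ltW/max_r].
apply: le_trans zS' _; apply: ler_sum => p _.
rewrite big_mkcond [leRHS]big_mkcond; apply: ler_sum => i _.
have [iS'|_] := ltnP i (cnt n p S'); last by case: ifP => // _; rewrite le_max lexx orbT.
rewrite (leq_trans iS') ?le_max ?lexx//; apply: subset_leq_card.
by apply/fintype.subsetP => e; rewrite !inE => /andP[/andP[-> _] ->].
Qed.

Definition count_point (N : X -> nat) : T -> R :=
  fun t => (t.2 < mass par N t.1.1 t.1.2)%N%:R.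

Lemma sum_ord_lt (c M : nat) : (M <= k)%N ->
  \sum_(i < k | (i < c)%N) ((i < M)%N : nat) = minn c M.
Proof.
move=> Mk; rewrite big_mkcond -[RHS](card_ord) -sum1_card.
rewrite (eq_bigr (fun i : 'I_k => if (i < minn c M)%N then 1%N else 0%N)).
  rewrite -big_mkcond (big_ord_widen k (fun=> 1%N))//.
  by rewrite geq_min Mk orbT.
by move=> i _; rewrite leq_min; case: (i < c)%N; case: (i < M)%N.
Qed.

Lemma mass_le (N : X -> nat) n x : \sum_x N x = k -> (mass par N n x <= k)%N.
Proof. by move=> <-; rewrite -(sum_mass par N n) (bigD1 x)//=; exact: leq_addr. Qed.

Lemma count_point_polytope (N : X -> nat) : \sum_x N x = k ->
  polytope (count_point N).
Proof.
move=> Nk; have Mk n x := mass_le n x Nk; split=> [x i|n S nH].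
  by rewrite /count_point/= mass_root Nk; case: eqVneq; rewrite ?ltn_ord ?ltn0.
rewrite /slack /count_point/= subr_ge0 -natr_sum.
under [leRHS]eq_bigr do rewrite -natr_sum.
rewrite -natr_sum ler_nat (partition_big (fun e => par n e.1) predT)//=.
apply: leq_sum => p _; rewrite sum_ord_lt// leq_min; apply/andP; split.
  rewrite /cnt cardsE -sum1_card; apply: leq_sum => e _; exact: leq_b1.
rewrite massS.
apply: (@leq_trans (\sum_(e : X * 'I_k | par n e.1 == p) (e.2 < mass par N n e.1)%N)).
  rewrite [leqLHS]big_mkcond [leqRHS]big_mkcond; apply: leq_sum => e _ /=.
  by case: (e \in S) => //=; case: ifP.
rewrite (eq_bigl (fun e : X * 'I_k => (par n e.1 == p) && true)); last first.
  by move=> e; rewrite andbT.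
rewrite -(pair_big (fun x => par n x == p) xpredT
  (fun x (i : 'I_k) => (i < mass par N n x)%N : nat))/=.
apply: leq_sum => x _.
rewrite (eq_bigl (fun i : 'I_k => (i < k)%N)) => [|i]; last by rewrite ltn_ord.
by rewrite sum_ord_lt// geq_minr.
Qed.

Lemma sum_count_point (N : X -> nat) n x : \sum_x N x = k ->
  \sum_(i < k) count_point N (n, x, i) = (mass par N n x)%:R.
Proof.
move=> Nk; rewrite /count_point/= -natr_sum; congr _%:R.
rewrite (eq_bigl (fun i : 'I_k => (i < k)%N)) => [|i]; last by rewrite ltn_ord.
by rewrite sum_ord_lt ?mass_le//; apply/minn_idPr/mass_le.
Qed.

End Polytope.

(** * Entropic projections *)

Section Entropy.
Variable R : realType.
Implicit Types a b : R.

(** Normalized so that the derivative in [a] is exactly [ln (a / b)]. *)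
Definition ent a b : R := a * ln (a / b) - a.

Lemma le_lnB1 a : 0 < a -> ln a <= a - 1.
Proof. by move=> a0; have := @le_ln1Dx R (a - 1); rewrite subrKC; apply; lra. Qed.

Lemma ge_lnV a : 0 < a -> 1 - a^-1 <= ln a.
Proof.
move=> a0; have := @le_lnB1 a^-1; rewrite invr_gt0 lnV ?posrE// => /(_ a0); lra.
Qed.

Lemma ent_tangent a a0 b : 0 < a -> 0 < a0 -> 0 < b ->
  ent a b - ent a0 b <= ln (a / b) * (a - a0).
Proof.
move=> ap a0p bp; have := @le_lnB1 (a / a0) (divr_gt0 ap a0p).
rewrite /ent !ln_div ?posrE// => h.
have {}h : a0 * (ln a - ln a0) <= a - a0.
  apply: le_trans (_ : a0 * (a / a0 - 1) <= _); first by rewrite ler_pM2l.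
  by rewrite mulrBr mulr1 mulrC divfK ?gt_eqF.
nra.
Qed.

Lemma mul_ln_div_ge a b : 0 < a -> 0 < b -> a - b <= a * ln (a / b).
Proof.
move=> ap bp; have := ge_lnV (divr_gt0 ap bp); rewrite invf_div => h.
apply: (@le_trans _ _ (a * (1 - b / a))); last by rewrite ler_pM2l.
by rewrite mulrBr mulr1 mulrC divfK ?gt_eqF.
Qed.

End Entropy.

Section Projection.
Variables (R : realType) (X : finType) (H : nat) (par : nat -> X -> X) (o : X).
Variable k : nat.
Hypotheses (H_gt0 : (0 < H)%N) (par_root : forall x, par H.-1 x = o).
Local Notation T := (nat * X * 'I_k)%type.
Variables (w : nat -> R) (dl : R) (z0 : T -> R) (r : X) (i0 : 'I_k).
Hypotheses (w_gt0 : forall n, 0 < w n) (dl_gt0 : 0 < dl).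
Local Notation polytope := (polytope H par o).
Local Notation tsum := (tsum H).
Hypothesis Kz0 : polytope z0.
Hypothesis z0_ge0 : forall n x i, (n < H)%N -> 0 <= z0 (n, x, i).
Implicit Types (z d : T -> R).

(** The probability that a slot is empty, shifted by [dl] to keep the logarithms bounded. *)
Definition antiserver z (t : T) : R := 1 + dl - z t.

(* The truncation at [dl] is inactive on the polytope; it makes the objective
   continuous everywhere. *)
Definition obj z : R :=
  tsum (fun t => w t.1.1 * ent (Num.max dl (antiserver z t)) (antiserver z0 t)).

Lemma antiserver_ge z n x i : polytope z -> (n <= H)%N -> dl <= antiserver z (n, x, i).
Proof. by move=> Kz nH; have := polytope_le1 H_gt0 x i Kz nH; rewrite /antiserver; lra. Qed.

Lemma antiserver_gt0 z n x i : polytope z -> (n <= H)%N -> 0 < antiserver z (n, x, i).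
Proof. by move=> Kz nH; apply: lt_le_trans dl_gt0 (antiserver_ge _ _ Kz nH). Qed.

Lemma objE z : polytope z ->
  obj z = tsum (fun t => w t.1.1 * ent (antiserver z t) (antiserver z0 t)).
Proof. by move=> Kz; apply: eq_tsum => n x i nH; rewrite max_r// antiserver_ge// ltnW. Qed.

Lemma obj_tangent z z' : polytope z -> polytope z' -> obj z - obj z' <=
  tsum (fun t => w t.1.1 * (ln (antiserver z t / antiserver z0 t) * (antiserver z t - antiserver z' t))).
Proof.
move=> Kz Kz'; rewrite !objE// -[- tsum _]mulN1r -tsumZ -tsumD.
apply: ler_tsum => n x i nH; rewrite mulN1r -mulrBr ler_pM2l//.
by apply: ent_tangent; apply: antiserver_gt0 => //; exact: ltnW.
Qed.

(** A negative coordinate puts [antiserver z] above 1 + dl, which is at least [antiserver z0].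
    Truncation moves it back towards [antiserver z0], where the convex entropy is least. *)
Lemma obj_max0 z : polytope z -> obj (fun t => Num.max (z t) 0) <= obj z.
Proof.
move=> Kz; have Kz' := polytope_max0 Kz; rewrite -subr_le0.
apply: le_trans (obj_tangent Kz' Kz) _; rewrite -[leRHS](linear_fun0 (@tsum_linear R X H k)).
apply: ler_tsum => n x i nH; have nH' := ltnW nH.
rewrite pmulr_rle0//.
rewrite (_ : _ - antiserver z _ = z (n, x, i) - Num.max (z (n, x, i)) 0); last first.
  by rewrite /antiserver/=; ring.
have [zn|zn] := leP 0 (z (n, x, i)); first by rewrite subrr mulr0.
apply: mulr_ge0_le0; last by lra.
rewrite ln_ge0// ler_pdivlMr ?antiserver_gt0// mul1r /antiserver/=.
by rewrite max_r; [have := z0_ge0 x i nH; lra|exact: ltW].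
Qed.

Let I := ('I_H * X * 'I_k)%type.

(** [T] has infinitely many levels: the finite box keeps those below [H], and all others are filled
    with the root values. *)
Let ext (v : I -> R) : T -> R := fun t =>
  if insub t.1.1 is Some n then v (n, t.1.2, t.2) else (t.1.2 == o)%:R.

Let res z : I -> R := fun e => z (e.1.1 : nat, e.1.2, e.2).

Let resK z : rooted H o z -> forall n x i, (n <= H)%N ->
  ext (res z) (n, x, i) = z (n, x, i).
Proof.
move=> rz n x i nH; rewrite /ext/= /res; case: insubP => [m _ <-//|].
rewrite -leqNgt => Hn; have -> : n = H by apply/eqP; rewrite eqn_leq nH.
by rewrite rz.
Qed.

Let extE v (n : 'I_H) x i : ext v (n : nat, x, i) = v (n, x, i).
Proof. by rewrite /ext/= valK. Qed.

Let slack_resK n (S : {set X * 'I_k}) z : (n < H)%N -> rooted H o z ->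
  slack par n S (ext (res z)) = slack par n S z.
Proof.
move=> nH rz; congr (_ - _).
  by apply: eq_bigr => p _; apply: eq_bigr => i _; rewrite resK.
by apply: eq_bigr => e _; rewrite resK// ltnW.
Qed.

Let ext_rooted v : rooted H o (ext v).
Proof. by move=> x i; rewrite /ext/= insubF ?ltnn. Qed.

Let ext_continuous t : row_continuous (fun v => ext v t).
Proof.
rewrite /ext; case: insubP => [n _ _|_]; first exact: row_continuous_proj.
exact: row_continuous_cst.
Qed.

Let slack_ext_continuous n (S : {set X * 'I_k}) :
  row_continuous (fun v => slack par n S (ext v)).
Proof.
apply: row_continuousB.
  apply: row_continuous_sum => p _; apply: row_continuous_sum => i _.
  exact: ext_continuous.
by apply: row_continuous_sum => e _; exact: ext_continuous.
Qed.

Let obj_ext_continuous : row_continuous (fun v => obj (ext v)).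
Proof.
apply: row_continuous_sum => n _; apply: row_continuous_sum => x _.
apply: row_continuous_sum => i _; apply: row_continuousZ.
pose f (s : R) := ent (Num.max dl (1 + dl - s)) (antiserver z0 (n : nat, x, i)).
change (row_continuous (fun v => f (ext v (n : nat, x, i)))).
apply: row_continuous_comp => [|s]; first exact: ext_continuous.
have b0 : 0 < antiserver z0 (n : nat, x, i) by apply: antiserver_gt0 => //; exact: ltnW.
have m0 u : 0 < Num.max dl (1 + dl - u) by rewrite lt_max dl_gt0.
have cm : {for s, continuous (fun u : R => Num.max dl (1 + dl - u))}.
  apply: continuous_max; first exact: cst_continuous.
  by apply: continuousB; [exact: cst_continuous|exact: id].
pose m u := Num.max dl (1 + dl - u); pose b := antiserver z0 (n : nat, x, i).
apply: (@continuousB _ _ _ (fun u => m u * ln (m u / b)) m) => //.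
apply: (@continuousM _ _ m (fun u => ln (m u / b))) => //.
apply: (@continuous_comp _ _ _ (fun u => m u / b) (@ln R)).
  by apply: (@continuousM _ _ m (fun=> b^-1)) => //; exact: cst_continuous.
by apply: continuous_ln; apply: divr_gt0 => //; exact: m0.
Qed.

Lemma minimizer_exists : exists z, [/\ polytope z,
  forall n x i, (n < H)%N -> 0 <= z (n, x, i), 1 - dl <= z (0%N, r, i0) &
  forall z', polytope z' -> 1 - dl <= z' (0%N, r, i0) -> obj z <= obj z'].
Proof.
pose h (j : option ('I_H * {set X * 'I_k})) (v : I -> R) :=
  if j is Some (n, U) then slack par n U (ext v) else ext v (0%N, r, i0) - (1 - dl).
have hP z : polytope z -> (forall n x i, (n < H)%N -> 0 <= z (n, x, i)) ->
    1 - dl <= z (0%N, r, i0) ->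
    (forall e, 0 <= res z e <= 1) /\ forall j, 0 <= h j (res z).
  move=> Kz zp zr; split=> [[[n x] i]|[[n U]|]].
  - by rewrite zp//=; exact: (polytope_le1 H_gt0 _ _ Kz (ltnW (ltn_ord n))).
  - by rewrite /h slack_resK//; [exact: Kz.2|exact: Kz.1].
  - by rewrite /h resK// ?subr_ge0//; exact: Kz.1.
(* All [k] servers at the request: a feasible point. *)
pose N x := if x == r then k else 0%N.
have Nk : \sum_x N x = k by rewrite -big_mkcond big_pred1_eq.
have Ky := @count_point_polytope R X H par o k H_gt0 par_root N Nk.
have [||f [bf hf fmin]] := @argmin_box R I _ (fun=> 0) (fun=> 1) h
    (fun v => obj (ext v)) _ obj_ext_continuous.
- move=> [[n U]|] /=; first exact: slack_ext_continuous.
  apply: row_continuousB; [exact: ext_continuous|exact: row_continuous_cst].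
- have [|/=|] := hP _ Ky; last by exists (res (count_point R par N)).
    by move=> n x i _; exact: ler0n.
  rewrite /count_point/= /mass/= (big_pred1 r) => [|l]; last by rewrite /= eq_sym.
  by rewrite /N eqxx ltn_ord gerBl ltW.
have Kf : polytope (ext f).
  by split => // n S nH; exact: (hf (Some (Ordinal nH, S))).
exists (ext f); split.
- exact: Kf.
- move=> n x i nH; have /andP[+ _] := bf (Ordinal nH, x, i).
  by rewrite -extE.
- by have := hf None; rewrite /h subr_ge0.
- move=> z' Kz' z'r; apply: le_trans (obj_max0 Kz').
  have K1 := polytope_max0 Kz'; set z1 := (fun t => Num.max (z' t) 0) in K1 *.
  have [||b' h'] := hP _ K1.
  + by move=> n x i _; rewrite le_max lexx orbT.
  + by rewrite le_max z'r.
  apply: le_trans (fmin _ b' h') _.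
  rewrite le_eqVlt; apply/orP; left; apply/eqP; apply: eq_tsum => n x i nH.
  have E : ext (res z1) (n, x, i) = z1 (n, x, i).
    by apply: resK; [exact: K1.1|exact: ltnW].
  by rewrite /antiserver E.
Qed.

End Projection.

(** * Optimality conditions of the projection *)

Section KKT.
Local Open Scope classical_set_scope.
Variables (R : realType) (X : finType) (H : nat) (par : nat -> X -> X) (o : X).
Variable k : nat.
Hypothesis H_gt0 : (0 < H)%N.
Local Notation T := (nat * X * 'I_k)%type.
Variables (w : nat -> R) (dl : R) (z0 z : T -> R) (r : X) (i0 : 'I_k).
Hypotheses (w_gt0 : forall n, 0 < w n) (dl_gt0 : 0 < dl).
Local Notation polytope := (polytope H par o).
Local Notation tsum := (tsum H).
Local Notation xs := (antiserver dl).
Hypotheses (Kz0 : polytope z0) (Kz : polytope z).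
Hypothesis zr : 1 - dl <= z (0%N, r, i0).
Hypothesis zmin : forall z', polytope z' -> 1 - dl <= z' (0%N, r, i0) ->
  obj H w dl z0 z <= obj H w dl z0 z'.
Implicit Types d : T -> R.

Let grad z (t : T) : R := w t.1.1 * ln (xs z t / xs z0 t).

Lemma near_affine_ge0 (a b : R) : 0 <= a -> (a = 0 -> 0 <= b) ->
  \forall t \near 0^'+, 0 <= t * b + a.
Proof.
rewrite le_eqVlt => /orP[/eqP<- /(_ erefl) b0|a0 _].
  near=> t; rewrite addr0 mulr_ge0// ltW//.
have c0 : 0 < a / (`|b| + 1) by rewrite divr_gt0// ltr_wpDl.
near=> t; have t0 : 0 < t by [].
have : t < a / (`|b| + 1) by near: t; exact: nbhs_right_lt.
rewrite ltr_pdivlMr ?ltr_wpDl// => h.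
have := ler_norm (- b); rewrite normrN => h2.
nra.
Unshelve. all: by end_near. Qed.

(** No derivative is taken. The tangent inequality at the perturbed point [q s] bounds
    [obj (q s) - obj z] by [- s * f s]; minimality forces [f s <= 0] for small [s], and [f s] tends
    to the left-hand side. The finitely many constraints that are not tight survive a small
    perturbation. *)
Lemma variational_inequality d :
  (forall n S, (n < H)%N -> slack par n S z = 0 -> 0 <= slack par n S (below H d)) ->
  (z (0%N, r, i0) = 1 - dl -> 0 <= d (0%N, r, i0)) ->
  tsum (fun t => grad z t * d t) <= 0.
Proof.
move=> dS dr; pose q (s : R) := fun t => s * below H d t + z t.
have rz := Kz.1.
have nK : \forall s \near 0^'+, polytope (q s).
  have : \forall s \near 0^'+, forall e : 'I_H * {set X * 'I_k},
      0 <= s * slack par e.1 e.2 (below H d) + slack par e.1 e.2 z.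
    apply: filter_forall => -[n S] /=; apply: near_affine_ge0.
      exact: Kz.2.
    exact: dS.
  apply: filterS => s hs; split; first exact: rootedDbelow.
  move=> n S nH; rewrite slackDbelow; exact: (hs (Ordinal nH, S)).
have nr : \forall s \near 0^'+, 1 - dl <= q s (0%N, r, i0).
  have := @near_affine_ge0 (z (0%N, r, i0) - (1 - dl)) (below H d (0%N, r, i0)).
  rewrite subr_ge0 => /(_ zr) h; apply: filterS (h _) => [s|zr'].
    by rewrite addrA subr_ge0.
  by rewrite /below/= H_gt0; apply: dr; apply/eqP; rewrite -subr_eq0 zr'.
pose f (s : R) := tsum (fun t => w t.1.1 * (ln (xs (q s) t / xs z0 t) * d t)).
have cf : f s @[s --> 0^'+] --> tsum (fun t => grad z t * d t).
  apply: cvg_at_right_filter.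
  apply: cvg_big => [|n _]; first exact: add_continuous.
  apply: cvg_big => [|x _]; first exact: add_continuous.
  apply: cvg_big => [|i _]; first exact: add_continuous.
  set t := (n : nat, x, i); rewrite /grad -mulrA.
  have nH : (n <= H)%N by exact: ltnW.
  apply: cvgMl_tmp; apply: cvgMr_tmp.
  have p0 : 0 < xs z0 t by exact: (antiserver_gt0 H_gt0 dl_gt0 _ _ Kz0).
  have p1 : 0 < xs z t by exact: (antiserver_gt0 H_gt0 dl_gt0 _ _ Kz).
  have E : q 0 = z by apply/funext => t'; rewrite /q mul0r add0r.
  rewrite -[X in ln (xs X _ / _)]E; apply: (@continuous_comp _ _ _ (fun s => xs (q s) t / xs z0 t)).
    apply: (@continuousM _ _ (fun s => xs (q s) t) (fun=> (xs z0 t)^-1)).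
      apply: continuousB; first exact: cst_continuous.
      apply: continuousD; last exact: cst_continuous.
      by apply: continuousM; [exact: id|exact: cst_continuous].
    exact: cst_continuous.
  by apply: continuous_ln; rewrite E divr_gt0.
rewrite leNgt; apply/negP => L0.
have nf := cvgr_gt _ cf _ L0.
have [s [s0 [Ks [rs fs]]]] :
    exists s, 0 < s /\ polytope (q s) /\ 1 - dl <= q s (0%N, r, i0) /\ 0 < f s.
  apply: (@filter_ex _ (0^'+)); near=> s; split; first by [].
  split; first by near: s; exact: nK.
  by split; near: s; [exact: nr|exact: nf].
have := le_trans (_ : 0 <= _) (obj_tangent H_gt0 w_gt0 dl_gt0 Kz0 Ks Kz).
rewrite subr_ge0 => /(_ (zmin Ks rs)).
have -> : tsum (fun t => w t.1.1 * (ln (xs (q s) t / xs z0 t) * (xs (q s) t - xs z t)))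
    = - s * f s.
  rewrite /f -tsumZ; apply: eq_tsum => n x i nH.
  by rewrite /q /xs /below/= nH; ring.
by rewrite mulNr oppr_ge0 leNgt mulr_gt0.
Unshelve. all: by end_near. Qed.

(** Farkas' lemma applied to the variational inequality, with the active constraints as functionals;
    the inactive ones get multiplier 0. *)
Lemma kkt : exists (lam : nat -> {set X * 'I_k} -> R) (c : R),
  [/\ forall n S, 0 <= lam n S, 0 <= c,
    forall n S, (n < H)%N -> lam n S = 0 \/ slack par n S z = 0,
    c = 0 \/ z (0%N, r, i0) = 1 - dl &
    forall d, tsum (fun t => grad z t * d t) =
      - (\sum_(n < H) \sum_S lam n S * slack par n S (below H d)
         + c * d (0%N, r, i0))].
Proof.
pose J := (('I_H * {set X * 'I_k}) + unit)%type.
pose a (j : J) d := match j with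
  inl (n, U) => slack par n U (below H d) | inr _ => d (0%N, r, i0) end.
pose act (j : J) := match j with
  inl (n, U) => slack par n U z == 0 | inr _ => z (0%N, r, i0) == 1 - dl end.
have [||||l l0 lE] := @farkas R T J (enum act) a (fun d => - tsum (fun t => grad z t * d t)).
- exact: enum_uniq.
- by move=> [[n U]|[]] c u v //=; exact: slack_below_linear.
- move=> c u v; rewrite mulrN -opprD -tsumZ -tsumD; congr (- _).
  by apply: eq_tsum => n x i _; ring.
- move=> d hd; rewrite oppr_ge0; apply: variational_inequality => [n S nH sl0|zr'].
    have := hd (inl (Ordinal nH, S)); apply.
    by rewrite mem_enum unfold_in /= sl0.
  by have := hd (inr tt); apply; rewrite mem_enum unfold_in /= zr'.
exists (fun n S => if insub n is Some m
  then if act (inl (m, S)) then l (inl (m, S)) else 0 else 0).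
exists (if act (inr tt) then l (inr tt) else 0); split.
- by move=> n S; case: insubP => // m _ _; case: ifP.
- by case: ifP.
- move=> n S nH; rewrite insubT; case: ifP => [/= /eqP|_]; last by left.
  by right.
- by case: ifP => [/= /eqP|_]; [right|left].
move=> d; have := lE d; move/eqP; rewrite eqr_oppLR => /eqP ->; congr (- _).
rewrite big_enum/= big_mkcond big_sumType/=; congr (_ + _); last first.
  rewrite (bigD1 tt)//= big1 => [|[] //]; rewrite addr0 unfold_in/=.
  by case: ifP; rewrite ?mul0r.
rewrite pair_big; apply: eq_bigr => -[n U] _ /=.
by rewrite valK unfold_in/=; case: ifP; rewrite ?mul0r.
Qed.

End KKT.

(** Concavity of prefix sums: the step from [c] to [e] gains no more than the equally long step from
    [a] to [b]. Nonnegativity keeps the sequence nonincreasing when it is extended by 0 beyond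
    [k]. *)
Lemma prefix_sum_submodular (R : realType) (k : nat) (f : 'I_k -> R)
    (a b c e : nat) :
  (forall i, 0 <= f i) -> (forall i j : 'I_k, (i <= j)%N -> f j <= f i) ->
  (a <= b)%N -> (a <= c)%N -> (a + e = b + c)%N ->
  \sum_(i < k | (i < a)%N) f i + \sum_(i < k | (i < e)%N) f i <=
  \sum_(i < k | (i < b)%N) f i + \sum_(i < k | (i < c)%N) f i.
Proof.
move=> f0 fs ab ac E; pose F i := if insub i is Some j then f j else 0.
have FE (m : nat) : \sum_(i < k | (i < m)%N) f i = \sum_(0 <= i < m) F i.
  transitivity (\sum_(0 <= i < k | (i < m)%N) F i).
    by rewrite big_mkord; apply: eq_bigr => i _; rewrite /F valK.
  rewrite (big_nat_widen 0 k (m + k) _ _ (leq_addl m k)).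
  rewrite (big_nat_widen 0 m (m + k) _ _ (leq_addr k m)).
  rewrite big_mkcond [RHS]big_mkcond; apply: eq_bigr => i _ /=.
  by case: (i < m)%N => //=; case: ifPn => // ik; rewrite /F insubN.
have FS i j : (i <= j)%N -> F j <= F i.
  move=> ij; rewrite /F; case: (insubP _ j) => [j' jk jE|_]; last first.
    by case: insubP => // *; exact: f0.
  case: insubP => [i' _ iE|]; last by rewrite (leq_ltn_trans ij jk).
  by apply: fs; rewrite iE jE.
rewrite !FE; have be : (b <= e)%N by lia.
rewrite (@big_cat_nat _ _ _ b 0 e)//= (@big_cat_nat _ _ _ a 0 c)//=.
rewrite addrCA lerD2l lerD2l -{1}[b]add0n -{1}[a]add0n !big_addn.
have -> : (e - b = c - a)%N by lia.
by apply: ler_sum => i _; apply: FS; rewrite leq_add2l.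
Qed.

(** * Points that are sorted and conserve mass *)

Section ServerState.
Variables (R : realType) (X : finType) (H : nat) (par : nat -> X -> X) (o : X).
Variable k : nat.
Local Notation T := (nat * X * 'I_k)%type.
Local Notation tsum := (tsum H).
Implicit Types (z d : T -> R) (S : {set X * 'I_k}).

Definition node_mass z n x : R := \sum_(i < k) z (n, x, i).

(** The invariant of the fractional algorithm: the projection of a state is again a state. *)
Record server_state z : Prop := ServerState {
  ss_polytope : polytope H par o z ;
  ss_ge0 : forall n x i, (n < H)%N -> 0 <= z (n, x, i) ;
  ss_sorted : forall n x (i j : 'I_k), (n < H)%N -> (i <= j)%N ->
    z (n, x, j) <= z (n, x, i) ;
  ss_conserved : forall n p, (n < H)%N ->
    \sum_(x | par n x == p) node_mass z n x = node_mass z n.+1 p }.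

Definition delta (u : T) : T -> R := fun t => (t == u)%:R.

Lemma slack_delta n S m x i : slack par n S (delta (m, x, i)) =
  ((n.+1 == m) && (i < cnt par n x S)%N)%:R - ((n == m) && ((x, i) \in S))%:R.
Proof.
rewrite /slack /delta; congr (_ - _).
  rewrite (bigD1 x)//= [X in _ + X]big1 ?addr0 => [|p px]; last first.
    by rewrite big1// => j _; rewrite !xpair_eqE (negbTE px) andbF.
  rewrite big_mkcond (bigD1 i)//= big1 ?addr0 => [|j ji].
    by rewrite !xpair_eqE !eqxx !andbT; case: ifP; rewrite ?andbT ?andbF.
  by rewrite !xpair_eqE (negbTE ji) andbF; case: ifP.
have [xiS|xiS] := boolP ((x, i) \in S); last first.
  rewrite andbF big1// => -[y j] yS; rewrite !xpair_eqE/= -andbA.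
  have [/= /andP[/eqP yx /eqP ji]|_] := boolP ((y == x) && (j == i)).
    by move: yS; rewrite yx ji (negbTE xiS).
  by rewrite andbF.
rewrite (bigD1 (x, i))//= big1 ?addr0 => [|[y j] /andP[_ /negbTE]].
  by rewrite !xpair_eqE !eqxx !andbT.
by rewrite !xpair_eqE/= -andbA => ->; rewrite andbF.
Qed.

Lemma tsum_delta (f : T -> R) m x i : (m < H)%N ->
  tsum (fun t => f t * delta (m, x, i) t) = f (m, x, i).
Proof.
move=> mH; rewrite /tsum /delta (bigD1 (Ordinal mH))//= [X in _ + X]big1 ?addr0.
  rewrite (bigD1 x)//= [X in _ + X]big1 ?addr0 => [|y yx]; last first.
    by rewrite big1// => j _; rewrite !xpair_eqE (negbTE yx) andbF mulr0.
  rewrite (bigD1 i)//= [X in _ + X]big1 ?addr0 ?eqxx ?mulr1// => j ji.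
  by rewrite !xpair_eqE (negbTE ji) andbF mulr0.
move=> n nm; rewrite big1// => y _; rewrite big1// => j _.
by rewrite !xpair_eqE -val_eqE/= in nm *; rewrite (negbTE nm) mulr0.
Qed.

Lemma below_delta m x i : (m < H)%N -> below H (delta (m, x, i)) = delta (m, x, i).
Proof.
move=> mH; apply/funext => t; rewrite /below; case: ifPn => //.
rewrite -leqNgt => tH; rewrite /delta; case: eqVneq => // tE.
by move: tH; rewrite tE/= leqNgt mH.
Qed.

Lemma node_massH z : rooted H o z -> forall x, node_mass z H x = (x == o)%:R * k%:R.
Proof.
move=> rz x; rewrite /node_mass; under eq_bigr do rewrite rz.
by rewrite sumr_const card_ord mulr_natr.
Qed.

Lemma node_mass_leaves z n x : server_state z -> (n <= H)%N ->
  node_mass z n x = mass par (node_mass z 0) n x.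
Proof.
move=> sz; elim: n x => [|n IH] x nH.
  by rewrite /mass/= (big_pred1 x).
rewrite massS -(ss_conserved sz)//; apply: eq_bigr => y _; rewrite IH//.
exact: ltnW.
Qed.

Lemma sum_node_mass z n : server_state z -> (n <= H)%N ->
  \sum_x node_mass z n x = k%:R.
Proof.
move=> sz nH; rewrite (eq_bigr (mass par (node_mass z 0) n)); last first.
  by move=> x _; apply: node_mass_leaves.
rewrite sum_mass -(sum_mass par _ H) (bigD1 o)//= [X in _ + X]big1 ?addr0.
  by rewrite -node_mass_leaves// (node_massH (ss_polytope sz).1) eqxx mul1r.
move=> x xo; rewrite -node_mass_leaves// (node_massH (ss_polytope sz).1).
by rewrite (negbTE xo) mul0r.
Qed.

Lemma node_mass_ge0 z n x : server_state z -> (n < H)%N -> 0 <= node_mass z n x.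
Proof. by move=> sz nH; apply: sumr_ge0 => i _; exact: (ss_ge0 sz). Qed.

End ServerState.

(** * One projection step: invariants, inflow and decrease of the potential *)

Section Step.
Variables (R : realType) (X : finType) (H : nat) (par : nat -> X -> X) (o : X).
Variable k : nat.
Hypothesis H_gt0 : (0 < H)%N.
Local Notation T := (nat * X * 'I_k)%type.
Variables (w : nat -> R) (dl : R) (z0 z : T -> R) (r : X) (i0 : 'I_k).
Hypotheses (w_gt0 : forall n, 0 < w n) (dl_gt0 : 0 < dl) (i0E : i0 = 0%N :> nat).
Local Notation polytope := (polytope H par o).
Local Notation state := (server_state H par o).
Local Notation tsum := (tsum H).
Local Notation xs := (antiserver dl).
Local Notation sl := (slack par).
Local Notation ct := (cnt par).
Hypotheses (s0 : state z0) (Kz : polytope z).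
Hypothesis z_ge0 : forall n x i, (n < H)%N -> 0 <= z (n, x, i).
Hypothesis zr : 1 - dl <= z (0%N, r, i0).
Hypothesis zmin : forall z', polytope z' -> 1 - dl <= z' (0%N, r, i0) ->
  obj H w dl z0 z <= obj H w dl z0 z'.
Variables (lam : nat -> {set X * 'I_k} -> R) (c : R).
Hypotheses (lam_ge0 : forall n S, 0 <= lam n S) (c_ge0 : 0 <= c).
Hypothesis lam_slack : forall n S, (n < H)%N -> lam n S = 0 \/ sl n S z = 0.
Hypothesis c_slack : c = 0 \/ z (0%N, r, i0) = 1 - dl.

Let g (t : T) : R := ln (xs z t / xs z0 t).

Hypothesis kktE : forall d, tsum (fun t => w t.1.1 * g t * d t) =
  - (\sum_(n < H) \sum_S lam n S * sl n S (below H d) + c * d (0%N, r, i0)).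

Let K0 : polytope z0 := ss_polytope s0.

Let xs0_gt0 n x i : (n <= H)%N -> 0 < xs z0 (n, x, i).
Proof. exact: (antiserver_gt0 H_gt0 dl_gt0 x i K0). Qed.

Let xs_gt0 n x i : (n <= H)%N -> 0 < xs z (n, x, i).
Proof. exact: (antiserver_gt0 H_gt0 dl_gt0 x i Kz). Qed.

(** If slots [i < j] were inverted, shifting mass from [j] to [i] would be a feasible direction: a
    tight set containing [i] but not [j] would get negative slack once [i] is replaced by [j]. The
    resulting inequality between the two logarithms contradicts the order of [z0]. *)
Lemma minimizer_sorted n x (i j : 'I_k) : (n < H)%N -> (i <= j)%N ->
  z (n, x, j) <= z (n, x, i).
Proof.
move=> nH; rewrite leq_eqVlt => /orP[/eqP ij|ij].
  by rewrite (_ : i = j)//; exact: val_inj.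
rewrite leNgt; apply/negP => zij.
pose d : T -> R := fun t => delta R (n, x, i) t + -1 * delta R (n, x, j) t.
have slackd m S : sl m S (below H d) =
    sl m S (delta R (n, x, i)) - sl m S (delta R (n, x, j)).
  have -> : below H d = fun t => -1 * delta R (n, x, j) t + delta R (n, x, i) t.
    apply/funext => t; have := congr1 (@^~ t) (below_delta R x i nH).
    have := congr1 (@^~ t) (below_delta R x j nH); rewrite /below /d.
    by case: ifP => _ /= => [_ _|<- <-]; ring.
  by rewrite slack_linear; ring.
have := variational_inequality H_gt0 w_gt0 dl_gt0 K0 Kz zr zmin (d := d) _ _.
rewrite (_ : (fun t => _ * d t) = fun t =>
    w t.1.1 * g t * delta R (n, x, i) t + -1 * (w t.1.1 * g t * delta R (n, x, j) t)).
  rewrite tsumD tsumZ !tsum_delta//= mulN1r -mulrBr => h.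
  have {h}: w n * (g (n, x, i) - g (n, x, j)) <= 0.
    apply: h => [m S mH sl0|zr'].
      rewrite slackd !slack_delta; have [mn|mn] := eqVneq m.+1 n.
        have -> /= : (m == n) = false by lia.
        rewrite !subr0 subr_ge0 ler_nat; have [jc|] := ltnP j (ct m x S) => //.
        by rewrite (ltn_trans ij jc).
      rewrite !sub0r; have [/= mn'|] := eqVneq m n; last by rewrite oppr0 subrr.
      have [xi|_] := boolP ((x, i) \in S); last by rewrite oppr0 sub0r opprK ler0n.
      have [xj|xj] := boolP ((x, j) \in S); first by rewrite subrr.
      pose S' := (x, j) |: (S :\ (x, i)).
      have xij : (x, j) \notin S :\ (x, i) by rewrite !inE negb_and xj orbT.
      have cS p : ct m p S' = ct m p S.
        rewrite /cnt !cardsE -!sum1_card !big_mkcondr/= big_setU1//=.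
        by rewrite [RHS](big_setD1 (x, i)).
      have : sl m S' z = sl m S z + z (m, x, i) - z (m, x, j).
        rewrite /slack; under eq_bigr do rewrite cS.
        rewrite (big_setD1 (x, i) xi)/= big_setU1//=; lra.
      by have := Kz.2 m S' mH; rewrite mn' in sl0 *; lra.
    (* The request constrains slot 0, which cannot be the larger index [j]; so [d] does not decrease
       there. *)
    rewrite /d /delta !xpair_eqE.
    have [/= /andP[_ /eqP j0]|_] := boolP (_ && (i0 == j)).
      by move: ij; rewrite -j0 i0E ltn0.
    by rewrite mulr0 addr0.
  have nH' := ltnW nH; have zi := xs_gt0 x i nH'; have zj := xs_gt0 x j nH'.
  have yi := xs0_gt0 x i nH'; have yj := xs0_gt0 x j nH'.
  rewrite (pmulr_rle0 _ (w_gt0 n)) subr_le0.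
  rewrite (ler_ln _ _) ?posrE; [|exact: divr_gt0|exact: divr_gt0].
  rewrite (ler_pdivrMr _ _ yi) mulrAC (ler_pdivlMr _ _ yj).
  have := ss_sorted s0 x nH (ltnW ij); move: zi zj yi yj; rewrite /antiserver; nra.
by apply/funext => t; rewrite /d /g/=; ring.
Qed.

(* The multipliers of the constraints at level [n] that involve [z (n, x, i)] from
   below and from above. *)
Definition alpha n (x : X) (i : 'I_k) : R :=
  \sum_(S : {set X * 'I_k} | (x, i) \in S) lam n S.

Definition beta n (x : X) (i : 'I_k) : R :=
  if n is m.+1 then \sum_(S : {set X * 'I_k} | (i < ct m x S)%N) lam m S else 0.

Lemma alpha_ge0 n x i : 0 <= alpha n x i.
Proof. by apply: sumr_ge0 => S _. Qed.

Lemma beta_ge0 n x i : 0 <= beta n x i.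
Proof. by case: n => //= n; apply: sumr_ge0 => S _. Qed.

Lemma kkt_coord n x i : (n < H)%N -> w n * g (n, x, i) =
  alpha n x i - beta n x i - c * ((0%N, r, i0) == (n, x, i))%:R.
Proof.
move=> nH; rewrite -(tsum_delta (fun t => w t.1.1 * g t) x i nH) kktE.
rewrite opprD; congr (_ - _).
rewrite below_delta// -sumrN.
have E (m : 'I_H) : - \sum_S lam m S * sl m S (delta R (n, x, i)) =
    (m == n :> nat)%:R * alpha n x i
    - (m.+1 == n)%:R * \sum_(S : {set X * 'I_k} | (i < ct m x S)%N) lam m S.
  rewrite /alpha [X in _ * X - _]big_mkcond [X in _ - _ * X]big_mkcond.
  rewrite !mulr_sumr -!sumrN -big_split/=; apply: eq_bigr => S _.
  rewrite slack_delta; have [mn|mn] := eqVneq (m : nat) n.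
    rewrite (_ : (m.+1 == n) = false) ?mn/=; last by lia.
    by case: ifP => _; case: ifP => _ /=; ring.
  by case: eqVneq => _; case: ifP => _; case: ifP => _ /=; ring.
under eq_bigr do rewrite E.
rewrite big_split/= sumrN (bigD1 (Ordinal nH))//= eqxx mul1r big1 ?addr0; last first.
  by move=> m; rewrite -val_eqE/= => /negbTE ->; rewrite mul0r.
congr (_ - _); case: n nH {E} => [|n] nH /=; first by rewrite big1// => m; rewrite mul0r.
rewrite (bigD1 (Ordinal (ltnW nH)))//= eqxx mul1r [X in _ + X]big1 ?addr0// => m.
by rewrite -val_eqE/= eqSS => /negbTE ->; rewrite mul0r.
Qed.

Let leafE n x i : (0 < n)%N -> ((0%N, r, i0) == (n, x, i) :> T) = false.
Proof. by case: n. Qed.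

Let le_of_g_ge0 n x i : (n < H)%N -> 0 <= g (n, x, i) -> z (n, x, i) <= z0 (n, x, i).
Proof.
move=> nH g0; rewrite leNgt; apply/negP => zz; move: g0; apply/negP; rewrite -ltNge.
have zi := xs_gt0 x i (ltnW nH); have yi := xs0_gt0 x i (ltnW nH).
apply: ln_lt0; rewrite (divr_gt0 zi yi)/= (ltr_pdivrMr _ _ yi) mul1r /antiserver; lra.
Qed.

Let ge_of_g_le0 n x i : (n < H)%N -> g (n, x, i) <= 0 -> z0 (n, x, i) <= z (n, x, i).
Proof.
move=> nH g0; rewrite leNgt; apply/negP => zz; move: g0; apply/negP; rewrite -ltNge.
have yi := xs0_gt0 x i (ltnW nH).
by apply: ln_gt0; rewrite (ltr_pdivlMr _ _ yi) mul1r /antiserver; lra.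
Qed.

(** At the leaves [beta] is 0, so away from the requested slot the logarithm has the sign of
    [alpha]. *)
Lemma minimizer_leaf_le x i : (x, i) != (r, i0) -> z (0%N, x, i) <= z0 (0%N, x, i).
Proof.
move=> xi; apply: le_of_g_ge0 => //; rewrite -(pmulr_rge0 _ (w_gt0 0)) kkt_coord//.
rewrite subr0 (_ : (_ == _) = false) ?mulr0 ?subr0 ?alpha_ge0//.
by apply/negbTE; apply: contraNneq xi => -[-> ->].
Qed.

(** Uncrossing: the slack is submodular in the set, since prefix sums are concave in the length and
    the subtracted sum is modular, and no slack is negative. *)
Lemma tight_setU n S1 S2 : (n < H)%N ->
  sl n S1 z = 0 -> sl n S2 z = 0 -> sl n (S1 :|: S2) z = 0.
Proof.
move=> nH e1 e2; apply/eqP; rewrite eq_le (Kz.2 n _ nH) andbT.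
suff : sl n (S1 :|: S2) z + sl n (S1 :&: S2) z <= sl n S1 z + sl n S2 z.
  by have := Kz.2 n (S1 :&: S2) nH; lra.
rewrite /slack addrACA [leRHS]addrACA; apply: lerD.
  rewrite -!big_split/=; apply: ler_sum => p _.
  rewrite addrC; apply: (@prefix_sum_submodular _ _ (fun i => z (n.+1, p, i))).
  - move=> i; have [nH'|Hn] := ltnP n.+1 H; first exact: z_ge0.
    by rewrite (_ : n.+1 = H) ?Kz.1 ?ler0n//; lia.
  - move=> i j ij; have [nH'|Hn] := ltnP n.+1 H; first exact: minimizer_sorted.
    by rewrite (_ : n.+1 = H) ?Kz.1//; lia.
  - by apply: subset_leq_card; apply/fintype.subsetP => e; rewrite !inE => /andP[/andP[-> _] ->].
  - by apply: subset_leq_card; apply/fintype.subsetP => e; rewrite !inE => /andP[/andP[_ ->] ->].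
  rewrite /cnt addnC -[RHS]cardsUI; congr (_ + _)%N; apply: eq_card => e; rewrite !inE.
    by case: (_ == p); rewrite ?andbT ?andbF.
  by case: (_ == p); rewrite ?andbT ?andbF.
rewrite -!opprD lerN2 le_eqVlt; apply/orP; left; apply/eqP.
have mk (S : {set X * 'I_k}) : \sum_(e in S) z (n, e.1, e.2) =
    \sum_e (if e \in S then z (n, e.1, e.2) else 0) by exact: big_mkcond.
rewrite !mk -!big_split/=; apply: eq_bigr => e _; rewrite !inE.
by case: (e \in S1); case: (e \in S2) => /=; rewrite ?addr0 ?add0r.
Qed.

(** Let [U] be the union of all tight sets, itself tight. Slots outside [U] have [alpha = 0], so [z]
    is at least [z0] there; parent slots beyond the prefixes of [U] have [beta = 0], so [z] is at
    most [z0] there. As [U] is tight for [z] and feasible for [z0], whose two totals agree, the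
    total of [z] at level [n] is at least that at level [n.+1]. The full set gives the converse. *)
Lemma level_sumB n : (n < H)%N ->
  \sum_x node_mass z n x = \sum_x node_mass z n.+1 x.
Proof.
move=> nH; pose U := \bigcup_(S : {set X * 'I_k} | sl n S z == 0) S.
have tU : sl n U z = 0.
  apply: (big_ind (fun S => sl n S z = 0)).
  - rewrite /slack big_set0 subr0 big1// => p _; rewrite big1// => i.
    by rewrite (_ : ct n p _ = 0%N)//; apply/eqP; rewrite cards_eq0; apply/eqP/setP => e; rewrite !inE.
  - by move=> S1 S2; exact: tight_setU.
  - by move=> S /eqP.
have subU S : sl n S z = 0 -> S \subset U by move=> /eqP h; exact: finset.bigcup_sup.
have eU x i : (x, i) \notin U -> z0 (n, x, i) <= z (n, x, i).
  move=> xU; apply: ge_of_g_le0 => //; rewrite -(pmulr_rle0 _ (w_gt0 n)) kkt_coord//.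
  rewrite (_ : alpha n x i = 0) ?sub0r; last first.
    rewrite /alpha big1// => S xS; have [//|/subU /fintype.subsetP SU] := lam_slack S nH.
    by rewrite (SU _ xS) in xU.
  have := beta_ge0 n x i; have : 0 <= c * ((0%N, r, i0) == (n, x, i))%:R.
    by rewrite mulr_ge0.
  by lra.
have eP p (i : 'I_k) : (ct n p U <= i)%N -> z (n.+1, p, i) <= z0 (n.+1, p, i).
  move=> ci; have [nH'|Hn] := ltnP n.+1 H; last first.
    by rewrite (_ : n.+1 = H) ?Kz.1 ?K0.1//; lia.
  apply: le_of_g_ge0 => //; rewrite -(pmulr_rge0 _ (w_gt0 n.+1)) kkt_coord//.
  rewrite leafE// mulr0 subr0 (_ : beta n.+1 p i = 0) ?subr0 ?alpha_ge0//.
  rewrite /= big1// => S iS; have [//|/subU SU] := lam_slack S nH.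
  move: iS; rewrite ltnNge (leq_trans _ ci)//; apply: subset_leq_card.
  by apply/fintype.subsetP => e; rewrite !inE => /andP[/(fintype.subsetP SU) -> ->].
have K0U := K0.2 n U nH; rewrite /slack in tU K0U.
have split_U y : \sum_x node_mass y n x =
    \sum_(e in U) y (n, e.1, e.2) + \sum_(e | e \notin U) y (n, e.1, e.2).
  by rewrite /node_mass pair_bigA/= (bigID (mem U)).
have split_P (y : T -> R) : \sum_p node_mass y n.+1 p =
    \sum_p \sum_(i < k | (i < ct n p U)%N) y (n.+1, p, i) +
    \sum_p \sum_(i < k | ~~ (i < ct n p U)%N) y (n.+1, p, i).
  rewrite -big_split/=; apply: eq_bigr => p _.
  by rewrite /node_mass (bigID (fun i : 'I_k => (i < ct n p U)%N)).
have c0 : \sum_x node_mass z0 n x = \sum_x node_mass z0 n.+1 x.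
  by rewrite (sum_node_mass s0 (ltnW nH)) (sum_node_mass s0 nH).
have h1 : \sum_(e | e \notin U) z0 (n, e.1, e.2) <= \sum_(e | e \notin U) z (n, e.1, e.2).
  by apply: ler_sum => -[x i] /=; exact: eU.
have h2 : \sum_p \sum_(i < k | ~~ (i < ct n p U)%N) z (n.+1, p, i) <=
    \sum_p \sum_(i < k | ~~ (i < ct n p U)%N) z0 (n.+1, p, i).
  apply: ler_sum => p _; apply: ler_sum => i; rewrite -leqNgt; exact: eP.
apply/eqP; rewrite eq_le; apply/andP; split; last first.
  move: c0 tU K0U h1 h2; rewrite !split_U !split_P; lra.
have := Kz.2 n [set: X * 'I_k] nH; rewrite /slack subr_ge0 => h.
rewrite [leLHS](_ : _ = \sum_(e in [set: X * 'I_k]) z (n, e.1, e.2)).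
  apply: le_trans h _; apply: ler_sum => p _; rewrite /node_mass [leRHS](bigID
    (fun i : 'I_k => (i < ct n p [set: X * 'I_k])%N))/= lerDl.
  apply: sumr_ge0 => i _; have [nH'|Hn] := ltnP n.+1 H; first exact: z_ge0.
  by rewrite (_ : n.+1 = H) ?Kz.1 ?ler0n//; lia.
by rewrite /node_mass pair_bigA; apply: eq_bigl => e; rewrite inE.
Qed.

(** The constraint for all slots below a parent gives one inequality per parent; equality of the
    level totals makes each of them an equality. *)
Lemma minimizer_state : state z.
Proof.
split => //; first exact: minimizer_sorted.
move=> n p nH; pose F p := \sum_(x | par n x == p) node_mass z n x.
have FP q : F q <= node_mass z n.+1 q.
  pose S := [set e : X * 'I_k | par n e.1 == q].
  have := Kz.2 n S nH; rewrite /slack subr_ge0 (bigD1 q)//= [X in _ + X]big1; last first.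
    move=> q' qq'; rewrite big1// => i; rewrite (_ : ct n q' S = 0%N)//.
    apply/eqP; rewrite cards_eq0; apply/eqP/setP => e; rewrite !inE.
    by apply/negP => /andP[/eqP-> /eqP qE]; rewrite qE eqxx in qq'.
  rewrite addr0 => h.
  have -> : F q = \sum_(e in S) z (n, e.1, e.2).
    rewrite /F /node_mass pair_big/=; apply: eq_bigl => e.
    by rewrite inE andbT.
  apply: le_trans h _; rewrite /node_mass [leRHS](bigID
    (fun i : 'I_k => (i < ct n q S)%N))/= lerDl.
  apply: sumr_ge0 => i _; have [nH'|Hn] := ltnP n.+1 H; first exact: z_ge0.
  by rewrite (_ : n.+1 = H) ?Kz.1 ?ler0n//; lia.
have D0 : \sum_q (node_mass z n.+1 q - F q) = 0.
  rewrite sumrB -level_sumB// /F; apply/eqP; rewrite subr_eq0; apply/eqP.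
  by rewrite [LHS](partition_big (par n) predT).
have F_ge0 q : true -> 0 <= node_mass z n.+1 q - F q by rewrite subr_ge0.
apply/eqP; rewrite eq_sym -subr_eq0; apply/eqP.
exact: (psumr_eq0P F_ge0 D0).
Qed.

(** This quantity dominates the inflow into the ancestor of the request at its level, and
    complementary slackness passes it from one level to the next. *)
Definition level_pressure n : R := \sum_x \sum_(i < k) xs z (n, x, i) * alpha n x i.

Definition level_gain n : R := w n * \sum_x \sum_(i < k) xs z (n, x, i) * g (n, x, i).

(** The part of the decrease of [potential] that does not depend on the offline position: a relative
    entropy per level and the contribution of the request. *)
Definition projection_gain : R := \sum_(n < H) level_gain n + c * dl.

(** Gibbs' inequality: both states have total [k] on the level. *)
Lemma level_gain_ge0 n : (n < H)%N -> 0 <= level_gain n.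
Proof.
move=> nH; rewrite pmulr_rge0//.
have E : \sum_x (node_mass z0 n x - node_mass z n x) = 0.
  rewrite sumrB (sum_node_mass s0 (ltnW nH)) (sum_node_mass minimizer_state (ltnW nH)).
  by rewrite subrr.
rewrite -[leLHS]E.
apply: ler_sum => x _; rewrite /node_mass -sumrB; apply: ler_sum => i _.
have := mul_ln_div_ge (xs_gt0 x i (ltnW nH)) (xs0_gt0 x i (ltnW nH)).
by apply: le_trans; rewrite /antiserver; lra.
Qed.

Lemma projection_gain_ge0 : 0 <= projection_gain.
Proof.
apply: addr_ge0; last by rewrite mulr_ge0// ltW.
by apply: sumr_ge0 => n _; exact: level_gain_ge0.
Qed.

(** The coordinate identity multiplied by [xs z] and summed over the level. Unless [c = 0], the
    requested slot has [z = 1 - dl], hence [xs z = dl + dl]. *)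
Lemma level_balance n : (n < H)%N -> level_pressure n = level_gain n
  + \sum_x \sum_(i < k) xs z (n, x, i) * beta n x i + (n == 0%N)%:R * (c * (dl + dl)).
Proof.
move=> nH; rewrite /level_gain mulr_sumr.
have cE : c * xs z (0%N, r, i0) = c * (dl + dl).
  by case: c_slack => [->|e]; rewrite ?mul0r// /antiserver e; congr (_ * _); lra.
have -> : (n == 0%N)%:R * (c * (dl + dl)) = \sum_x \sum_(i < k)
    xs z (n, x, i) * (c * ((0%N, r, i0) == (n, x, i))%:R).
  rewrite -cE; have [n0|n0] := eqVneq n 0%N; last first.
    rewrite mul0r big1// => x _; rewrite big1// => i _.
    by rewrite leafE ?lt0n// !mulr0.
  rewrite n0 mul1r (bigD1 r)//= (bigD1 i0)//= eqxx !big1 ?addr0 ?mulr1 1?mulrC//.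
    by move=> x xr; rewrite big1// => i _; rewrite !xpair_eqE eq_sym (negbTE xr) !mulr0.
  by move=> i ii; rewrite !xpair_eqE [i0 == _]eq_sym (negbTE ii) andbF !mulr0.
rewrite /level_pressure -!big_split/=; apply: eq_bigr => x _.
rewrite mulr_sumr -!big_split/=; apply: eq_bigr => i _.
rewrite [w n * _]mulrCA kkt_coord//; ring.
Qed.

(* Complementary slackness: a tight set has the same total of [1 - z] above and
   below, up to the elements in excess of [k] per parent. *)
Lemma beta_le_pressure n : (n.+1 < H)%N ->
  \sum_x \sum_(i < k) xs z (n.+1, x, i) * beta n.+1 x i <= level_pressure n.
Proof.
move=> nH.
have -> : level_pressure n = \sum_S lam n S * \sum_(e in S) xs z (n, e.1, e.2).
  rewrite /level_pressure pair_bigA/=.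
  under eq_bigr do rewrite mulr_sumr big_mkcond/=.
  rewrite exchange_big/=; apply: eq_bigr => S _.
  rewrite mulr_sumr [RHS]big_mkcond/=; apply: eq_bigr => -[x i] _ /=.
  by case: ifP => // _; rewrite mulrC.
have -> : \sum_x \sum_(i < k) xs z (n.+1, x, i) * beta n.+1 x i = \sum_S lam n S *
    \sum_x \sum_(i < k | (i < ct n x S)%N) xs z (n.+1, x, i).
  rewrite pair_bigA/=.
  under eq_bigr do rewrite mulr_sumr big_mkcond/=.
  rewrite exchange_big/=; apply: eq_bigr => S _.
  under [in RHS]eq_bigr do rewrite big_mkcond.
  rewrite pair_bigA/= mulr_sumr; apply: eq_bigr => -[x i] _ /=.
  by case: ifP => // _; rewrite ?mulr0// mulrC.
apply: ler_sum => S _; have [->|sl0] := lam_slack S (ltnW nH); first by rewrite !mul0r.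
apply: ler_wpM2l => //.
have -> : \sum_(e in S) xs z (n, e.1, e.2) =
    (1 + dl) * #|S|%:R - \sum_(e in S) z (n, e.1, e.2).
  by rewrite /antiserver sumrB sumr_const mulr_natr.
have -> : \sum_x \sum_(i < k | (i < ct n x S)%N) xs z (n.+1, x, i) =
    (1 + dl) * (\sum_x #|[pred i : 'I_k | (i < ct n x S)%N]|)%:R
    - \sum_x \sum_(i < k | (i < ct n x S)%N) z (n.+1, x, i).
  rewrite natr_sum mulr_sumr -sumrB; apply: eq_bigr => x _.
  by rewrite /antiserver sumrB sumr_const mulr_natr.
move: sl0; rewrite /slack => /eqP; rewrite subr_eq0 => /eqP ->.
rewrite lerD2r ler_pM2l ?ler_nat; last by rewrite addr_gt0.
have -> : #|S| = (\sum_x ct n x S)%N.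
  rewrite -sum1_card (partition_big (fun e : X * 'I_k => par n e.1) predT)//=.
  by apply: eq_bigr => x _; rewrite /cnt -sum1_card; apply: eq_bigl => e; rewrite inE.
apply: leq_sum => x _; rewrite -sum1_card.
rewrite (eq_bigr (fun i : 'I_k => ((i < k)%N : nat))) => [|i _]; last by rewrite ltn_ord.
by rewrite (sum_ord_lt _ (leqnn k)) geq_minl.
Qed.

(** The pressure accumulates the gains from the leaves up to its level. The factor 2 is due to the
    request, which adds [c * (dl + dl)] to the pressure but only [c * dl] to the gain. *)
Lemma level_pressure_le n : (n < H)%N -> level_pressure n <= 2 * projection_gain.
Proof.
move=> nH.
have h : level_pressure n <= \sum_(m < n.+1) level_gain m + c * (dl + dl).
  elim: n nH => [|n IH] nH; rewrite level_balance// big_ord_recr/=.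
    rewrite big_ord0 add0r mul1r big1 ?addr0// => x _.
    by rewrite big1// => i _; rewrite mulr0.
  have := beta_le_pressure nH; have := IH (ltnW nH); lra.
have h2 : \sum_(m < n.+1) level_gain m <= \sum_(m < H) level_gain m.
  rewrite (big_ord_widen _ (fun m => level_gain m) nH) big_mkcond.
  by apply: ler_sum => m _; case: ifP => // _; exact: level_gain_ge0.
apply: le_trans h _; rewrite /projection_gain mulrDr.
have : 0 <= \sum_(m < H) level_gain m by apply: sumr_ge0 => m _; exact: level_gain_ge0.
have : c * (dl + dl) = 2 * (c * dl) by ring.
lra.
Qed.

(** What enters the ancestor leaves the other nodes of the level. In each of their slots the loss
    equals [xs z - xs z0], which is at most [xs z * g], and [w n * g] is at most [alpha]. *)
Lemma path_inflow_le n : (n < H)%N -> w n * (node_mass z n (anc par n r)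
  - node_mass z0 n (anc par n r)) <= 2 * projection_gain.
Proof.
move=> nH; apply: le_trans (level_pressure_le nH).
have st := minimizer_state; have nH' := ltnW nH.
have : \sum_x node_mass z n x = \sum_x node_mass z0 n x.
  by rewrite (sum_node_mass st nH') (sum_node_mass s0 nH').
rewrite (bigD1 (anc par n r))//= [RHS](bigD1 (anc par n r))//= => E.
have -> : node_mass z n (anc par n r) - node_mass z0 n (anc par n r) =
    \sum_(x | x != anc par n r) (node_mass z0 n x - node_mass z n x).
  by rewrite sumrB; lra.
rewrite mulr_sumr /level_pressure big_mkcond; apply: ler_sum => x _.
have p i : 0 <= xs z (n, x, i) * alpha n x i.
  by rewrite mulr_ge0 ?alpha_ge0// ltW// xs_gt0.
case: ifP => _; last by apply: sumr_ge0.
rewrite /node_mass -sumrB mulr_sumr; apply: ler_sum => i _.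
have := mul_ln_div_ge (xs_gt0 x i nH') (xs0_gt0 x i nH') => h.
have h2 : w n * (xs z (n, x, i) - xs z0 (n, x, i)) <=
    xs z (n, x, i) * (w n * g (n, x, i)) by rewrite mulrCA ler_pM2l.
have -> : z0 (n, x, i) - z (n, x, i) = xs z (n, x, i) - xs z0 (n, x, i).
  by rewrite /antiserver; lra.
apply: le_trans h2 _; rewrite kkt_coord//.
rewrite ler_pM2l ?xs_gt0// lerBlDr lerBlDr -addrA lerDl addr_ge0 ?beta_ge0//.
by rewrite mulr_ge0.
Qed.

(* Relative entropy of the offline position [y], up to a term independent of [z];
   the second argument stays between [dl] and [1 + dl]. *)
Definition potential (y z : T -> R) : R :=
  tsum (fun t => w t.1.1 * (xs y t * ln ((1 + dl) / xs z t))).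

(** The optimality identity is tested against [z - y]. The request contributes [c * dl], because [y]
    is 1 there, and every tight set contributes a nonnegative term, because [y] is feasible. *)
Lemma potential_drop y : polytope y -> y (0%N, r, i0) = 1 ->
  potential y z + projection_gain <= potential y z0.
Proof.
move=> Ky yr.
have -> : potential y z0 = potential y z + tsum (fun t => w t.1.1 * g t * xs y t).
  rewrite /potential -tsumD; apply: eq_tsum => n x i nH.
  have zi := xs_gt0 x i (ltnW nH); have yi := xs0_gt0 x i (ltnW nH).
  have d1 : 0 < 1 + dl by rewrite addr_gt0.
  by rewrite /g !ln_div ?posrE//=; ring.
rewrite lerD2l.
have -> : tsum (fun t => w t.1.1 * g t * xs y t) =
    tsum (fun t => w t.1.1 * g t * xs z t)
    + tsum (fun t => w t.1.1 * g t * (z t - y t)).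
  by rewrite -tsumD; apply: eq_tsum => n x i nH; rewrite /antiserver; ring.
apply: lerD.
  rewrite le_eqVlt; apply/orP; left; apply/eqP; apply: eq_bigr => n _.
  rewrite /level_gain mulr_sumr; apply: eq_bigr => x _.
  by rewrite mulr_sumr; apply: eq_bigr => i _ /=; ring.
rewrite kktE yr opprD.
have -> : - (c * (z (0%N, r, i0) - 1)) = c * dl.
  by case: c_slack => [->|->]; rewrite ?mul0r ?oppr0//; ring.
rewrite lerDr oppr_ge0; apply: sumr_le0 => n _; apply: sumr_le0 => S _.
have [->|sl0] := lam_slack S (ltn_ord n); first by rewrite mul0r.
rewrite mulr_ge0_le0//.
have -> : sl n S (below H (fun t => z t - y t)) = sl n S z - sl n S y.
  have <- : sl n S (fun t => -1 * y t + z t) = sl n S z - sl n S y.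
    by rewrite slack_linear; ring.
  rewrite /slack; congr (_ - _); last first.
    by apply: eq_bigr => e _; rewrite /below/= ltn_ord; ring.
  apply: eq_bigr => p _; apply: eq_bigr => i _; rewrite /below/=.
  case: ifPn => [_|]; first by ring.
  rewrite -leqNgt => Hn; have -> : n.+1 = H by apply/eqP; rewrite eqn_leq Hn ltn_ord.
  by rewrite Kz.1 Ky.1; ring.
by rewrite sl0 sub0r oppr_le0; exact: Ky.2.
Qed.

End Step.

Theorem projection_step (R : realType) (X : finType) (H : nat)
    (par : nat -> X -> X) (o : X) (k : nat) (w : nat -> R) (dl : R)
    (z0 : nat * X * 'I_k -> R) (r : X) (i0 : 'I_k) :
  (0 < H)%N -> (forall x, par H.-1 x = o) -> (forall n, 0 < w n) -> 0 < dl ->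
  i0 = 0%N :> nat -> server_state H par o z0 ->
  exists (z : nat * X * 'I_k -> R) (D : R),
  [/\ server_state H par o z, 1 - dl <= z (0%N, r, i0),
    forall x i, (x, i) != (r, i0) -> z (0%N, x, i) <= z0 (0%N, x, i),
    forall n, (n < H)%N -> w n * (node_mass z n (anc par n r)
      - node_mass z0 n (anc par n r)) <= 2 * D &
    0 <= D /\ forall y, polytope H par o y -> y (0%N, r, i0) = 1 ->
      potential H w dl y z + D <= potential H w dl y z0].
Proof.
move=> H0 pr w0 d0 i00 s0.
have [z [Kz zp zr zm]] := minimizer_exists H0 pr r i0 w0 d0 (ss_polytope s0) (ss_ge0 s0).
have [lam [c [l0 c0 ls cs kE]]] := kkt H0 w0 d0 (ss_polytope s0) Kz zr zm.
exists z, (projection_gain H w dl z0 z c); split => //.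
- exact: (minimizer_state H0 w0 d0 i00 s0 Kz zp zr zm l0 c0 ls kE).
- exact: (minimizer_leaf_le H0 w0 d0 i00 s0 Kz zr l0 c0 kE).
- exact: (path_inflow_le H0 w0 d0 i00 s0 Kz zp zr zm l0 c0 ls cs kE).
split; last by move=> y Ky yr; exact: (potential_drop H0 d0 s0 Kz l0 ls cs kE).
exact: (projection_gain_ge0 H0 w0 d0 i00 s0 Kz zp zr zm l0 c0 ls kE).
Qed.

(** * The entropy of the server distribution *)

Section OneLevel.
Variables (R : realType) (X : finType) (f : X -> X).
Implicit Types z q : X -> R.

Definition fiber_sum z p : R := \sum_(x | f x == p) z x.

Definition cond_entropy z : R := \sum_x z x * (ln (fiber_sum z (f x)) - ln (z x)).

Lemma le_fiber_sum z x : (forall x, 0 <= z x) -> z x <= fiber_sum z (f x).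
Proof. by move=> z0; rewrite /fiber_sum (bigD1 x)//= lerDl sumr_ge0. Qed.

(** [ln t <= t - 1] is used with [q] rescaled on each fiber to the fiber sum of [z]; the rescaled
    [q] has on every fiber at most the total of [z], so the correction terms sum to at most 0. *)
Lemma gibbs z q : (forall x, 0 <= z x) -> (forall x, 0 <= q x) ->
  (forall x, 0 < z x -> 0 < q x) ->
  cond_entropy z <= \sum_x z x * (ln (fiber_sum q (f x)) - ln (q x)).
Proof.
move=> z0 q0 zq.
have fz x := le_fiber_sum x z0; have fq x := le_fiber_sum x q0.
have key x : z x * (ln (fiber_sum z (f x)) - ln (z x)) <=
    z x * (ln (fiber_sum q (f x)) - ln (q x)) +
    (fiber_sum z (f x) / fiber_sum q (f x) * q x - z x).
  have := z0 x; rewrite le_eqVlt => /orP[/eqP zx|zx].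
    rewrite -zx !mul0r add0r subr0 mulr_ge0// divr_ge0//.
      by apply: le_trans (fz x); rewrite -zx.
    exact: le_trans (q0 x) (fq x).
  have qx := zq x zx; have Z := lt_le_trans zx (fz x); have Q := lt_le_trans qx (fq x).
  set A := fiber_sum z (f x) in Z *; set B := fiber_sum q (f x) in Q *.
  have := @le_lnB1 R (A / B * (q x / z x)).
  rewrite mulr_gt0 ?divr_gt0// lnM ?posrE ?divr_gt0// !ln_div ?posrE// => /(_ isT) h.
  have -> : A / B * q x - z x = z x * (A / B * (q x / z x) - 1).
    by field; rewrite !gt_eqF.
  by rewrite -mulrDr ler_pM2l//; lra.
apply: le_trans (ler_sum _ (fun x _ => key x)) _.
rewrite big_split/= gerDl sumrB subr_le0 (partition_big f predT)//=.
rewrite [leRHS](partition_big f predT)//=; apply: ler_sum => p _.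
rewrite (eq_bigr (fun x => fiber_sum z p / fiber_sum q p * q x)); last first.
  by move=> x /eqP->.
rewrite -mulr_sumr -[\sum_(x | f x == p) q x]/(fiber_sum q p).
rewrite -[leRHS]/(fiber_sum z p); have [->|Q] := eqVneq (fiber_sum q p) 0.
  by rewrite mulr0; apply: sumr_ge0.
by rewrite divfK.
Qed.

Variables (z0 z : X -> R) (u : X).
Hypotheses (z0_ge0 : forall x, 0 <= z0 x) (z_ge0 : forall x, 0 <= z x).
Hypothesis z_le : forall x, x != u -> z x <= z0 x.

Let inflow := \sum_(x | (x != u) && (f x == f u)) (z0 x - z x).

Let inflow_ge0 : 0 <= inflow.
Proof. by apply: sumr_ge0 => x /andP[xu _]; rewrite subr_ge0 z_le. Qed.

Let fiber_sumD1 : fiber_sum z0 (f u) =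
  z0 u + \sum_(x | (x != u) && (f x == f u)) z0 x.
Proof. by rewrite /fiber_sum (bigD1 u)//=; congr (_ + _); apply: eq_bigl => x; rewrite andbC. Qed.

Let pos_of_pos x : x != u -> 0 < z x -> 0 < z0 x.
Proof. by move=> xu zx; apply: lt_le_trans zx (z_le xu). Qed.

(** [gibbs] with the old masses makes the change linear: [u] costs ln(A / a) per unit gained, and
    each sibling returns at least ln(A / s) per unit lost, [s] being the old total of the siblings.
    These logarithms add up to at least 1, so the inflow itself costs only another ln(A / a) per
    unit. *)
Lemma entropy_high : 0 < z0 u -> 0 <= z u - z0 u -> inflow <= z u - z0 u ->
  inflow + (cond_entropy z - cond_entropy z0) <=
  2 * (z u - z0 u) * (ln (fiber_sum z0 (f u)) - ln (z0 u)).
Proof.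
move=> u0 M0 FM; set A := fiber_sum z0 (f u); set a := z0 u in u0 M0 FM *.
have aA : a <= A by exact: le_fiber_sum.
have A0 : 0 < A by exact: lt_le_trans aA.
have B0 : 0 <= ln A - ln a by rewrite subr_ge0 ler_ln ?posrE.
set M := z u - a in M0 FM *; set s := \sum_(x | (x != u) && (f x == f u)) z0 x.
have AE : A = a + s by exact: fiber_sumD1.
have s0 : 0 <= s by apply: sumr_ge0.
have le_s x : x != u -> f x == f u -> z0 x <= s.
  by move=> xu fx; rewrite /s (bigD1 x) ?xu//= lerDl sumr_ge0.
have E : cond_entropy z - cond_entropy z0 <=
    \sum_x (z x - z0 x) * (ln (fiber_sum z0 (f x)) - ln (z0 x)).
  under [leRHS]eq_bigr do rewrite mulrBl.
  rewrite sumrB lerD2r; apply: gibbs => // x zx.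
  by have [->|xu] := eqVneq x u; [|exact: pos_of_pos].
have lnle x : 0 < z0 x -> ln (z0 x) <= ln (fiber_sum z0 (f x)).
  move=> zx; have h := le_fiber_sum x z0_ge0.
  by rewrite ler_ln ?posrE//; exact: lt_le_trans h.
have E2 : \sum_x (z x - z0 x) * (ln (fiber_sum z0 (f x)) - ln (z0 x)) <=
    M * (ln A - ln a) - inflow * (ln A - ln s).
  rewrite (bigD1 u)//= lerD2l (bigID (fun x => f x == f u))/=.
  rewrite -[leRHS]addr0; apply: lerD.
    rewrite /inflow mulr_suml -sumrN; apply: ler_sum => x /andP[xu fx].
    rewrite (eqP fx) -/A.
    have := z0_ge0 x; rewrite le_eqVlt => /orP[/eqP zx|zx].
      have := z_le xu; rewrite -zx => zx'.
      by rewrite (le_anti (introT andP (conj zx' (z_ge0 x)))) subrr !mul0r oppr0.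
    rewrite -mulNr opprB; apply: ler_wnM2l; first by rewrite subr_le0 z_le.
    rewrite lerD2l lerN2 ler_ln ?posrE ?le_s//; exact: lt_le_trans (le_s _ xu fx).
  apply: sumr_le0 => x /andP[xu _].
  have := z0_ge0 x; rewrite le_eqVlt => /orP[/eqP zx|zx].
    have := z_le xu; rewrite -zx => zx'.
    by rewrite (le_anti (introT andP (conj zx' (z_ge0 x)))) subrr !mul0r.
  by apply: mulr_le0_ge0; rewrite ?subr_le0 ?z_le// subr_ge0 lnle.
have [s00|s00] := eqVneq s 0.
  have F0 : inflow <= 0.
    apply: sumr_le0 => x /andP[xu fx]; rewrite subr_le0.
    by apply: le_trans (z_ge0 x); rewrite -s00 le_s.
  have Fz : inflow = 0 by apply/eqP; rewrite eq_le F0 inflow_ge0.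
  move: E E2; rewrite Fz mul0r subr0 => E E2; nra.
have sp : 0 < s by rewrite lt_def s00.
(* [a s <= A^2 / 4] since [A = a + s] *)
have ln4 : 1 <= (ln A - ln s) + (ln A - ln a).
  have h2 : 2^-1 <= ln (2 : R) by have := @ge_lnV R 2; lra.
  have h4 : ln (2 * 2 * (a * s)) <= ln (A * A).
    have sq := sqr_ge0 (a - s); rewrite ler_ln ?posrE ?mulr_gt0//.
    have -> : A * A = (a - s) ^+ 2 + 2 * 2 * (a * s) by rewrite AE expr2; ring.
    by rewrite lerDr.
  move: h4; rewrite (lnM (_ : 2 * 2 \is Num.pos)) ?posrE ?mulr_gt0//.
  rewrite (lnM (_ : 2 \is Num.pos)) ?posrE// (lnM (_ : a \is Num.pos)) ?posrE//.
  by rewrite (lnM (_ : A \is Num.pos)) ?posrE//; lra.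
have := ler_wpM2l inflow_ge0 ln4; have := ler_wpM2r B0 FM.
move: (le_trans E E2); lra.
Qed.

(** To avoid the logarithm of a small [z0 u], [gibbs] is applied with [q], where the mass of [u] is
    raised to 1/2. Then [u] costs at most 3/2 times 3 ln k and its siblings at most 1/2, which is
    below ln k. *)
Lemma entropy_low (k : nat) : (2 <= k)%N -> z0 u < 2^-1 -> z u <= 3 / 2 ->
  \sum_x z0 x = k%:R -> cond_entropy z - cond_entropy z0 <= 6 * ln k%:R.
Proof.
move=> k2 u0 zu zk; set A := fiber_sum z0 (f u); set a := z0 u in u0 *.
pose q x := if x == u then 2^-1 else z0 x.
have hp : 0 < 2^-1 :> R by rewrite invr_gt0.
have q_ge0 x : 0 <= q x by rewrite /q; case: ifP => // _; exact: ltW.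
have qQ p : p != f u -> fiber_sum q p = fiber_sum z0 p.
  move=> pu; apply: eq_bigr => x /eqP xp; rewrite /q ifN//.
  by apply: contraNneq pu => xu; rewrite -xp xu.
set s := \sum_(x | (x != u) && (f x == f u)) z0 x.
have s_ge0 : 0 <= s by apply: sumr_ge0.
have AE : A = a + s by exact: fiber_sumD1.
have QE : fiber_sum q (f u) = 2^-1 + s.
  rewrite /fiber_sum (bigD1 u)//= /q eqxx; congr (_ + _).
  rewrite (eq_bigl (fun x => (x != u) && (f x == f u))); last by move=> x; rewrite andbC.
  by apply: eq_bigr => x /andP[/negbTE->].
have Ak : A <= k%:R.
  by rewrite -zk (bigID (fun x => f x == f u))/= lerDl sumr_ge0.
have lnk : ln 2 <= ln (k%:R : R) by rewrite ler_ln ?posrE ?ltr0n ?ler_nat//; lia.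
have ln2 : 2^-1 <= ln (2 : R) by have := @ge_lnV R 2; lra.
have key x : x != u -> z x * (ln (fiber_sum q (f x)) - ln (q x))
    - z0 x * (ln (fiber_sum z0 (f x)) - ln (z0 x)) <=
    (if f x == f u then z0 x * (ln (2^-1 + s) - ln A) else 0).
  move=> xu; have qx : q x = z0 x by rewrite /q (negbTE xu).
  have fx := le_fiber_sum x z0_ge0.
  have := z0_ge0 x; rewrite le_eqVlt => /orP[/eqP zx|zx].
    have := z_le xu; rewrite -zx => zx'.
    rewrite (le_anti (introT andP (conj zx' (z_ge0 x)))) !mul0r subr0.
    by case: ifP.
  have zz := z_le xu; case: ifPn => [/eqP e|e]; last first.
    rewrite qx qQ// -mulrBl mulr_le0_ge0 ?subr_le0// subr_ge0 ler_ln ?posrE//.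
    exact: lt_le_trans fx.
  rewrite e QE qx -/A.
  have zs : z0 x <= s by rewrite /s (bigD1 x) ?xu ?e ?eqxx//= lerDl sumr_ge0.
  have : ln (z0 x) <= ln (2^-1 + s) by rewrite ler_ln ?posrE//; lra.
  nra.
have E : cond_entropy z - cond_entropy z0 <= \sum_x
    (z x * (ln (fiber_sum q (f x)) - ln (q x))
     - z0 x * (ln (fiber_sum z0 (f x)) - ln (z0 x))).
  rewrite sumrB lerD2r; apply: gibbs => // x zx; rewrite /q.
  by have [_|xu] := eqVneq x u; [|exact: pos_of_pos].
apply: le_trans E _; rewrite (bigD1 u)//=.
apply: (@le_trans _ _ (z u * (ln (2^-1 + s) - ln 2^-1) + s * (ln (2^-1 + s) - ln A))).
  apply: lerD.
    rewrite QE /q eqxx -/A -/a gerDl oppr_le0.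
    have := z0_ge0 u; rewrite le_eqVlt => /orP[/eqP zx|zx].
      by rewrite /a -zx mul0r.
    apply: mulr_ge0; first exact: ltW.
    have h := le_fiber_sum u z0_ge0.
    by rewrite subr_ge0 ler_ln ?posrE//; exact: lt_le_trans h.
  apply: le_trans (ler_sum _ (fun x xu => key x xu)) _.
  by rewrite -big_mkcondr/= -mulr_suml.
(* Used as [1 + 2 * s <= k ^ 3], since [s <= A <= k]; it needs [k >= 2]. *)
have k5 : (2 * k%:R + 1 <= k%:R ^+ 3 :> R).
  have : 2 <= (k%:R : R) by rewrite ler_nat.
  set K := k%:R : R; move=> K2; have -> : K ^+ 3 = K * (K * K) by rewrite !exprS expr0; ring.
  nra.
have L1 : ln (2^-1 + s) - ln 2^-1 <= 3 * ln (k%:R : R).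
  rewrite -ln_div ?posrE//; last by lra.
  have -> : 3 * ln (k%:R : R) = ln (k%:R ^+ 3).
    by rewrite lnXn ?ltr0n; [rewrite mulr_natl|lia].
  rewrite ler_ln ?posrE ?exprn_gt0 ?ltr0n//; [|rewrite divr_gt0//; lra|lia].
  by rewrite invrK; have := z0_ge0 u; rewrite -/a; lra.
have L0 : 0 <= ln (2^-1 + s) - ln 2^-1 by rewrite subr_ge0 ler_ln ?posrE//; lra.
have L2 : s * (ln (2^-1 + s) - ln A) <= 2^-1.
  have [->|sn] := eqVneq s 0; first by rewrite mul0r ltW.
  have sp : 0 < s by rewrite lt_def sn.
  have a0 : 0 <= a := z0_ge0 u.
  have Ap : 0 < A by lra.
  have := @le_lnB1 R ((2^-1 + s) / A); rewrite ln_div ?posrE//; last by lra.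
  rewrite divr_gt0//; last by lra.
  move=> /(_ isT) h; apply: le_trans (ler_wpM2l s_ge0 h) _.
  have -> : s * ((2^-1 + s) / A - 1) = (s / A) * (2^-1 + s - A).
    by field; rewrite gt_eqF.
  have s1 : s / A <= 1 by rewrite ler_pdivrMr// mul1r; lra.
  have s2 : 0 <= s / A by rewrite divr_ge0// ltW.
  nra.
have := z_ge0 u; nra.
Qed.

End OneLevel.

(** * Movement of the fractional algorithm *)

Section Movement.
Variables (R : realType) (X : finType) (H : nat) (par : nat -> X -> X) (o : X).
Variables (k : nat) (w : nat -> R).
Hypotheses (H_gt0 : (0 < H)%N) (par_root : forall x, par H.-1 x = o).
Hypotheses (k_ge2 : (2 <= k)%N) (w_gt0 : forall n, 0 < w n).
Hypothesis w_geo : forall n, \sum_(m < n.+1) w m <= 2 * w n.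
Local Notation ms := (mass par).
Local Notation anc := (anc par).
Implicit Types m : X -> R.

Definition tree_move m0 m : R :=
  \sum_(n < H) w n * \sum_x `|ms m n x - ms m0 n x|.

Definition tree_entropy m : R :=
  \sum_(n < H) w n * cond_entropy (par n) (ms m n).

Lemma mass_ge0 m n x : (forall l, 0 <= m l) -> 0 <= ms m n x.
Proof. by move=> m0; apply: sumr_ge0. Qed.

Lemma tree_entropy_ge0 m : (forall l, 0 <= m l) -> 0 <= tree_entropy m.
Proof.
move=> m0; apply: sumr_ge0 => n _; apply: mulr_ge0; first exact: ltW.
apply: sumr_ge0 => x _; have mx := mass_ge0 n x m0.
have := le_fiber_sum (par n) x (fun x => mass_ge0 n x m0).
move: mx; rewrite le_eqVlt => /orP[/eqP<-|mx] h; first by rewrite mul0r.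
apply: mulr_ge0; first exact: ltW.
by rewrite subr_ge0 ler_ln ?posrE//; exact: lt_le_trans h.
Qed.

Variables (m0 m : X -> R) (r : X) (D : R).
Hypotheses (m0_ge0 : forall l, 0 <= m0 l) (m_ge0 : forall l, 0 <= m l).
Hypotheses (sum_m0 : \sum_l m0 l = k%:R) (sum_m : \sum_l m l = k%:R).
Hypotheses (m_le : forall l, l != r -> m l <= m0 l) (m_r : m r - m0 r <= 1).
Hypotheses (m_r_ge : 3 / 4 <= m r) (D_ge0 : 0 <= D).
Let u n := anc n r.
Let M n := ms m n (u n) - ms m0 n (u n).
Hypothesis inflow_le : forall n, (n < H)%N -> w n * M n <= 2 * D.

Let mass_le n x : x != u n -> ms m n x <= ms m0 n x.
Proof.
move=> xu; apply: ler_sum => l /eqP lx; apply: m_le.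
by apply: contraNneq xu => lr; rewrite -lx lr.
Qed.

Let ME n : M n = \sum_(x | x != u n) (ms m0 n x - ms m n x).
Proof.
have : \sum_x ms m n x = \sum_x ms m0 n x by rewrite !sum_mass sum_m sum_m0.
by rewrite (bigD1 (u n))//= [RHS](bigD1 (u n))//= sumrB /M; lra.
Qed.

Let M_ge0 n : 0 <= M n.
Proof. by rewrite ME; apply: sumr_ge0 => x xu; rewrite subr_ge0 mass_le. Qed.

Let M_le1 n : M n <= 1.
Proof.
apply: le_trans m_r; rewrite /M /mass -sumrB (bigD1 r) ?eqxx//= gerDl.
by apply: sumr_le0 => l /andP[_ lr]; rewrite subr_le0 m_le.
Qed.

Let MH : M H = 0.
Proof.
rewrite ME big1// => x xo; rewrite /mass !big1 ?subrr// => l;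
  by rewrite /u !(ancH H_gt0 par_root) in xo * => /eqP oE; rewrite oE eqxx in xo.
Qed.

Let inflowE n : \sum_(x | (x != u n) && (par n x == par n (u n)))
  (ms m0 n x - ms m n x) = M n - M n.+1.
Proof.
have E (m' : X -> R) : ms m' n.+1 (u n.+1) = ms m' n (u n) +
    \sum_(x | (x != u n) && (par n x == par n (u n))) ms m' n x.
  rewrite massS (bigD1 (u n)) ?eqxx//=; congr (_ + _).
  by apply: eq_bigl => x; rewrite andbC.
by rewrite sumrB /M !E; lra.
Qed.

Let move_level n : \sum_x `|ms m n x - ms m0 n x| = 2 * M n.
Proof.
rewrite (bigD1 (u n))//= ger0_norm; last exact: M_ge0.
rewrite -/(M n) (eq_bigr (fun x => ms m0 n x - ms m n x)) -?ME; first by ring.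
by move=> x xu; rewrite distrC ger0_norm// subr_ge0 mass_le.
Qed.

(** Abel summation, [W] being the partial sums of the weights. *)
Let abel N (W : nat -> R) : W 0%N = 0 -> (forall n, W n.+1 = W n + w n) ->
  \sum_(n < N) w n * M n = \sum_(n < N) W n.+1 * (M n - M n.+1) + W N * M N.
Proof.
move=> W0 WS; elim: N => [|N IH]; first by rewrite !big_ord0 W0 mul0r addr0.
by rewrite big_ord_recr [in RHS]big_ord_recr/= IH WS; ring.
Qed.

Let a n := ms m0 n (u n).
Let low n := a n < 2^-1.
(** Truncated at 1/2, so that the logarithm grows by at most 2 ln k along the path. *)
Let L n := ln (Num.max (a n) 2^-1).

(** At the highest low level [N] the ancestor rises from below 1/2 to at least 3/4, so
    [w N <= 4 * w N * M N <= 8 * D]; geometric growth bounds all the weights up to [N] by twice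
    this. *)
Let low_weight N : (N <= H)%N -> \sum_(n < N | low n) w n <= 16 * D.
Proof.
elim: N => [|N IH] NH; first by rewrite big_ord0 mulr_ge0.
rewrite big_mkcond big_ord_recr/= -big_mkcond/=; case: ifPn => lN; last first.
  by rewrite addr0 IH// ltnW.
have hM : 4^-1 <= M N.
  have : m r <= ms m N (u N) by rewrite /mass (bigD1 r) ?eqxx//= lerDl sumr_ge0.
  move: lN; rewrite /low /a /M; move: m_r_ge => h1 h2 h3; lra.
apply: (@le_trans _ _ (2 * w N)); last by have := inflow_le NH; have := w_gt0 N; nra.
apply: le_trans (w_geo N); rewrite big_ord_recr/= lerD2r big_mkcond.
by apply: ler_sum => n _; case: ifP => // _; exact: ltW.
Qed.

Let ln2k : ln 2 <= ln (k%:R : R).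
Proof. by rewrite ler_ln ?posrE ?ltr0n ?ler_nat//; lia. Qed.

Let ln2 : 2^-1 <= ln (2 : R).
Proof. by have := @ge_lnV R 2; lra. Qed.

Let fiber_massE m' n p : fiber_sum (par n) (ms m' n) p = ms m' n.+1 p.
Proof. by rewrite massS. Qed.

Let a_le n : a n <= a n.+1.
Proof.
rewrite /a -fiber_massE; apply: (le_fiber_sum (par n)) => x.
exact: mass_ge0.
Qed.

Let half_gt0 : 0 < 2^-1 :> R. Proof. by rewrite invr_gt0. Qed.

Let L_le n : L n <= L n.+1.
Proof.
rewrite /L ler_ln ?posrE ?lt_max ?half_gt0 ?orbT//.
by rewrite ge_max !le_max a_le lexx orbT.
Qed.

(** At a low level, 6 ln k is the entropy change and 2 ln k bounds [M n - M n.+1 <= 1]. At a high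
    level, 4 is the 2 of [entropy_high] times the 2 of [inflow_le]. *)
Let level_bound n : (n < H)%N -> w n * (M n - M n.+1) +
  (w n * cond_entropy (par n) (ms m n) - w n * cond_entropy (par n) (ms m0 n)) <=
  4 * D * (L n.+1 - L n) + (if low n then 8 * ln k%:R * w n else 0).
Proof.
move=> nH; rewrite -mulrBr -mulrDr; have wn := w_gt0 n.
have h0 x : 0 <= ms m0 n x by exact: mass_ge0.
have h x : 0 <= ms m n x by exact: mass_ge0.
case: ifPn => lo.
  have lowE := entropy_low (par n) h0 h (@mass_le n) k_ge2 lo.
  have {}lowE : cond_entropy (par n) (ms m n) - cond_entropy (par n) (ms m0 n)
      <= 6 * ln k%:R.
    apply: lowE; last by rewrite sum_mass sum_m0.
    by have := M_le1 n; move: lo; rewrite /low /M /a; lra.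
  have F1 : M n - M n.+1 <= 2 * ln k%:R.
    by have := M_le1 n; have := M_ge0 n.+1; have := ln2k; have := ln2; lra.
  have DL : 0 <= 4 * D * (L n.+1 - L n).
    by rewrite mulr_ge0 ?subr_ge0 ?L_le// mulr_ge0.
  by nra.
rewrite addr0 -leNgt in lo *.
have a0 : 0 < a n by exact: lt_le_trans lo.
have := entropy_high (f := par n) h0 h (@mass_le n) a0 (M_ge0 n).
rewrite inflowE => /(_ _) hi.
have {}hi := hi (_ : M n - M n.+1 <= ms m n (u n) - ms m0 n (u n)).
have FM : M n - M n.+1 <= ms m n (u n) - ms m0 n (u n).
  by rewrite -/(M n) gerBl M_ge0.
have := hi FM; rewrite fiber_massE -[ms m0 n (u n)]/(a n) -/(M n).
rewrite -[par n (u n)]/(u n.+1) -[ms m0 n.+1 _]/(a n.+1) => {}hi.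
have LE : L n.+1 - L n = ln (a n.+1) - ln (a n).
  by rewrite /L !max_l//; exact: le_trans (a_le n).
have L0 : 0 <= L n.+1 - L n by rewrite subr_ge0 L_le.
rewrite -LE in hi; apply: le_trans (ler_wpM2l (ltW wn) hi) _.
have := ler_wpM2r L0 (inflow_le nH); rewrite -/(M n); lra.
Qed.

(** 544 = 4 (4 * 2 + 8 * 16). The outer 4 is 2 for counting each transfer at both ends times 2 for
    Abel summation; inside are the growth of [L], at rate [4 * D], and the low levels, of total
    weight [16 * D]. *)
Lemma tree_move_le : tree_move m0 m <=
  544 * ln k%:R * D + 4 * (tree_entropy m0 - tree_entropy m).
Proof.
have -> : tree_move m0 m = 2 * \sum_(n < H) w n * M n.
  by rewrite mulr_sumr; apply: eq_bigr => n _; rewrite move_level; ring.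
have h1 : \sum_(n < H) w n * M n <= 2 * \sum_(n < H) w n * (M n - M n.+1).
  rewrite (@abel H (fun n => \sum_(j < n) w j)) ?big_ord0// => [|n]; last first.
    by rewrite big_ord_recr.
  rewrite MH mulr0 addr0 mulr_sumr; apply: ler_sum => n _; rewrite mulrA.
  apply: ler_wpM2r (w_geo n); rewrite -inflowE; apply: sumr_ge0 => x /andP[xu _].
  by rewrite subr_ge0 mass_le.
have h2 : \sum_(n < H) w n * (M n - M n.+1) + (tree_entropy m - tree_entropy m0) <=
    4 * D * (L H - L 0%N) + 8 * ln k%:R * \sum_(n < H | low n) w n.
  rewrite /tree_entropy -sumrB -big_split/=.
  apply: le_trans (ler_sum _ (fun n _ => level_bound (ltn_ord n))) _.
  rewrite big_split/=; apply: lerD.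
    rewrite -mulr_sumr -(telescope_sumr L (leq0n H)) big_mkord.
    by rewrite lexx.
  by rewrite [in leRHS]big_mkcond mulr_sumr; apply: ler_sum => n _; case: ifP; rewrite ?mulr0.
have h3 := low_weight (leqnn H).
have h4 : L H - L 0%N <= 2 * ln k%:R.
  have LH : L H = ln k%:R.
    have aH : a H = k%:R.
      rewrite /a /mass -sum_m0; apply: eq_bigl => l.
      by rewrite /u !(ancH H_gt0 par_root) eqxx.
    rewrite /L aH max_l//; have : (2 <= k%:R :> R) by rewrite ler_nat.
    lra.
  have : - ln 2 <= L 0%N.
    rewrite -lnV ?posrE// /L ler_ln ?posrE//; first by rewrite le_max lexx orbT.
    by rewrite lt_max half_gt0 orbT.
  by rewrite LH; have := ln2k; lra.
have lk : 0 <= ln (k%:R : R) by have := ln2k; have := ln2; lra.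
have : 4 * D * (L H - L 0%N) <= 4 * D * (2 * ln k%:R).
  by apply: ler_wpM2l => //; rewrite mulr_ge0.
have : 8 * ln k%:R * \sum_(n < H | low n) w n <= 8 * ln k%:R * (16 * D).
  by apply: ler_wpM2l => //; rewrite mulr_ge0.
lra.
Qed.

End Movement.

(** * Competitiveness of the fractional algorithm *)

Section Fractional.
Variables (R : realType) (X : finType) (H : nat) (par : nat -> X -> X) (o : X).
Variables (k : nat) (w : nat -> R) (dl : R).
Hypotheses (H_gt0 : (0 < H)%N) (par_root : forall x, par H.-1 x = o).
Hypotheses (k_ge2 : (2 <= k)%N) (w_gt0 : forall n, 0 < w n).
Hypothesis w_geo : forall n, \sum_(m < n.+1) w m <= 2 * w n.
Hypotheses (dl_gt0 : 0 < dl) (dl_le : dl <= 4^-1).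
Local Notation T := (nat * X * 'I_k)%type.
Local Notation state := (server_state H par o).
Local Notation polytope := (polytope H par o).
Local Notation tmove := (tree_move H par w).
Implicit Types (z y : T -> R).

Definition leaf_mass z : X -> R := node_mass z 0.

Let k_gt0 : (0 < k)%N. Proof. exact: ltnW. Qed.
Let i0 : 'I_k := Ordinal k_gt0.

Lemma leaf_mass_ge0 z x : state z -> 0 <= leaf_mass z x.
Proof. by move=> sz; exact: (node_mass_ge0 x sz). Qed.

Lemma fractional_step z0 r : state z0 -> exists z, [/\ state z,
  1 - dl <= leaf_mass z r &
  forall y, polytope y -> y (0%N, r, i0) = 1 ->
    tmove (leaf_mass z0) (leaf_mass z) <= 544 * ln k%:R *
      (potential H w dl y z0 - potential H w dl y z)
    + 4 * (tree_entropy H par w (leaf_mass z0) - tree_entropy H par w (leaf_mass z))].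
Proof.
move=> s0; have [z [D [sz zr zle zD [D0 Dy]]]] :=
  @projection_step R X H par o k w dl z0 r i0 H_gt0 par_root w_gt0 dl_gt0 erefl s0.
have zri : z (0%N, r, i0) <= leaf_mass z r.
  rewrite /leaf_mass /node_mass (bigD1 i0)//= lerDl; apply: sumr_ge0 => i _.
  exact: (ss_ge0 sz).
exists z; split => //; first exact: le_trans zr zri.
move=> y Ky yr; have := @tree_move_le R X H par o k w H_gt0 par_root k_ge2 w_gt0 w_geo
  (leaf_mass z0) (leaf_mass z) r D.
have lm x : state x -> \sum_l leaf_mass x l = k%:R.
  by move=> sx; exact: (sum_node_mass sx).
move=> /(_ (fun x => leaf_mass_ge0 x s0) (fun x => leaf_mass_ge0 x sz) (lm _ s0) (lm _ sz)).
move=> h; apply: le_trans (h _ _ _ _ _) _ => //.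
- by move=> l lr; apply: ler_sum => i _; apply: zle; rewrite xpair_eqE (negbTE lr).
(* At the leaf [r] only the slot [i0] can gain, and by at most 1. *)
- rewrite /leaf_mass /node_mass -sumrB (bigD1 i0)//=.
  have h1 := polytope_le1 H_gt0 r i0 (ss_polytope sz) (leq0n H).
  have h2 := ss_ge0 s0 r i0 H_gt0.
  apply: (@le_trans _ _ (1 + 0)); last by rewrite addr0.
  apply: lerD; first by lra.
  by apply: sumr_le0 => i ii; rewrite subr_le0; apply: zle; rewrite xpair_eqE eqxx.
- by move: zr zri dl_le => *; lra.
- move=> n nH; have := zD n nH.
  by rewrite (node_mass_leaves _ sz (ltnW nH)) (node_mass_leaves _ s0 (ltnW nH)).
apply: lerD => //; apply: ler_wpM2l; last by rewrite lerBrDl; exact: Dy.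
apply: mulr_ge0; first exact: ler0n.
by rewrite ln_ge0// ler1n.
Qed.

Lemma potential_ge0 y z : polytope y -> state z -> 0 <= potential H w dl y z.
Proof.
move=> Ky sz; apply: sumr_ge0 => n _; apply: sumr_ge0 => x _; apply: sumr_ge0 => i _.
have nH := ltn_ord n; apply: mulr_ge0; first exact: ltW.
apply: mulr_ge0; first by apply: ltW; exact: (antiserver_gt0 H_gt0 dl_gt0 _ _ Ky (ltnW nH)).
have z1 := antiserver_gt0 H_gt0 dl_gt0 x i (ss_polytope sz) (ltnW nH).
rewrite ln_ge0// (ler_pdivlMr _ _ z1) mul1r /antiserver.
by have := ss_ge0 sz x i nH; lra.
Qed.

(** Makes the slot encoding of counts an isometry, so that offline movement can be measured on
    masses. *)
Lemma sum_abs_ltn (a b : nat) : (a <= k)%N -> (b <= k)%N ->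
  \sum_(i < k) `|(i < a)%N%:R - (i < b)%N%:R| = `|a%:R - b%:R : R|.
Proof.
wlog ab : a b / (b <= a)%N.
  move=> h ak bk; have [ba|/ltnW ab] := leqP b a; first exact: h.
  by rewrite distrC -h//; apply: eq_bigr => i _; rewrite distrC.
move=> ak bk.
have E c : (c <= k)%N -> \sum_(i < k) (i < c)%N%:R = c%:R :> R.
  move=> ck; rewrite -natr_sum; congr _%:R.
  rewrite (eq_bigl (fun i : 'I_k => (i < k)%N)) => [|i]; last by rewrite ltn_ord.
  by rewrite (sum_ord_lt k ck); exact/minn_idPr.
rewrite ger0_norm ?subr_ge0 ?ler_nat// -[in RHS]E// -[in X in _ - X]E// -sumrB.
apply: eq_bigr => i _; rewrite ger0_norm// subr_ge0 ler_nat.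
by have [ib|] := ltnP i b => //; rewrite (leq_trans ib ab).
Qed.


Lemma mass_natr (N : X -> nat) n x : mass par (fun x => (N x)%:R : R) n x = (mass par N n x)%:R.
Proof. by rewrite /mass natr_sum. Qed.

(** The potential is linear in [xs y], and its slopes per unit of weight lie between 0 and
    [ln ((1 + dl) / dl)]. *)
Lemma potential_lipschitz (N N' : X -> nat) z : \sum_x N x = k -> \sum_x N' x = k ->
  state z -> potential H w dl (count_point R par N') z <=
    potential H w dl (count_point R par N) z
    + ln ((1 + dl) / dl) * tmove (fun x => (N x)%:R) (fun x => (N' x)%:R).
Proof.
move=> Nk N'k sz; rewrite -lerBlDl -[- potential _ _ _ _ _]mulN1r -tsumZ -tsumD.
rewrite /tree_move mulr_sumr; apply: ler_sum => n _.
rewrite mulrCA mulr_sumr mulr_sumr; apply: ler_sum => x _.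
have Mk (N1 : X -> nat) : \sum_x N1 x = k -> (mass par N1 n x <= k)%N.
  by move=> <-; rewrite -(sum_mass par N1 n) (bigD1 x)//= leq_addr.
rewrite !mass_natr -(sum_abs_ltn (Mk _ N'k) (Mk _ Nk)) !mulr_sumr.
apply: ler_sum => i _; rewrite mulN1r -mulrBr; apply: ler_wpM2l; first exact: ltW.
rewrite -mulrBl /antiserver /count_point/=.
set b := (_ < _)%N%:R; set b' := (_ < mass par N n x)%N%:R.
have nH := ltn_ord n.
have z1 := antiserver_ge H_gt0 dl x i (ss_polytope sz) (ltnW nH).
have z2 : antiserver dl z (n : nat, x, i) <= 1 + dl.
  by rewrite /antiserver; have := ss_ge0 sz x i nH; lra.
rewrite -/(antiserver dl z (n : nat, x, i)).
set v := antiserver dl z _ in z1 z2 *.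
have v0 : 0 < v by exact: lt_le_trans dl_gt0 z1.
have l0 : 0 <= ln ((1 + dl) / v) by rewrite ln_ge0// (ler_pdivlMr _ _ v0) mul1r.
have l1 : ln ((1 + dl) / v) <= ln ((1 + dl) / dl).
  have d1 : 0 < 1 + dl by rewrite addr_gt0.
  by rewrite ler_ln ?posrE ?divr_gt0// ler_pM2l// lef_pV2 ?posrE.
have -> : 1 + dl - b - (1 + dl - b') = b' - b by ring.
apply: (@le_trans _ _ (`|b - b'| * ln ((1 + dl) / v))).
  by apply: ler_wpM2r => //; rewrite distrC ler_norm.
by rewrite mulrC ler_wpM2r.
Qed.

Lemma count_point_state (N : X -> nat) : \sum_x N x = k ->
  state (count_point R par N : T -> R).
Proof.
move=> Nk; split.
- exact: (count_point_polytope R H_gt0 par_root Nk).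
- by move=> n x i _; exact: ler0n.
- move=> n x i j _ ij; rewrite ler_nat /=.
  by have [jm|] := ltnP j (mass par N n x) => //; rewrite (leq_ltn_trans ij jm).
- move=> n p _; rewrite /node_mass sum_count_point// massS natr_sum.
  by apply: eq_bigr => x _; rewrite sum_count_point.
Qed.

(** Amortization: the movement is charged to 544 ln k times the potential plus 4 times the entropy.
    The masses [m] depend on past requests only; the offline counts [N] are quantified after
    them. *)
Theorem fractional_algorithm (N0 : X -> nat) : \sum_x N0 x = k ->
  exists (m : seq X -> X -> R) (c : R),
  [/\ m [::] = (fun x => (N0 x)%:R), forall s x, 0 <= m s x,
    forall s, \sum_x m s x = k%:R, forall s r, 1 - dl <= m (rcons s r) r &
    forall (r : nat -> X) (N : nat -> X -> nat), N 0%N = N0 ->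
      (forall t, \sum_x N t x = k) -> (forall t, (0 < N t.+1 (r t))%N) -> forall t,
      \sum_(j < t) tmove (m (mkseq r j)) (m (mkseq r j.+1)) <=
      544 * ln k%:R * ln ((1 + dl) / dl) *
        (\sum_(j < t) tmove (fun x => (N j x)%:R) (fun x => (N j.+1 x)%:R)) + c].
Proof.
move=> N0k; pose z0 : T -> R := count_point R par N0.
(* Conditional on [state z] so that [step] can be chosen as a total function; the invariant is then
   proved along the run. *)
pose good z r z' := state z -> [/\ state z', 1 - dl <= leaf_mass z' r &
  forall y, polytope y -> y (0%N, r, i0) = 1 ->
    tmove (leaf_mass z) (leaf_mass z') <= 544 * ln k%:R *
      (potential H w dl y z - potential H w dl y z')
    + 4 * (tree_entropy H par w (leaf_mass z) - tree_entropy H par w (leaf_mass z'))].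
have /boolp.choice[step stepP] : forall e, exists z', good e.1 e.2 z'.
  move=> [z r] /=.
  have [sz|nsz] := pselect (state z); last by exists z => /nsz.
  by have [z' h] := fractional_step r sz; exists z' => _.
pose zs (s : seq X) := foldl (fun z r => step (z, r)) z0 s.
have zsS s r : zs (rcons s r) = step (zs s, r) by rewrite /zs foldl_rcons.
have zs_state s : state (zs s).
  elim/last_ind: s => [|s r IH]; first exact: count_point_state.
  by rewrite zsS; have [] := stepP (zs s, r) IH.
have lk : 0 <= ln (k%:R : R) by rewrite ln_ge0// ler1n.
pose Phi N z := potential H w dl (count_point R par N : T -> R) z.
pose Psi z := tree_entropy H par w (leaf_mass z).
exists (fun s => leaf_mass (zs s)), (544 * ln k%:R * Phi N0 z0 + 4 * Psi z0); split.
- apply/funext => x; rewrite /leaf_mass /node_mass sum_count_point//.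
  by rewrite /mass/= (big_pred1 x).
- by move=> s x; exact: leaf_mass_ge0.
- by move=> s; exact: (sum_node_mass (zs_state s)).
- by move=> s r; rewrite zsS; have [] := stepP (zs s, r) (zs_state s).
move=> r N N00 Nk Nr t.
suff : \sum_(j < t) tmove (leaf_mass (zs (mkseq r j))) (leaf_mass (zs (mkseq r j.+1)))
    + 544 * ln k%:R * Phi (N t) (zs (mkseq r t)) + 4 * Psi (zs (mkseq r t)) <=
    544 * ln k%:R * ln ((1 + dl) / dl) *
      (\sum_(j < t) tmove (fun x => (N j x)%:R) (fun x => (N j.+1 x)%:R))
    + (544 * ln k%:R * Phi N0 z0 + 4 * Psi z0).
  apply: le_trans; rewrite -addrA lerDl; apply: addr_ge0; last first.
    apply: mulr_ge0; first exact: ler0n.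
    by apply: tree_entropy_ge0 => // l; exact: leaf_mass_ge0.
  apply: mulr_ge0; first exact: mulr_ge0 (ler0n _ _) lk.
  apply: potential_ge0 => //; exact: (count_point_polytope R H_gt0 par_root (Nk t)).
elim: t => [|t IH]; first by rewrite !big_ord0 mulr0 N00 !add0r.
rewrite !big_ord_recr/=.
have mkS : mkseq r t.+1 = rcons (mkseq r t) (r t).
  by rewrite /mkseq -addn1 iotaD map_cat/= cats1.
have [_ _ h] := stepP (zs (mkseq r t), r t) (zs_state _).
have {h} := h (count_point R par (N t.+1)) _ _.
rewrite -zsS -mkS /= => /(_ (count_point_polytope R H_gt0 par_root (Nk _))) h.
have {h} := h _; rewrite {1}/count_point/=.
have -> : mass par (N t.+1) 0 (r t) = N t.+1 (r t) by rewrite /mass/= (big_pred1 (r t)).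
rewrite Nr => /(_ erefl); rewrite -!/(Phi _ _) -!/(Psi _) => h1.
have h2 := potential_lipschitz (Nk t) (Nk t.+1) (zs_state (mkseq r t)).
have := ler_wpM2l (mulr_ge0 (ler0n R 544) lk) h2.
rewrite -!/(Phi _ _); move: IH h1.
set S1 := \sum_(j < t) _; set S2 := \sum_(j < t) _.
set a := tmove _ _; set b := tmove _ _.
lra.
Qed.

End Fractional.

(** * Rounding of laminar flows *)

Section IntBox.
Variable R : realType.
Implicit Types (x : R) (c : int).

Definition fl x : R := (Num.floor x)%:~R.
Definition ce x : R := - fl (- x).

Lemma fl_le x : fl x <= x. Proof. by rewrite /fl; have /andP[] := floor_itv x. Qed.

Lemma fl_gt x : x - 1 < fl x.
Proof. by rewrite /fl; have /andP[_] := floor_itv x; rewrite intrD ltrBlDr. Qed.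

Lemma ce_ge x : x <= ce x. Proof. by rewrite /ce lerNr fl_le. Qed.

Lemma ce_lt x : ce x < x + 1.
Proof. by have := fl_gt (- x); rewrite /ce; lra. Qed.

Lemma le_fl c x : c%:~R <= x -> c%:~R <= fl x.
Proof.
move=> cx; rewrite /fl ler_int -ltzD1 -(ltr_int R) intrD.
by apply: le_lt_trans cx _; have := fl_gt x; rewrite /fl; lra.
Qed.

Lemma ge_ce c x : x <= c%:~R -> ce x <= c%:~R.
Proof.
by move=> xc; rewrite /ce lerNl -intrN; apply: le_fl; rewrite intrN lerN2.
Qed.

Lemma fl_int x : fl x \is a Num.int. Proof. exact: intr_int. Qed.

Lemma ce_int x : ce x \is a Num.int.
Proof. by rewrite /ce rpredN fl_int. Qed.

Lemma fl_lt_nint x : x \isn't a Num.int -> fl x < x.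
Proof.
move=> xn; rewrite lt_def fl_le andbT; apply: contraNneq xn => ->; exact: fl_int.
Qed.

Lemma ce_gt_nint x : x \isn't a Num.int -> x < ce x.
Proof.
by move=> xn; rewrite lt_def ce_ge andbT; apply: contraNneq xn => <-; exact: ce_int.
Qed.

Lemma ce_fl1 x : ce x <= fl x + 1.
Proof.
have : x <= (Num.floor x + 1)%:~R by rewrite intrD; have := fl_gt x; rewrite /fl; lra.
by move=> /ge_ce; rewrite intrD.
Qed.

Lemma near_int_box v x : v \is a Num.int -> `|v - x| < 1 -> fl x <= v <= ce x.
Proof.
move=> /intrP[c ->]; rewrite ltr_norml => /andP[h1 h2]; apply/andP; split.
  have /intrP[d dE] := fl_int x; rewrite dE ler_int -ltzD1 -(ltr_int R) intrD -dE.
  by have := fl_le x; lra.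
have /intrP[d dE] := ce_int x; rewrite dE ler_int -ltzD1 -(ltr_int R) intrD -dE.
by have := ce_ge x; lra.
Qed.

(** All atoms move upwards, so the cost is the difference of the means. If [ce s <= s'], the
    constant [s'] works; otherwise both means lie in one unit cell and each atom covers the fraction
    [th] of its way to [ce s]. The values of [y] need not be integers. *)
Lemma push_up (W : finType) (p v : W -> R) (s s' : R) :
  (forall i, 0 <= p i) -> \sum_i p i = 1 -> \sum_i p i * v i = s ->
  (forall i, v i \is a Num.int) -> (forall i, 0 < p i -> `|v i - s| < 1) -> s <= s' ->
  exists y : W -> R, [/\ forall i, fl s' <= y i <= ce s',
    \sum_i p i * y i = s' & \sum_i p i * `|y i - v i| = `|s' - s|].
Proof.
move=> p0 p1 pv vi vs ss'.
have mean (c : R) : \sum_i p i * c = c by rewrite -mulr_suml p1 mul1r.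
suff [y [yb ym yv]] : exists y : W -> R, [/\ forall i, fl s' <= y i <= ce s',
    \sum_i p i * y i = s' & forall i, 0 < p i -> v i <= y i].
  exists y; split => //; rewrite ger0_norm ?subr_ge0// -pv -ym -sumrB.
  apply: eq_bigr => i _; rewrite -mulrBr.
  have := p0 i; rewrite le_eqVlt => /orP[/eqP<-|pi]; first by rewrite !mul0r.
  by rewrite ger0_norm// subr_ge0 yv.
have v_le i : 0 < p i -> v i <= ce s.
  by move=> pi; have /andP[] := near_int_box (vi i) (vs i pi).
have v_ge i : 0 < p i -> fl s <= v i.
  by move=> pi; have /andP[] := near_int_box (vi i) (vs i pi).
have [cs|cs] := leP (ce s) s'.
  exists (fun=> s'); split; [by move=> i; rewrite fl_le ce_ge|exact: mean|].
  by move=> i pi; apply: le_trans (v_le i pi) cs.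
have sc : s < ce s by exact: le_lt_trans ss' cs.
pose th := (s' - s) / (ce s - s).
have th0 : 0 <= th by rewrite divr_ge0 ?subr_ge0// ltW.
have th1 : th <= 1 by rewrite ler_pdivrMr ?subr_gt0// mul1r; lra.
(* An atom of probability 0 may be far from [s]; the value [s'] keeps it in the box. *)
pose y i := if p i == 0 then s' else v i + th * (ce s - v i).
have fs : fl s <= fl s' by have /intrP[c cE] := fl_int s; rewrite cE; apply: le_fl; rewrite -cE (le_trans (fl_le s)).
have s'i : s' \isn't a Num.int.
  apply/negP => /intrP[c cE]; have := @ge_ce c s; rewrite -cE => /(_ ss').
  by rewrite leNgt cs.
have fs' : fl s' = fl s.
  apply/eqP; rewrite eq_le fs andbT; have /intrP[d dE] := fl_int s.
  have /intrP[c cE] := fl_int s'; rewrite dE cE ler_int -ltzD1 -(ltr_int R) intrD -cE -dE.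
  apply: le_lt_trans (fl_le s') _; exact: lt_le_trans cs (ce_fl1 s).
have cs' : ce s <= ce s'.
  have /intrP[c cE] := ce_int s'; rewrite cE; apply: ge_ce; rewrite -cE.
  exact: le_trans ss' (ce_ge s').
exists y; split.
- move=> i; rewrite /y; case: eqVneq => [_|pi]; first by rewrite fl_le ce_ge.
  have pi0 : 0 < p i by rewrite lt_def pi p0.
  have h1 := v_ge i pi0; have h2 := v_le i pi0; rewrite fs'.
  apply/andP; split; first by nra.
  by apply: le_trans cs'; nra.
- have -> : \sum_i p i * y i = \sum_i ((1 - th) * (p i * v i) + p i * (th * ce s)).
    apply: eq_bigr => i _; rewrite /y; case: eqVneq => [->|_]; first by rewrite !mul0r mulr0 addr0.
    by ring.
  rewrite big_split/= -mulr_sumr pv mean /th.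
  have : ce s - s != 0 by rewrite gt_eqF// subr_gt0.
  by move: (ce s) => C nz; field.
- move=> i pi; rewrite /y gt_eqF// lerDl mulr_ge0// subr_ge0 v_le//.
Qed.

Lemma push (W : finType) (p v : W -> R) (s s' : R) :
  (forall i, 0 <= p i) -> \sum_i p i = 1 -> \sum_i p i * v i = s ->
  (forall i, v i \is a Num.int) -> (forall i, 0 < p i -> `|v i - s| < 1) ->
  exists y : W -> R, [/\ forall i, fl s' <= y i <= ce s',
    \sum_i p i * y i = s' & \sum_i p i * `|y i - v i| = `|s' - s|].
Proof.
move=> p0 p1 pv vi vs; have [ss|/ltW ss] := leP s s'; first exact: (push_up p0 p1 pv).
have [||||y [yb ym yv]] := @push_up W p (fun i => - v i) (- s) (- s') p0 p1.
- by rewrite -pv -sumrN; apply: eq_bigr => i _; rewrite mulrN.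
- by move=> i; rewrite rpredN.
- by move=> i pi; rewrite -opprD normrN vs.
- by rewrite lerN2.
exists (fun i => - y i); split.
- by move=> i; have := yb i; rewrite /ce opprK => /andP[h1 h2]; rewrite lerNr h2 lerN2 h1.
- by rewrite -[RHS]opprK -ym -sumrN; apply: eq_bigr => i _; rewrite mulrN.
- have -> : `|s' - s| = `|- s' - - s| by rewrite -opprD normrN.
  by rewrite -yv; apply: eq_bigr => i _; rewrite -[in RHS]normrN opprD opprK; congr (_ * `|_|); ring.
Qed.

End IntBox.

Lemma anc_eq (X : Type) (par : nat -> X -> X) n m a b : (n <= m)%N ->
  anc par n a = anc par n b -> anc par m a = anc par m b.
Proof.
move=> nm E; rewrite -(subnK nm); elim: (m - n)%N => //= j IH.
by rewrite IH.
Qed.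

(** * Integral decomposition of masses on a tree *)

Section Laminar.
Variables (R : realType) (X : finType) (H : nat) (par : nat -> X -> X) (o : X).
Variable B : nat.
Hypotheses (H_gt0 : (0 < H)%N) (par_root : forall x, par H.-1 x = o).
Local Notation ms := (mass par).
Local Notation an := (anc par).
Local Notation F := {ffun X -> 'I_B}.
Implicit Types (f : X -> R) (N : F).

Definition counts N : X -> R := fun x => (N x : nat)%:R.

Lemma mass_counts_int N n x : ms (counts N) n x \is a Num.int.
Proof. by apply: rpred_sum => l _; exact: rpred_nat. Qed.

(** Every node stays between the floor and the ceiling of its mass; stated with integer bounds so
    that it composes along successive shifts. *)
Definition int_preserving f f' := forall n x (c : int),
  (c%:~R <= ms f n x -> c%:~R <= ms f' n x) /\
  (ms f n x <= c%:~R -> ms f' n x <= c%:~R).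

Definition nonint f : {set 'I_H.+1 * X} :=
  [set e : 'I_H.+1 * X | ms f e.1 e.2 \isn't a Num.int].

Lemma nonint_descend f n x : ms f n x \isn't a Num.int ->
  exists2 a, an n a = x & forall m, (m <= n)%N -> ms f m (an m a) \isn't a Num.int.
Proof.
elim: n x => [|n IH] x fx.
  by exists x => // m; rewrite leqn0 => /eqP ->.
have [y yx fy] : exists2 y, par n y = x & ms f n y \isn't a Num.int.
  apply: contrapT => h; move: fx; rewrite massS; apply/negP; rewrite negbK.
  apply: rpred_sum => y /eqP yx; apply/negPn/negP => fy; apply: h; by exists y.
have [a ay am] := IH y fy; exists a; first by rewrite /= ay.
move=> m; rewrite leq_eqVlt => /orP[/eqP->|]; last by rewrite ltnS; exact: am.
by rewrite /= ay yx.
Qed.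

(** At the highest nonintegral level the parents are integral, so a nonintegral node has a
    nonintegral sibling. From both of them a path of nonintegral nodes leads down to a leaf. *)
Lemma nonint_pair f : \sum_l f l \is a Num.int -> nonint f != finset.set0 ->
  exists n a b, [/\ (n < H)%N, an n.+1 a = an n.+1 b, an n a != an n b &
    forall m, (m <= n)%N -> ms f m (an m a) \isn't a Num.int
      /\ ms f m (an m b) \isn't a Num.int].
Proof.
move=> fi /set0Pn[[n0 x0]]; rewrite inE/= => f0.
pose P n := (n <= H)%N && [exists x, ms f n x \isn't a Num.int].
have exP : exists n, P n.
  by exists n0; rewrite /P -ltnS ltn_ord; apply/existsP; exists x0.
have PH n : P n -> (n <= H)%N by case/andP.
case: (ex_maxnP exP PH) => n /andP[nH /existsP[x fx]] nmax.
have {}nH : (n < H)%N.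
  rewrite ltn_neqAle nH andbT; apply: contraNneq fx => ->; rewrite (mass_root H_gt0 par_root).
  by case: ifP => // _; exact: rpred0.
have fp : ms f n.+1 (par n x) \is a Num.int.
  apply/negPn/negP => fp; suff : P n.+1 by move/nmax; rewrite ltnn.
  by rewrite /P nH; apply/existsP; exists (par n x).
have [y [yx py fy]] : exists y, [/\ y != x, par n y = par n x &
    ms f n y \isn't a Num.int].
  apply: contrapT => h; move: fx; apply/negP; rewrite negbK.
  move: fp; rewrite massS (bigD1 x)//= rpredDr//; apply: rpred_sum => y /andP[/eqP py yx].
  by apply/negPn/negP => fy; apply: h; exists y.
have [a ax am] := nonint_descend fx; have [b bx bm] := nonint_descend fy.
exists n, a, b; split => //; first by rewrite /= ax bx py.
- by rewrite ax bx eq_sym.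
- by move=> m mn; split; [exact: am|exact: bm].
Qed.

Definition shift f a b t : X -> R := fun l => f l + t * ((l == a)%:R - (l == b)%:R).

Lemma mass_shift f a b t n x :
  ms (shift f a b t) n x = ms f n x + t * ((an n a == x)%:R - (an n b == x)%:R).
Proof.
rewrite /mass /shift big_split/=; congr (_ + _); rewrite -mulr_sumr sumrB.
have E c : \sum_(l | an n l == x) (l == c)%:R = (an n c == x)%:R :> R.
  rewrite big_mkcond (bigD1 c)//= eqxx big1 ?addr0; first by case: ifP.
  by move=> l lc; rewrite (negbTE lc); case: ifP.
by rewrite !E.
Qed.

(** Mass moves from [b] to [a] until the first node on one of the two paths becomes integral. Above
    level [n] the paths coincide and nothing changes. *)
Lemma shift_step f n a b : (n < H)%N -> an n.+1 a = an n.+1 b -> an n a != an n b ->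
  (forall m, (m <= n)%N -> ms f m (an m a) \isn't a Num.int
      /\ ms f m (an m b) \isn't a Num.int) ->
  exists2 t, 0 < t & int_preserving f (shift f a b t) /\
    (#|nonint (shift f a b t)| < #|nonint f|)%N.
Proof.
move=> nH eab nab nint.
pose tau (j : 'I_n.+1 * bool) := if j.2 then ce (ms f j.1 (an j.1 a)) - ms f j.1 (an j.1 a)
  else ms f j.1 (an j.1 b) - fl (ms f j.1 (an j.1 b)).
have tau0 j : 0 < tau j.
  have [h1 h2] := nint j.1 (ltn_ord j.1 : (j.1 <= n)%N).
  by rewrite /tau; case: ifP => _; rewrite subr_gt0 ?ce_gt_nint ?fl_lt_nint.
pose j0 : 'I_n.+1 * bool := (ord0, true).
have [js _ jmin] := @Order.TotalTheory.arg_minP _ _ _ j0 xpredT tau isT.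
have ne m : (m <= n)%N -> an m a != an m b.
  by move=> mn; apply: contraNneq nab => E; rewrite (anc_eq mn E).
have eq_up m : (n < m)%N -> an m a = an m b by move=> nm; exact: anc_eq nm eab.
pose t := tau js; pose f' := shift f a b t.
have up m : (m <= n)%N -> ms f' m (an m a) = ms f m (an m a) + t.
  by move=> mn; rewrite mass_shift eqxx eq_sym (negbTE (ne m mn)) subr0 mulr1.
have dn m : (m <= n)%N -> ms f' m (an m b) = ms f m (an m b) - t.
  by move=> mn; rewrite mass_shift eqxx (negbTE (ne m mn)) sub0r mulrN1.
have same m x : ~~ ((m <= n)%N && ((x == an m a) || (x == an m b))) ->
    ms f' m x = ms f m x.
  rewrite mass_shift; have [mn|nm] := leqP m n; last by rewrite eq_up// subrr mulr0 addr0.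
  rewrite /= negb_or ![x == _]eq_sym => /andP[/negbTE-> /negbTE->].
  by rewrite subrr mulr0 addr0.
have t_up m : (m <= n)%N -> ms f m (an m a) + t <= ce (ms f m (an m a)).
  move=> mn; have := jmin (Ordinal (mn : (m < n.+1)%N), true) isT.
  by rewrite /t /tau/= lerBrDl.
have t_dn m : (m <= n)%N -> fl (ms f m (an m b)) <= ms f m (an m b) - t.
  move=> mn; have := jmin (Ordinal (mn : (m < n.+1)%N), false) isT.
  by rewrite /t /tau/= lerBrDl lerBrDr.
exists t; first exact: tau0.
split.
  move=> m x c; have [/andP[mn /orP[]/eqP->]|/same->//] :=
    boolP ((m <= n)%N && ((x == an m a) || (x == an m b))).
    rewrite up//; split => h; first by rewrite (le_trans h)// lerDl ltW// tau0.
    by rewrite (le_trans (t_up m mn))// ge_ce.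
  rewrite dn//; split => h; first by rewrite (le_trans _ (t_dn m mn))// le_fl.
  by rewrite (le_trans _ h)// gerBl ltW// tau0.
apply: proper_card; apply/properP; split.
  apply/fintype.subsetP => -[m x]; rewrite !inE/=.
  have [/andP[mn /orP[]/eqP->] _|/same->//] :=
    boolP ((m <= n)%N && ((x == an m a) || (x == an m b))); have [] := nint m mn => //.
have mH : (js.1 < H.+1)%N by rewrite ltnS (leq_trans _ (ltnW nH))// -ltnS.
have mn : (js.1 <= n)%N by rewrite -ltnS.
have [na nb] := nint js.1 mn.
case jb : js.2.
  exists (Ordinal mH, an js.1 a); rewrite !inE/= ?na// negbK up// /t /tau jb.
  by rewrite addrC subrK ce_int.
exists (Ordinal mH, an js.1 b); rewrite !inE/= ?nb// negbK dn// /t /tau jb.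
by rewrite subKr fl_int.
Qed.

(** Induction on the number of nonintegral nodes: [f] is a convex combination of two opposite
    shifts, with weights inversely proportional to their lengths, and each shift makes a node
    integral. *)
Lemma laminar_rounding f : (forall l, 0 <= f l) -> \sum_l f l \is a Num.int ->
  \sum_l f l < B%:R ->
  exists q : F -> R, [/\ forall N, 0 <= q N, \sum_N q N = 1,
    forall x, \sum_N q N * counts N x = f x &
    forall N, 0 < q N -> int_preserving f (counts N)].
Proof.
have [c] := ubnP #|nonint f|; elim: c f => // c IH f; rewrite ltnS => fc f0 fi fB.
have [n0|nn0] := eqVneq (nonint f) finset.set0.
  have /boolp.choice[g gE] : forall l, exists j : 'I_B, f l = (j : nat)%:R.
    move=> l; have fl_int : f l \is a Num.int.
      apply/negPn/negP => fl; have : (ord0, l) \in nonint f.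
        by rewrite inE/= /mass/= (big_pred1 l).
      by rewrite n0 inE.
    have : f l \is a Num.nat by rewrite natrEint fl_int f0.
    move=> /natrP[j jE]; have jB : (j < B)%N.
      rewrite -(ltr_nat R) -jE; apply: le_lt_trans fB.
      by rewrite (bigD1 l)//= lerDl sumr_ge0.
    by exists (Ordinal jB).
  pose N0 : F := [ffun l => g l].
  have N0E : counts N0 = f by apply/funext => l; rewrite /counts ffunE gE.
  exists (fun N => (N == N0)%:R); split.
  - by move=> N; exact: ler0n.
  - by rewrite (bigD1 N0)//= eqxx big1 ?addr0// => N /negbTE->.
  - move=> x; rewrite (bigD1 N0)//= eqxx mul1r N0E big1 ?addr0// => N /negbTE->.
    by rewrite mul0r.
  - move=> N; case: eqVneq => [-> _|]; last by rewrite ltxx.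
    by rewrite N0E => n x z; split.
have [n [a [b [nH eab nab nint]]]] := nonint_pair fi nn0.
have key a' b' t : an n.+1 a' = an n.+1 b' -> int_preserving f (shift f a' b' t) ->
    (#|nonint (shift f a' b' t)| < #|nonint f|)%N ->
  exists q : F -> R, [/\ forall N, 0 <= q N, \sum_N q N = 1,
    forall x, \sum_N q N * counts N x = shift f a' b' t x &
    forall N, 0 < q N -> int_preserving f (counts N)].
  move=> eab' pr card.
  have tot : \sum_l shift f a' b' t l = \sum_l f l.
    have E (g : X -> R) : \sum_l g l = ms g H o by rewrite (mass_root H_gt0 par_root) eqxx.
    by rewrite !E mass_shift (anc_eq nH eab') subrr mulr0 addr0.
  have [||||q [q0 q1 qm qp]] := IH (shift f a' b' t).
  - exact: leq_trans card fc.
  - move=> l; have := (pr 0%N l 0).1; rewrite /mass/= !(big_pred1 l)//.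
    by apply; exact: f0.
  - by rewrite tot.
  - by rewrite tot.
  exists q; split => // N qN m x z; have [h1 h2] := pr m x z.
  have [h3 h4] := qp N qN m x z; split => h; first exact/h3/h1.
  exact/h4/h2.
have [t1 t10 [pr1 c1]] := shift_step nH eab nab nint.
have [|||t2 t20 [pr2 c2]] := @shift_step f n b a nH.
- by [].
- by rewrite eq_sym.
- by move=> m mn; have [? ?] := nint m mn; split.
have [q1 [q10 q11 q1m q1p]] := key a b t1 eab pr1 c1.
have [q2 [q20 q21 q2m q2p]] := key b a t2 (esym eab) pr2 c2.
have t12 : t1 + t2 != 0 by rewrite gt_eqF// addr_gt0.
pose th := t2 / (t1 + t2).
have th0 : 0 <= th by rewrite divr_ge0 ?addr_ge0// ltW.
have th1 : 0 <= 1 - th.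
  by rewrite subr_ge0 ler_pdivrMr ?addr_gt0// mul1r lerDr ltW.
exists (fun N => th * q1 N + (1 - th) * q2 N); split.
- by move=> N; rewrite addr_ge0// mulr_ge0.
- by rewrite big_split/= -!mulr_sumr q11 q21; ring.
- move=> x; have -> : f x = th * shift f a b t1 x + (1 - th) * shift f b a t2 x.
    by rewrite /shift /th; field.
  rewrite -q1m -q2m !mulr_sumr -big_split/=; apply: eq_bigr => N _; ring.
- move=> N h; have [q1N|q1N] := ltP 0 (q1 N); first exact: q1p.
  apply: q2p; rewrite lt_neqAle q20 andbT; apply: contraTneq h => <-.
  by rewrite mulr0 addr0 -leNgt mulr_ge0_le0.
Qed.

End Laminar.

(** * Rounding a fractional move *)

Section Rounding.
Variables (R : realType) (X : finType) (H : nat) (par : nat -> X -> X) (o : X).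
Variables (B : nat) (w : nat -> R).
Hypotheses (H_gt0 : (0 < H)%N) (par_root : forall x, par H.-1 x = o).
Hypotheses (w_gt0 : forall n, 0 < w n) (w_double : forall n, 2 * w n <= w n.+1).
Local Notation ms := (mass par).
Local Notation F := {ffun X -> 'I_B}.
Local Notation W := (nat * X * F)%type.
Implicit Types (N : F) (s : X -> R) (y : W -> R).

(** Distance less than 1 from the mean at every node is what [push] requires, and what forces a
    server onto a leaf of scaled mass at least 1. *)
Record balanced_law s (p : F -> R) : Prop := BalancedLaw {
  bl_ge0 : forall N, 0 <= p N ;
  bl_sum : \sum_N p N = 1 ;
  bl_mean : forall x, \sum_N p N * counts R N x = s x ;
  bl_balanced : forall N, 0 < p N -> forall n x, (n <= H)%N ->
    `|ms (counts R N) n x - ms s n x| < 1 }.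

Lemma law_mean_mass s (p : F -> R) n x : (forall x, \sum_N p N * counts R N x = s x) ->
  \sum_N p N * ms (counts R N) n x = ms s n x.
Proof.
move=> ps; rewrite /mass; under eq_bigr do rewrite mulr_sumr.
by rewrite exchange_big/=; apply: eq_bigr => l _; rewrite ps.
Qed.

Variables (s s' : X -> R) (p : F -> R).
Hypotheses (sp : balanced_law s p) (s'_ge0 : forall x, 0 <= s' x).
Hypotheses (ss' : \sum_x s' x = \sum_x s x).

Let p0 : forall N, 0 <= p N := bl_ge0 sp.

(* Flow conservation is relaxed at a price: [K n.+1] exceeds [w n + K n], so that an
   exchange between two outcomes removing an excess always pays off. *)
Definition K n : R := if n is m.+1 then 4 * w m else 0.

Definition excess y n x N : R := \sum_(z | par n z == x) y (n, z, N) - y (n.+1, x, N).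

Definition rcost y : R :=
  \sum_(n < H) \sum_x \sum_N
     (w n * (p N * `|y (n : nat, x, N) - ms (counts R N) n x|)
      + K n.+1 * (p N * `|excess y n x N|)).

(** [y (n, x, N)] is the target mass of the node when the current configuration is [N]; the means
    couple the outcomes. The root is frozen so that each outcome keeps its number of servers. *)
Record admissible y : Prop := Admissible {
  adm_root : forall x N, y (H, x, N) = ms (counts R N) H x ;
  adm_box : forall n x N, (n < H)%N -> fl (ms s' n x) <= y (n, x, N) <= ce (ms s' n x) ;
  adm_mean : forall n x, (n < H)%N -> \sum_N p N * y (n, x, N) = ms s' n x }.

Let I := ('I_H * X * F)%type.

Let ext (v : I -> R) : W -> R := fun t =>
  if insub t.1.1 is Some n then v (n, t.1.2, t.2) else ms (counts R t.2) H t.1.2.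

Let res y : I -> R := fun e => y (e.1.1 : nat, e.1.2, e.2).

Let ext_continuous t : row_continuous (fun v => ext v t).
Proof.
rewrite /ext; case: insubP => [n _ _|_]; first exact: row_continuous_proj.
exact: row_continuous_cst.
Qed.

Let rcost_continuous : row_continuous (fun v => rcost (ext v)).
Proof.
apply: row_continuous_sum => n _; apply: row_continuous_sum => x _.
apply: row_continuous_sum => N _; apply: row_continuousD; do 2! apply: row_continuousZ.
  apply: row_continuous_norm; apply: row_continuousB; first exact: ext_continuous.
  exact: row_continuous_cst.
apply: row_continuous_norm; apply: row_continuousB; last exact: ext_continuous.
by apply: row_continuous_sum => z _; exact: ext_continuous.
Qed.

Let extE v (n : 'I_H) x N : ext v (n : nat, x, N) = v (n, x, N).
Proof. by rewrite /ext/= valK. Qed.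

Let resK y n x N : admissible y -> (n <= H)%N -> ext (res y) (n, x, N) = y (n, x, N).
Proof.
move=> ay nH; rewrite /ext/= /res; case: insubP => [m _ <-//|].
rewrite -leqNgt => Hn; have -> : n = H by apply/eqP; rewrite eqn_leq nH.
by rewrite (adm_root ay).
Qed.

Lemma rounding_minimizer y1 : admissible y1 -> exists2 y, admissible y &
  forall y', admissible y' -> rcost y <= rcost y'.
Proof.
move=> ay1.
pose h (j : bool * ('I_H * X)) (v : I -> R) :=
  let d := \sum_N p N * ext v (j.2.1 : nat, j.2.2, N) - ms s' j.2.1 j.2.2 in
  if j.1 then d else -1 * d.
have aP y : admissible y -> (forall e : I, fl (ms s' e.1.1 e.1.2) <= res y e <=
    ce (ms s' e.1.1 e.1.2)) /\ forall j, 0 <= h j (res y).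
  move=> ay; split=> [[[n x] N]|[b [n x]]] /=; first exact: (adm_box ay).
  rewrite /h/=; under eq_bigr do rewrite (resK _ _ ay (ltnW (ltn_ord n))).
  by rewrite (adm_mean ay)// subrr mulr0 if_same.
have [||v [bv hv vmin]] := @argmin_box R I _ (fun e => fl (ms s' e.1.1 e.1.2))
    (fun e => ce (ms s' e.1.1 e.1.2)) h (fun v => rcost (ext v)) _ rcost_continuous.
- move=> [b [n x]]; rewrite /h/=.
  have c : row_continuous (fun v : I -> R =>
      \sum_N p N * ext v (n : nat, x, N) - ms s' n x).
    apply: row_continuousB; last exact: row_continuous_cst.
    by apply: row_continuous_sum => N _; apply: row_continuousZ; exact: ext_continuous.
  by case: b; last apply: row_continuousZ.
- by have [b1 h1] := aP y1 ay1; exists (res y1).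
exists (ext v); first split.
- by move=> x N; rewrite /ext/= insubF ?ltnn.
- by move=> n x N nH; have := bv (Ordinal nH, x, N); rewrite -extE.
- move=> n x nH; have := hv (true, (Ordinal nH, x)); have := hv (false, (Ordinal nH, x)).
  by rewrite /h/= mulN1r => h1 h2; apply/eqP; rewrite eq_le -subr_le0 -oppr_ge0 h1 -subr_ge0 h2.
move=> y' ay'; have [b' h'] := aP y' ay'; apply: le_trans (vmin _ b' h') _.
rewrite le_eqVlt; apply/orP; left; apply/eqP.
apply: eq_bigr => n _; apply: eq_bigr => x _; apply: eq_bigr => N _.
have e1 := resK x N ay' (ltnW (ltn_ord n)).
have e2 := resK x N ay' (ltn_ord n : (n.+1 <= H)%N).
rewrite /excess e1 e2; congr (_ + _ * (_ * `|_ - _|)).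
by apply: eq_bigr => z _; exact: (resK z N ay' (ltnW (ltn_ord n))).
Qed.

(** Each node is pushed on its own, at optimal cost but without regard to conservation between
    levels. *)
Lemma push_admissible : exists2 y, admissible y & forall n x, (n <= H)%N ->
  \sum_N p N * `|y (n, x, N) - ms (counts R N) n x| = `|ms s' n x - ms s n x|.
Proof.
have sH x : ms s' H x = ms s H x by rewrite !(mass_root H_gt0 par_root) ss'.
have /boolp.choice[g gE] : forall e : nat * X, exists v : F -> R, (e.1 < H)%N ->
    [/\ forall N, fl (ms s' e.1 e.2) <= v N <= ce (ms s' e.1 e.2),
      \sum_N p N * v N = ms s' e.1 e.2 & \sum_N p N * `|v N - ms (counts R N) e.1 e.2|
        = `|ms s' e.1 e.2 - ms s e.1 e.2|].
  move=> [n x]/=; have [nH|_] := ltnP n H; last by exists (fun=> 0).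
  have [|||||v hv] := @push R F p (fun N => ms (counts R N) n x) (ms s n x) (ms s' n x).
  - exact: p0.
  - exact: (bl_sum sp).
  - by apply: law_mean_mass; exact: (bl_mean sp).
  - by move=> N; exact: mass_counts_int.
  - by move=> N pN; apply: (bl_balanced sp pN); exact: ltnW.
  by exists v.
pose y (t : W) := if (t.1.1 < H)%N then g t.1 t.2 else ms (counts R t.2) H t.1.2.
have yE n x N : (n < H)%N -> y (n, x, N) = g (n, x) N by move=> nH; rewrite /y/= nH.
exists y; first split.
- by move=> x N; rewrite /y/= ltnn.
- by move=> n x N nH; rewrite yE//; have [h _ _] := gE (n, x) nH; exact: h.
- move=> n x nH; have [_ h _] := gE (n, x) nH; rewrite -[RHS]h.
  by apply: eq_bigr => N _; rewrite yE.
move=> n x; rewrite leq_eqVlt => /orP[/eqP->|nH].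
  rewrite sH subrr normr0 big1// => N _.
  by rewrite /y/= ltnn subrr normr0 mulr0.
have [_ _ h] := gE (n, x) nH; rewrite -[RHS]h.
by apply: eq_bigr => N _; rewrite yE.
Qed.

Let K_ge0 n : 0 <= K n.
Proof. by case: n => //= n; rewrite mulr_ge0// ltW. Qed.

Let K_le n : K n <= 2 * w n.
Proof.
case: n => [|n] /=; first by rewrite mulr_ge0// ltW.
by have := w_double n; lra.
Qed.

(** 7 = 1 + 4 + 2: the movement of a node, its share in the penalty of its parent at price
    [K n.+1 = 4 * w n], and its share in its own penalty at price [K n <= 2 * w n]. At the root [s]
    and [s'] agree. *)
Lemma rcost_push y : admissible y -> (forall n x, (n <= H)%N ->
    \sum_N p N * `|y (n, x, N) - ms (counts R N) n x| = `|ms s' n x - ms s n x|) ->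
  rcost y <= 7 * tree_move H par w s s'.
Proof.
move=> ay yE; pose D n : R := \sum_x `|ms s' n x - ms s n x|.
have DH : D H = 0.
  by rewrite /D big1// => x _; rewrite !(mass_root H_gt0 par_root) ss' subrr normr0.
have step n : (n < H)%N -> \sum_x \sum_N
     (w n * (p N * `|y (n : nat, x, N) - ms (counts R N) n x|)
      + K n.+1 * (p N * `|excess y n x N|)) <=
    w n * D n + K n.+1 * (D n + D n.+1).
  move=> nH; under eq_bigr do rewrite big_split/= -!mulr_sumr.
  rewrite big_split/= -!mulr_sumr; apply: lerD.
    by apply: ler_wpM2l; [exact: ltW|apply: ler_sum => x _; rewrite yE// ltnW].
  apply: ler_wpM2l; first exact: (K_ge0 n.+1).
  have e x N : `|excess y n x N| <= \sum_(z | par n z == x)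
      `|y (n, z, N) - ms (counts R N) n z| + `|y (n.+1, x, N) - ms (counts R N) n.+1 x|.
    have -> : excess y n x N = \sum_(z | par n z == x)
      (y (n, z, N) - ms (counts R N) n z) - (y (n.+1, x, N) - ms (counts R N) n.+1 x).
      by rewrite sumrB massS /excess; ring.
    by apply: le_trans (ler_normB _ _) _; rewrite lerD2r ler_norm_sum.
  apply: (@le_trans _ _ (\sum_x \sum_N p N * (\sum_(z | par n z == x)
      `|y (n, z, N) - ms (counts R N) n z| + `|y (n.+1, x, N) - ms (counts R N) n.+1 x|))).
    by apply: ler_sum => x _; apply: ler_sum => N _; apply: ler_wpM2l.
  under eq_bigr do under eq_bigr do rewrite mulrDr mulr_sumr.
  under eq_bigr do rewrite big_split/= yE// exchange_big/=.
  rewrite big_split/= lerD2r /D [leRHS](partition_big (par n) predT)//=.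
  apply: ler_sum => x _; apply: ler_sum => z _; rewrite yE//; exact: ltnW.
rewrite /rcost; apply: le_trans (ler_sum _ (fun (n : 'I_H) _ => step n (ltn_ord n))) _.
have -> : tree_move H par w s s' = \sum_(n < H) w n * D n by [].
have D0 n : 0 <= D n by apply: sumr_ge0 => x _.
have : \sum_(n < H) K n.+1 * D n.+1 <= \sum_(n < H) K n * D n.
  rewrite -(big_mkord predT (fun n => K n.+1 * D n.+1)).
  rewrite -(big_mkord predT (fun n => K n * D n)).
  case: H H_gt0 DH => // h _ Dh; rewrite [leLHS]big_nat_recr// [leRHS]big_nat_recl//= Dh.
  by rewrite mulr0 addr0 mul0r add0r.
have : \sum_(n < H) K n * D n <= 2 * \sum_(n < H) w n * D n.
  by rewrite mulr_sumr; apply: ler_sum => n _; rewrite mulrA; apply: ler_wpM2r.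
have -> : \sum_(n < H) (w n * D n + K n.+1 * (D n + D n.+1)) =
    5 * (\sum_(n < H) w n * D n) + \sum_(n < H) K n.+1 * D n.+1.
  by rewrite mulr_sumr -big_split/=; apply: eq_bigr => n _; ring.
lra.
Qed.

Lemma sum0_signs (V : finType) (a : V -> R) i : \sum_j a j = 0 -> a i != 0 ->
  (exists j, 0 < a j) /\ (exists j, a j < 0).
Proof.
move=> a0 ai; split; apply: contrapT => h; move: ai; apply/negP; rewrite negbK.
  have h' j : true -> 0 <= - a j.
    by move=> _; rewrite oppr_ge0 leNgt; apply/negP => aj; apply: h; exists j.
  have := @psumr_eq0P R V xpredT (fun j => - a j) h'.
  by rewrite sumrN a0 oppr0 => /(_ erefl i isT) /eqP; rewrite oppr_eq0.
have h' j : true -> 0 <= a j.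
  by move=> _; rewrite leNgt; apply/negP => aj; apply: h; exists j.
by have /(_ i isT) -> := psumr_eq0P h' a0.
Qed.

Let box_le y n x N : admissible y -> (n <= H)%N -> 0 < p N ->
  fl (ms s' n x) <= y (n, x, N) <= ce (ms s' n x).
Proof.
move=> ay; rewrite leq_eqVlt => /orP[/eqP-> pN|nH _]; last exact: (adm_box ay).
rewrite (adm_root ay); apply: near_int_box; first exact: mass_counts_int.
have -> : ms s' H x = ms s H x by rewrite !(mass_root H_gt0 par_root) ss'.
exact: (bl_balanced sp).
Qed.

Let mean_le y n x : admissible y -> (n <= H)%N ->
  \sum_N p N * y (n, x, N) = ms s' n x.
Proof.
move=> ay; rewrite leq_eqVlt => /orP[/eqP->|nH]; last exact: (adm_mean ay).
under eq_bigr do rewrite (adm_root ay).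
rewrite (law_mean_mass _ _ (bl_mean sp)).
by rewrite !(mass_root H_gt0 par_root) ss'.
Qed.

Lemma excess_mean y n x : admissible y -> (n < H)%N ->
  \sum_N p N * excess y n x N = 0.
Proof.
move=> ay nH; under eq_bigr do rewrite /excess mulrBr mulr_sumr.
rewrite sumrB exchange_big/= (mean_le _ ay nH) massS; apply/eqP.
rewrite subr_eq0; apply/eqP; apply: eq_bigr => z _; exact: (adm_mean ay).
Qed.

(* If no child could transfer mass from [N1] to [N2], an integer would separate
   the two totals, whereas both parents lie in the same unit cell. *)
Lemma transfer_exists y n x N1 N2 : admissible y -> (n < H)%N ->
  0 < p N1 -> 0 < p N2 -> 0 < excess y n x N1 -> excess y n x N2 < 0 ->
  exists z, [/\ par n z = x, fl (ms s' n z) < y (n, z, N1) &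
    y (n, z, N2) < ce (ms s' n z)].
Proof.
move=> ay nH p1 p2 e1 e2; apply: contrapT => h.
pose c : R := \sum_(z | par n z == x)
  if y (n, z, N2) == ce (ms s' n z) then ce (ms s' n z) else fl (ms s' n z).
have ci : c \is a Num.int.
  by apply: rpred_sum => z _; case: ifP => _; [exact: ce_int|exact: fl_int].
have c1 : \sum_(z | par n z == x) y (n, z, N1) <= c.
  apply: ler_sum => z /eqP zx; have /andP[b1 b2] := adm_box ay z N1 nH.
  case: eqVneq => // y2; rewrite leNgt; apply/negP => y1; apply: h; exists z; split => //.
  by rewrite lt_neqAle y2; have /andP[] := adm_box ay z N2 nH.
have c2 : c <= \sum_(z | par n z == x) y (n, z, N2).
  apply: ler_sum => z _; have /andP[b1 b2] := adm_box ay z N2 nH.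
  by case: eqVneq => // ->.
have /andP[b1 _] := box_le x ay nH p1; have /andP[_ b2] := box_le x ay nH p2.
move: e1 e2; rewrite /excess subr_gt0 subr_lt0 => e1 e2.
have h1 : fl (ms s' n.+1 x) < c by lra.
have h2 : c < ce (ms s' n.+1 x) by lra.
have := ce_fl1 (ms s' n.+1 x).
have /intrP[d dE] := ci; have /intrP[a aE] := fl_int (ms s' n.+1 x).
have h3 : fl (ms s' n.+1 x) + 1 <= c.
  by move: h1; rewrite dE aE -[1]/(1%:~R) -intrD ltr_int ler_int lezD1.
lra.
Qed.

(** Excesses have mean 0, so a nonzero one yields outcomes [N1] and [N2] with excesses of opposite
    signs. Transferring at a common child from [N1] to [N2] keeps the mean, costs at most
    [w n + K n] on each side and saves [K n.+1]. *)
Lemma minimizer_flow y : admissible y ->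
  (forall y', admissible y' -> rcost y <= rcost y') ->
  forall n x N, (n < H)%N -> 0 < p N -> excess y n x N = 0.
Proof.
move=> ay ymin n x N nH pN; apply/eqP/negPn/negP => eN.
have pe : p N * excess y n x N != 0 by rewrite mulf_neq0// gt_eqF.
have [[N1 h1] [N2 h2]] := sum0_signs (excess_mean x ay nH) pe.
have p1 : 0 < p N1.
  by rewrite lt_neqAle p0 andbT; apply: contraTneq h1 => <-; rewrite mul0r ltxx.
have p2 : 0 < p N2.
  by rewrite lt_neqAle p0 andbT; apply: contraTneq h2 => <-; rewrite mul0r ltxx.
rewrite (pmulr_rgt0 _ p1) in h1; rewrite (pmulr_rlt0 _ p2) in h2.
have [z [zx z1 z2]] := transfer_exists ay nH p1 p2 h1 h2.
(* Probability times mass: the largest transfer that stays in both boxes and reverses neither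
   excess. *)
pose t := Num.min (Num.min (p N1 * (y (n, z, N1) - fl (ms s' n z)))
                           (p N2 * (ce (ms s' n z) - y (n, z, N2))))
                  (Num.min (p N1 * excess y n x N1) (p N2 * - excess y n x N2)).
have t0 : 0 < t.
  rewrite !lt_min; apply/andP; split; apply/andP; split; apply: mulr_gt0 => //.
  - by rewrite subr_gt0.
  - by rewrite subr_gt0.
  - by rewrite oppr_gt0.
have N12 : N1 != N2 by apply: contraTneq h1 => ->; rewrite -leNgt ltW.
have [t1 t2 t3 t4] : [/\ t / p N1 <= y (n, z, N1) - fl (ms s' n z),
    t / p N2 <= ce (ms s' n z) - y (n, z, N2), t / p N1 <= excess y n x N1 &
    t / p N2 <= - excess y n x N2].
  by split; rewrite ler_pdivrMr// mulrC !ge_min lexx ?orbT.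
pose d M : R := (M == N2)%:R * (t / p N2) - (M == N1)%:R * (t / p N1).
pose v M : R := (M == N2)%:R * (t / p N2) + (M == N1)%:R * (t / p N1).
have v0 M : 0 <= v M by rewrite addr_ge0// mulr_ge0// divr_ge0// ltW.
have vd M : `|d M| <= v M.
  by rewrite (le_trans (ler_normB _ _))// !ger0_norm// mulr_ge0// divr_ge0// ltW.
have E M0 c : \sum_M p M * ((M == M0)%:R * c) = p M0 * c.
  rewrite (bigD1 M0)//= eqxx mul1r big1 ?addr0// => M /negbTE->.
  by rewrite mul0r mulr0.
have pd : \sum_M p M * d M = 0.
  under eq_bigr do rewrite mulrBr.
  by rewrite sumrB !E; field; rewrite !gt_eqF.
have pv : \sum_M p M * v M = 2 * t.
  under eq_bigr do rewrite mulrDr.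
  by rewrite big_split/= !E; field; rewrite !gt_eqF.
pose at_ m q : R := ((m == n) && (q == z))%:R.
pose y' (e : W) := y e + at_ e.1.1 e.1.2 * d e.2.
have ay' : admissible y'.
  split.
  - move=> q M; rewrite /y' /at_/= (_ : (H == n) = false) ?mul0r ?addr0.
      exact: (adm_root ay).
    by rewrite gtn_eqF.
  - move=> m q M mH; rewrite /y' /at_/=; have /andP[b1 b2] := adm_box ay q M mH.
    case: (boolP ((m == n) && (q == z))) => [/andP[/eqP mE /eqP qE]|_]; last by rewrite mul0r addr0 b1 b2.
    rewrite mul1r /d; move: b1 b2; rewrite mE qE.
    have [->|M2] := eqVneq M N2.
      by rewrite eq_sym (negbTE N12) mul0r subr0 mul1r => b1 b2; have := divr_gt0 t0 p2; lra.
    have [->|M1] := eqVneq M N1; last by rewrite !mul0r subr0 addr0 => -> ->.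
    by rewrite mul0r mul1r sub0r => b1 b2; have := divr_gt0 t0 p1; lra.
  - move=> m q mH; rewrite /y'/=; under eq_bigr do rewrite mulrDr mulrCA.
    by rewrite big_split/= -mulr_sumr pd mulr0 addr0 (adm_mean ay).
have sum_at m q : \sum_(r | par m r == q) at_ m r = ((m == n) && (q == x))%:R.
  rewrite /at_; have [->|_] := eqVneq m n; last by rewrite big1.
  rewrite /= big_mkcond (bigD1 z)//= eqxx zx big1 ?addr0; last first.
    by move=> r /negbTE->; case: ifP.
  by rewrite [x == q]eq_sym; case: ifP.
have ex' m q M : (m < H)%N -> `|excess y' m q M| <= `|excess y m q M|
    + (at_ m.+1 q * v M - ((m == n) && (q == x))%:R * v M).
  move=> mH; have -> : excess y' m q M = excess y m q M
      + ((m == n) && (q == x))%:R * d M - at_ m.+1 q * d M.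
    by rewrite /excess /y'/= big_split/= -mulr_suml sum_at; ring.
  case: (boolP ((m == n) && (q == x))) => [/andP[/eqP mE /eqP qE]|_]; last first.
    rewrite !mul0r addr0 subr0; apply: le_trans (ler_normB _ _) _.
    rewrite lerD2l normrM ger0_norm ?ler0n//; apply: ler_wpM2l => //; exact: ler0n.
  rewrite /at_ mE qE (_ : (n.+1 == n) = false)/=; last by apply/negbTE; rewrite neq_ltn ltnSn orbT.
  rewrite !mul0r !mul1r subr0 sub0r /d /v.
  have [->|M2] := eqVneq M N2.
    rewrite eq_sym (negbTE N12) !mul0r !mul1r subr0 addr0.
    by rewrite !ler0_norm; [lra|exact: ltW|lra].
  have [->|M1] := eqVneq M N1; last by rewrite !mul0r !subr0 !addr0 oppr0 addr0.
  by rewrite !mul0r !mul1r sub0r add0r !ger0_norm; [lra|exact: ltW|lra].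
have := ymin y' ay'; apply/negP; rewrite -ltNge.
have gain : rcost y' <= rcost y + 2 * t * (w n + K n - K n.+1).
  have -> : 2 * t * (w n + K n - K n.+1) = \sum_(m < H) \sum_q \sum_M
      (w m * (p M * (at_ m q * v M)) + K m.+1 * (p M *
         (at_ m.+1 q * v M - ((m == n :> nat) && (q == x))%:R * v M))).
    have S a : \sum_M p M * (a * v M) = a * (2 * t).
      by under eq_bigr do rewrite mulrCA; rewrite -mulr_sumr pv.
    have at_sum m (q0 : X) : \sum_q ((m == n) && (q == q0))%:R = (m == n)%:R :> R.
      rewrite (bigD1 q0)//= eqxx andbT big1 ?addr0// => q /negbTE->.
      by rewrite andbF.
    have sel (f : nat -> R) : \sum_(m < H) f m * (m == n :> nat)%:R = f n.
      rewrite (bigD1 (Ordinal nH))//= eqxx mulr1 big1 ?addr0// => m.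
      by rewrite -val_eqE/= => /negbTE->; rewrite mulr0.
    have sel' n' : (n' < H)%N -> \sum_(m < H) K m.+1 * (m.+1 == n')%:R = K n'.
      case: n' => [|n'] nH'; first by rewrite big1// => m _; rewrite mulr0.
      rewrite (bigD1 (Ordinal (ltnW nH')))//= eqxx mulr1 big1 ?addr0// => m.
      by rewrite -val_eqE/= eqSS => /negbTE->; rewrite mulr0.
    transitivity (2 * t * \sum_(m < H) (w m * (m == n :> nat)%:R
        + (K m.+1 * (m.+1 == n)%:R - K m.+1 * (m == n :> nat)%:R))).
      congr (_ * _); rewrite big_split sumrB sel (sel' n nH) (sel (fun m => K m.+1)).
      by rewrite -addrA.
    rewrite mulr_sumr; apply: eq_bigr => m _.
    rewrite -(at_sum m z) -(at_sum m.+1 z).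
    rewrite -[X in _ - _ * X](_ : \sum_q ((m == n :> nat) && (q == x))%:R = _); last first.
      by rewrite !at_sum.
    rewrite !mulr_sumr -sumrB -big_split/= mulr_sumr; apply: eq_bigr => q _.
    rewrite big_split/= -!mulr_sumr S.
    under [X in _ = _ + _ * X]eq_bigr do rewrite mulrBr.
    by rewrite sumrB !S /at_; ring.
  rewrite /rcost -big_split/=; apply: ler_sum => m _.
  rewrite -big_split/=; apply: ler_sum => q _.
  rewrite -big_split/=; apply: ler_sum => M _.
  rewrite addrACA -!mulrDr; apply: lerD.
    apply: ler_wpM2l; first exact: ltW.
    apply: ler_wpM2l => //; rewrite /y'/= addrAC; apply: le_trans (ler_normD _ _) _.
    rewrite lerD2l normrM ger0_norm ?ler0n//; apply: ler_wpM2l => //; exact: ler0n.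
  apply: ler_wpM2l; first exact: (K_ge0 m.+1).
  by apply: ler_wpM2l => //; exact: ex'.
apply: le_lt_trans gain _; rewrite gtrDl pmulr_rlt0 ?mulr_gt0//.
by have := K_le n; have := w_gt0 n; rewrite [K n.+1]/=; lra.
Qed.

(** For each [N] the minimizer is a genuine flow, to which [laminar_rounding] applies. Since the
    masses of [N] are integers and the rounding crosses no integer, each node's expected movement is
    exactly that of the flow. *)
Theorem rounding_step : \sum_x s x < B%:R - 1 ->
  exists q : F -> F -> R, [/\ forall N N', 0 <= q N N', forall N, \sum_N' q N N' = 1,
    balanced_law s' (fun N' => \sum_N p N * q N N'),
    forall N N', 0 < p N -> 0 < q N N' -> \sum_x (N' x : nat) = \sum_x (N x : nat) &
    \sum_N \sum_N' p N * q N N' * tree_move H par w (counts R N) (counts R N')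
      <= 7 * tree_move H par w s s'].
Proof.
move=> sB; have [y1 ay1 y1E] := push_admissible.
have [y ay ymin] := rounding_minimizer ay1.
have flow := minimizer_flow ay ymin.
pose f N x := y (0%N, x, N).
have fE N n x : 0 < p N -> (n <= H)%N -> ms (f N) n x = y (n, x, N).
  move=> pN; elim: n x => [|n IH] x nH; first by rewrite /mass/= (big_pred1 x).
  have := flow n x N nH pN; rewrite /excess => /eqP; rewrite subr_eq0 => /eqP <-.
  by rewrite massS; apply: eq_bigr => z _; rewrite IH// ltnW.
have tot N : 0 < p N -> \sum_l f N l = \sum_l counts R N l.
  move=> pN; have := mass_root H_gt0 par_root (f N) o.
  by rewrite eqxx fE// (adm_root ay) (mass_root H_gt0 par_root) eqxx.
have /boolp.choice[q qP] : forall N, exists q : F -> R, [/\ forall N', 0 <= q N',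
    \sum_N' q N' = 1 & 0 < p N ->
    (forall x, \sum_N' q N' * counts R N' x = f N x) /\
    (forall N', 0 < q N' -> int_preserving par (f N) (counts R N'))].
  move=> N; have [pN|pN] := ltP 0 (p N); last first.
    exists (fun N' => (N' == N)%:R); split => [N'||//].
    - exact: ler0n.
    - by rewrite (bigD1 N)//= eqxx big1 ?addr0// => N' /negbTE->.
  have [|||q [q0 q1 qm qi]] := @laminar_rounding R X H par o B H_gt0 par_root (f N).
  - move=> l; have /andP[+ _] := adm_box ay l N H_gt0; apply: le_trans.
    rewrite -[0]/(0%:~R); apply: le_fl; rewrite /mass/= (big_pred1 l)//.
  - by rewrite tot//; apply: rpred_sum => l _; exact: rpred_nat.
  - rewrite tot//; have := bl_balanced sp pN o (leqnn H).
    rewrite !(mass_root H_gt0 par_root) eqxx ltr_norml => /andP[_]; lra.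
  by exists q.
have q0 N N' : 0 <= q N N' by have [] := qP N.
have q1 N : \sum_N' q N N' = 1 by have [] := qP N.
have qm N x : 0 < p N -> \sum_N' q N N' * counts R N' x = f N x.
  by move=> pN; have [_ _ /(_ pN)[]] := qP N.
have qi N N' : 0 < p N -> 0 < q N N' -> int_preserving par (f N) (counts R N').
  by move=> pN; have [_ _ /(_ pN)[_]] := qP N; apply.
have pz N : p N = 0 \/ 0 < p N.
  by have := p0 N; rewrite le_eqVlt => /orP[/eqP|]; [left|right].
have qtot N N' : 0 < p N -> 0 < q N N' -> ms (counts R N') H o = ms (counts R N) H o.
  move=> pN qN; have /intrP[c cE] := mass_counts_int R par N H o.
  have [h1 h2] := qi N N' pN qN H o c.
  rewrite fE// (adm_root ay) cE in h1 h2 *.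
  by apply/eqP; rewrite eq_le h1 ?h2.
exists q; split => //.
- split.
  + by move=> N'; apply: sumr_ge0 => N _; rewrite mulr_ge0.
  + rewrite exchange_big/= -(bl_sum sp); apply: eq_bigr => N _.
    by rewrite -mulr_sumr q1 mulr1.
  + move=> x; have -> : s' x = ms s' 0 x by rewrite /mass/= (big_pred1 x).
    rewrite -(adm_mean ay x H_gt0).
    under eq_bigr do rewrite mulr_suml.
    rewrite exchange_big/=; apply: eq_bigr => N _.
    have [->|pN] := pz N; first by rewrite mul0r big1// => N' _; rewrite !mul0r.
    by rewrite -/(f N x) -qm// mulr_sumr; apply: eq_bigr => N' _; rewrite mulrA.
  + move=> N' pN' n x nH.
    have [N [pN qN]] : exists N, 0 < p N /\ 0 < q N N'.
      apply: contrapT => h; move: pN'; rewrite big1 ?ltxx// => N _.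
      have [->|pN] := pz N; first by rewrite mul0r.
      have := q0 N N'; rewrite le_eqVlt => /orP[/eqP<-|qN]; first by rewrite mulr0.
      by exfalso; apply: h; exists N.
    have /andP[b1 b2] := box_le x ay nH pN.
    have /intrP[c cE] := fl_int (ms s' n x); have /intrP[d dE] := ce_int (ms s' n x).
    have [h1 _] := qi N N' pN qN n x c; have [_ h2] := qi N N' pN qN n x d.
    rewrite fE// -cE in h1; rewrite fE// -dE in h2.
    have := h1 b1; have := h2 b2; have := fl_gt (ms s' n x); have := ce_lt (ms s' n x).
    by rewrite ltr_norml => *; apply/andP; split; lra.
- move=> N N' pN qN; have := qtot N N' pN qN.
  rewrite !(mass_root H_gt0 par_root) eqxx /counts -!natr_sum => /eqP.
  by rewrite eqr_nat => /eqP.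
have cost N n x : 0 < p N -> (n <= H)%N ->
    \sum_N' q N N' * `|ms (counts R N') n x - ms (counts R N) n x| =
    `|y (n, x, N) - ms (counts R N) n x|.
  move=> pN nH; have /intrP[c cE] := mass_counts_int R par N n x.
  have m1 : \sum_N' q N N' * ms (counts R N') n x = y (n, x, N).
    by rewrite (law_mean_mass _ _ (fun x => qm N x pN)) fE.
  have m2 : \sum_N' q N N' * ms (counts R N) n x = ms (counts R N) n x.
    by rewrite -mulr_suml q1 mul1r.
  have [le|/ltW le] := leP (ms (counts R N) n x) (y (n, x, N)).
    rewrite (ger0_norm (_ : 0 <= y (n, x, N) - _)) ?subr_ge0// -m1 -[in RHS]m2 -sumrB.
    apply: eq_bigr => N' _; rewrite -mulrBr.
    have := q0 N N'; rewrite le_eqVlt => /orP[/eqP<-|qN]; first by rewrite !mul0r.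
    have [h _] := qi N N' pN qN n x c; rewrite fE// -cE in h.
    by rewrite ger0_norm// subr_ge0 h.
  rewrite (ler0_norm (_ : y (n, x, N) - _ <= 0)) ?subr_le0// opprB -m1 -[in RHS]m2 -sumrB.
  apply: eq_bigr => N' _; rewrite -mulrBr.
  have := q0 N N'; rewrite le_eqVlt => /orP[/eqP<-|qN]; first by rewrite !mul0r.
  have [_ h] := qi N N' pN qN n x c; rewrite fE// -cE in h.
  by rewrite distrC ger0_norm// subr_ge0 h.
apply: le_trans (rcost_push ay1 y1E); apply: le_trans (ymin _ ay1).
have step N : \sum_N' p N * q N N' * tree_move H par w (counts R N) (counts R N') <=
    \sum_(n < H) \sum_x w n * (p N * `|y (n : nat, x, N) - ms (counts R N) n x|).
  have [->|pN] := pz N.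
    rewrite big1 => [|N' _]; last by rewrite !mul0r.
    by apply: sumr_ge0 => n _; apply: sumr_ge0 => x _; rewrite mul0r mulr0.
  rewrite le_eqVlt; apply/orP; left; apply/eqP.
  under eq_bigr do rewrite /tree_move mulr_sumr.
  rewrite exchange_big/=; apply: eq_bigr => n _.
  under eq_bigr do rewrite mulr_sumr mulr_sumr.
  rewrite exchange_big/=; apply: eq_bigr => x _.
  rewrite -(cost N n x pN (ltnW (ltn_ord n))) !mulr_sumr.
  by apply: eq_bigr => N' _; ring.
apply: le_trans (ler_sum _ (fun N _ => step N)) _.
rewrite exchange_big/=; apply: ler_sum => n _.
rewrite exchange_big/=; apply: ler_sum => x _; apply: ler_sum => N _.
by rewrite lerDl; apply: mulr_ge0; [exact: (K_ge0 n.+1)|exact: mulr_ge0].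
Qed.

End Rounding.

(** * The rounded Markov chain *)

Section History.
Variables (X A : Type) (a0 : A) (step : seq X -> X -> A -> A).

(** Recursion on the reversed sequence, because a step needs the last request together with the
    prefix before it. *)
Fixpoint history_rev s := if s is r :: s' then step (rev s') r (history_rev s') else a0.

Definition history s := history_rev (rev s).

Lemma history_rcons s r : history (rcons s r) = step s r (history s).
Proof. by rewrite /history rev_rcons /= revK. Qed.

End History.

Definition chain_law (R : realType) (X : Type) (S : finType) (a : S)
    (kappa : seq X -> X -> S -> S -> R) : seq X -> S -> R :=
  history (fun b => (b == a)%:R)
    (fun s r mu b' => \sum_b mu b * kappa s r b b').

Section ChainLaw.
Variables (R : realType) (X : Type) (S : finType) (a : S).
Variable kappa : seq X -> X -> S -> S -> R.
Local Notation mu := (chain_law a kappa).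

Lemma chain_law_rcons s r b' : mu (rcons s r) b' = \sum_b mu s b * kappa s r b b'.
Proof. by rewrite /chain_law history_rcons. Qed.

Hypothesis kappa_ge0 : forall s r b b', 0 <= kappa s r b b'.

Lemma chain_law_ge0 s b : 0 <= mu s b.
Proof.
elim/last_ind: s b => [|s r IH] b; first exact: ler0n.
by rewrite chain_law_rcons; apply: sumr_ge0 => b' _; apply: mulr_ge0.
Qed.

Lemma chain_law_gt0 s r b' : 0 < mu (rcons s r) b' ->
  exists b, 0 < mu s b /\ 0 < kappa s r b b'.
Proof.
rewrite chain_law_rcons => h; apply: contrapT => no; move: h; rewrite big1 ?ltxx// => b _.
have := chain_law_ge0 s b; rewrite le_eqVlt => /orP[/eqP<-|mb]; first by rewrite mul0r.
have := kappa_ge0 s r b b'; rewrite le_eqVlt => /orP[/eqP<-|kb]; first by rewrite mulr0.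
by exfalso; apply: no; exists b.
Qed.

End ChainLaw.

Section InitialLaw.
Variables (R : realType) (X : finType) (H : nat) (par : nat -> X -> X).
Variables (k : nat) (N0 : {ffun X -> 'I_k.+2}) (eta : R).
Hypotheses (N0k : (\sum_x (N0 x : nat) = k)%N) (eta_gt0 : 0 < eta).
Hypothesis eta_le : k%:R * eta <= 2^-1.
Local Notation ms := (mass par).
Local Notation F := {ffun X -> 'I_k.+2}.

Definition bump (e : X) : F := [ffun x => inord (N0 x + (x == e))].

Let N0_le x : (N0 x <= k)%N.
Proof.
apply: (@leq_trans (\sum_y (N0 y : nat))%N); last by rewrite N0k.
by rewrite (bigD1 x)//= leq_addr.
Qed.

Lemma counts_bump e x : counts R (bump e) x = counts R N0 x + (x == e)%:R.
Proof.
rewrite /counts ffunE inordK -?natrD//.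
by have := leq_add (N0_le x) (leq_b1 (x == e)); rewrite addn1.
Qed.

(* A point mass is not balanced around the fractional state, whose total exceeds [k].
   The law below is, and it dominates half the point mass at [N0]. *)
Definition initial_law (N : F) : R :=
  (1 - k%:R * eta) * (N == N0)%:R + \sum_e counts R N0 e * eta * (N == bump e)%:R.

Lemma sum_counts : \sum_x counts R N0 x = k%:R.
Proof. by rewrite -natr_sum N0k. Qed.

Lemma initial_law_mean (f : F -> R) : \sum_N initial_law N * f N =
  (1 - k%:R * eta) * f N0 + \sum_e counts R N0 e * eta * f (bump e).
Proof.
have E c M : \sum_N c * (N == M)%:R * f N = c * f M.
  by rewrite (bigD1 M)//= eqxx mulr1 big1 ?addr0// => N /negbTE->; rewrite mulr0 mul0r.
under eq_bigr do rewrite mulrDl mulr_suml.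
by rewrite big_split/= E exchange_big/=; congr (_ + _); apply: eq_bigr => e _; exact: E.
Qed.

Lemma initial_law_ge N : 2^-1 * (N == N0)%:R <= initial_law N.
Proof.
rewrite -[leLHS]addr0; apply: lerD; last first.
  apply: sumr_ge0 => e _; rewrite mulr_ge0 ?ler0n// mulr_ge0 ?ler0n//; exact: ltW.
by apply: ler_wpM2r; [exact: ler0n|have := eta_le; lra].
Qed.

(** A node deviates by minus [eta] times its mass, plus 1 if it contains the bump [e]. In the latter
    case its mass is positive, as [e] is occupied, so the deviation stays below 1. *)
Lemma initial_law_balanced :
  balanced_law H par (fun x => (1 + eta) * counts R N0 x) initial_law.
Proof.
have c0 e : 0 <= counts R N0 e * eta by rewrite mulr_ge0 ?ler0n// ltW.
split.
- by move=> N; apply: le_trans (initial_law_ge N); rewrite mulr_ge0 ?ler0n ?invr_ge0.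
- under eq_bigr do rewrite -[initial_law _]mulr1.
  rewrite (initial_law_mean (fun=> 1)) mulr1; under eq_bigr do rewrite mulr1.
  by rewrite -mulr_suml sum_counts subrK.
- move=> x; rewrite (initial_law_mean (fun N => counts R N x)).
  under eq_bigr do rewrite counts_bump mulrDr.
  rewrite big_split/= -!mulr_suml sum_counts (bigD1 x)//= eqxx big1; last first.
    by move=> e /negbTE ex; rewrite eq_sym ex mulr0.
  by rewrite addr0 mulr1; ring.
move=> N pN n x _.
have ms1 : ms (fun x => (1 + eta) * counts R N0 x) n x = (1 + eta) * ms (counts R N0) n x.
  by rewrite /mass mulr_sumr.
have m0 : 0 <= ms (counts R N0) n x by apply: sumr_ge0 => l _; exact: ler0n.
have mk : eta * ms (counts R N0) n x <= 2^-1.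
  apply: le_trans eta_le; rewrite mulrC; apply: ler_wpM2r; first exact: ltW.
  rewrite -sum_counts /mass [leRHS](bigID (fun l => anc par n l == x))/= lerDl.
  by apply: sumr_ge0 => l _; exact: ler0n.
rewrite ms1; have [->|NN0] := eqVneq N N0.
  have -> : ms (counts R N0) n x - (1 + eta) * ms (counts R N0) n x =
    - (eta * ms (counts R N0) n x) by ring.
  by rewrite normrN ger0_norm; [lra|apply: mulr_ge0 => //; exact: ltW].
have [e [Ne N0e]] : exists e, N = bump e /\ 0 < counts R N0 e.
  apply: contrapT => no; move: pN; rewrite /initial_law (negbTE NN0) mulr0 add0r.
  rewrite big1 ?ltxx// => e _; case: eqVneq => [Ne|]; last by rewrite mulr0.
  have : 0 <= counts R N0 e by exact: ler0n.
  rewrite le_eqVlt => /orP[/eqP<-|h]; first by rewrite !mul0r.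
  by exfalso; apply: no; exists e.
have -> : ms (counts R N) n x = ms (counts R N0) n x + (anc par n e == x)%:R.
  rewrite Ne /mass; under eq_bigr do rewrite counts_bump.
  rewrite big_split/=; congr (_ + _); rewrite big_mkcond (bigD1 e)//= eqxx big1 ?addr0.
    by case: ifP.
  by move=> l /negbTE->; case: ifP.
have -> : ms (counts R N0) n x + (anc par n e == x)%:R - (1 + eta) * ms (counts R N0) n x =
  (anc par n e == x)%:R - eta * ms (counts R N0) n x by ring.
have em : 0 <= eta * ms (counts R N0) n x by apply: mulr_ge0 => //; exact: ltW.
case: eqP => [ex|_]; last by rewrite sub0r normrN ger0_norm//; lra.
have : 0 < eta * ms (counts R N0) n x.
  apply: mulr_gt0 => //; rewrite /mass (bigD1 e) ?ex//=.
  by apply: ltr_pwDl => //; apply: sumr_ge0 => l _; exact: ler0n.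
by move=> h; rewrite ger0_norm/=; lra.
Qed.

End InitialLaw.

Section RoundedChain.
Variables (R : realType) (X : finType) (H : nat) (par : nat -> X -> X) (o : X).
Variables (k : nat) (w : nat -> R).
Hypotheses (H_gt0 : (0 < H)%N) (par_root : forall x, par H.-1 x = o).
Hypotheses (k_ge2 : (2 <= k)%N) (w_gt0 : forall n, 0 < w n).
Hypothesis w_geo : forall n, \sum_(m < n.+1) w m <= 2 * w n.
Hypothesis w_double : forall n, 2 * w n <= w n.+1.
Local Notation tmove := (tree_move H par w).
Local Notation F := {ffun X -> 'I_k.+2}.

Lemma tree_moveZ (a : R) m m' : 0 <= a ->
  tmove (fun x => a * m x) (fun x => a * m' x) = a * tmove m m'.
Proof.
move=> a0; rewrite /tree_move mulr_sumr; apply: eq_bigr => n _.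
rewrite mulrCA; congr (_ * _); rewrite mulr_sumr; apply: eq_bigr => x _.
by rewrite /mass -!mulr_sumr -mulrBr normrM (ger0_norm a0).
Qed.

Lemma tree_move_ge0 m m' : 0 <= tmove m m'.
Proof.
by apply: sumr_ge0 => n _; apply: mulr_ge0; [exact: ltW|apply: sumr_ge0 => x _].
Qed.

(** For [dl = 1 / (4 k)] the ratio [(1 + dl) / dl] is 4 k + 1, which is at most k ^ 4. *)
Lemma ln_servers_le : ln (4 * k%:R + 1 : R) <= 4 * ln k%:R.
Proof.
have k2 : 2 <= k%:R :> R by rewrite (ler_nat R 2 k).
rewrite [leRHS]mulr_natl -lnXn; last by lra.
rewrite ler_ln ?posrE; [|lra|by apply: exprn_gt0; lra].
have -> : (k%:R : R) ^+ 4 = k%:R ^+ 2 * k%:R ^+ 2 by ring.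
have k4 : 2 * k%:R <= k%:R ^+ 2 :> R by rewrite expr2 ler_wpM2r//; lra.
have : 2 * k%:R * (2 * k%:R) <= k%:R ^+ 2 * k%:R ^+ 2 :> R.
  by apply: ler_pM => //; lra.
nra.
Qed.

(** The same kernels drive two laws: [p], which starts from the balanced initial law and determines
    the kernels, and the law of the chain started at [N0], which is at most [2 * p]. Support
    properties pass from [p] to the chain, and costs at most double. *)
Theorem rounded_chain (N0 : F) : \sum_x (N0 x : nat) = k ->
  exists (kappa : seq X -> X -> F -> F -> R) (c : R),
  [/\ forall s r N N', 0 <= kappa s r N N',
    forall s r N, \sum_N' kappa s r N N' = 1,
    forall s N, 0 < chain_law N0 kappa s N -> \sum_x (N x : nat) = k,
    forall s r N, 0 < chain_law N0 kappa (rcons s r) N -> (0 < N r)%N &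
    forall (r : nat -> X) (M : nat -> X -> nat), M 0%N = (fun x => N0 x : nat) ->
      (forall t, \sum_x M t x = k) -> (forall t, (0 < M t.+1 (r t))%N) -> forall t,
      \sum_(j < t) \sum_N \sum_N' chain_law N0 kappa (mkseq r j) N *
          kappa (mkseq r j) (r j) N N' * tmove (counts R N) (counts R N') <=
      16 * (544 * 4) * ln k%:R ^+ 2 *
        (\sum_(j < t) tmove (fun x => (M j x)%:R) (fun x => (M j.+1 x)%:R)) + c].
Proof.
move=> N0k.
have k2 : 2 <= k%:R :> R by rewrite (ler_nat R 2 k).
(* The scaled total exceeds [k] by [a / 4 <= 1/2], so balanced configurations have at most [k + 1]
   servers and their counts fit in ['I_k.+2]. *)
pose dl : R := (4 * k%:R)^-1; pose a : R := (1 - dl)^-1.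
have dl0 : 0 < dl by rewrite invr_gt0; lra.
have dlk : dl * (4 * k%:R) = 1 by rewrite mulVf// gt_eqF//; lra.
have dl8 : dl <= 8^-1.
  by rewrite lef_pV2 ?posrE; lra.
have a0 : 0 < a by rewrite invr_gt0; lra.
have aE : a * (1 - dl) = 1 by rewrite mulVf// gt_eqF//; lra.
have a_le : 7 * a <= 8.
  by rewrite ler_pdivrMr; lra.
have ak : k%:R * (a - 1) <= 2^-1.
  have -> : a - 1 = a * dl by rewrite -[X in _ - X]aE; ring.
  have -> : k%:R * (a * dl) = a / 4 by move: dlk => /(congr1 (fun x => a / 4 * x)); lra.
  lra.
have a1 : 0 < a - 1.
  have -> : a - 1 = a * dl by rewrite -[X in _ - X]aE; ring.
  exact: mulr_gt0.
have dl4 : dl <= 4^-1 by lra.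
have [m [c [m0 m_ge0 mk mr mcost]]] :=
  fractional_algorithm H_gt0 par_root k_ge2 w_gt0 w_geo dl0 dl4 N0k.
pose S s x := a * m s x.
have S_sum s : \sum_x S s x = a * k%:R by rewrite -mulr_sumr mk.
pose good (e : (seq X * X) * (F -> R)) (q : F -> F -> R) := balanced_law H par (S e.1.1) e.2 ->
  [/\ balanced_law H par (S (rcons e.1.1 e.1.2)) (fun N' => \sum_N e.2 N * q N N'),
    forall N N', 0 < e.2 N -> 0 < q N N' -> \sum_x (N' x : nat) = \sum_x (N x : nat) &
    \sum_N \sum_N' e.2 N * q N N' * tmove (counts R N) (counts R N')
      <= 7 * tmove (S e.1.1) (S (rcons e.1.1 e.1.2))].
have /boolp.choice[q qP] : forall e, exists q : F -> F -> R,
    [/\ forall N N', 0 <= q N N', forall N, \sum_N' q N N' = 1 & good e q].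
  move=> [[s r] p]; have [bp|nb] := pselect (balanced_law H par (S s) p); last first.
    exists (fun N N' => (N' == N)%:R); split => [N N'|N|/nb//]; first exact: ler0n.
    by rewrite (bigD1 N)//= eqxx big1 ?addr0// => N' /negbTE->.
  have [|||q [q0 q1 qb qt qc]] := @rounding_step R X H par o k.+2 w H_gt0 par_root
      w_gt0 w_double (S s) (S (rcons s r)) p bp.
  - by move=> x; apply: mulr_ge0 => //; exact: ltW.
  - by rewrite !S_sum.
  - by rewrite S_sum -[k.+2]addn2 natrD; have := ak; lra.
  by exists q; split => // _.
pose p := history (initial_law N0 (a - 1)) (fun s r p N' => \sum_N p N * q ((s, r), p) N N').
have pS s r : p (rcons s r) = (fun N' => \sum_N p s N * q ((s, r), p s) N N').
  by rewrite /p history_rcons.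
have pb s : balanced_law H par (S s) (p s).
  elim/last_ind: s => [|s r IH].
    have := initial_law_balanced H par N0k a1 ak.
    by congr (balanced_law _ _ _ _); apply/funext => x; rewrite /S m0 addrC subrK.
  by rewrite pS; have [_ _ /(_ IH)[]] := qP ((s, r), p s).
pose ka s r := q ((s, r), p s).
have ka0 s r N N' : 0 <= ka s r N N' by have [h _ _] := qP ((s, r), p s); exact: h.
exists ka, (16 * c).
have mup s N : chain_law N0 ka s N <= 2 * p s N.
  elim/last_ind: s N => [|s r IH] N.
    have : 2^-1 * (N == N0)%:R <= p [::] N := initial_law_ge N0 a1 ak N.
    by rewrite -[chain_law _ _ _ _]/((N == N0)%:R); lra.
  rewrite chain_law_rcons pS mulr_sumr; apply: ler_sum => N' _.
  by rewrite mulrA ler_wpM2r// ka0.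
have mu_p s N : 0 < chain_law N0 ka s N -> 0 < p s N by have := mup s N; lra.
split=> //.
- by move=> s r N; have [_ h _] := qP ((s, r), p s); exact: h.
- move=> s; elim/last_ind: s => [|s r IH] N.
    by rewrite /chain_law /history/=; case: eqP => [->|]; rewrite ?ltxx.
  move=> /(chain_law_gt0 ka0)[N' [h1 h2]]; apply: etrans (IH _ h1).
  have [_ _ /(_ (pb s))[_ h _]] := qP ((s, r), p s).
  exact: h (mu_p _ _ h1) h2.
- move=> s r N /mu_p pN; have := bl_balanced (pb _) pN r (leq0n H).
  rewrite /mass/= !(big_pred1 r)// /S /counts; have := mr s r.
  move=> /(ler_wpM2l (ltW a0)); rewrite aE => h1; rewrite ltr_norml => /andP[h2 _].
  (* The scaled mass of [r] is at least 1, and [N r] is less than 1 away from it. *)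
  have : 0 < (N r : nat)%:R :> R by lra.
  by rewrite ltr0n.
move=> r M M0 Mk Mr t.
have := mcost r M M0 Mk Mr t.
have -> : (1 + dl) / dl = 4 * k%:R + 1.
  by rewrite mulrDl mul1r mulfV ?gt_eqF// /dl invrK.
have lk : 0 <= ln (k%:R : R) by rewrite ln_ge0//; lra.
set D := \sum_(j < t) tmove (fun x => (M j x)%:R) _.
have D0 : 0 <= D by apply: sumr_ge0 => j _; exact: tree_move_ge0.
set E := \sum_(j < t) tmove _ _ => hE.
have hE' : E <= 544 * 4 * ln k%:R ^+ 2 * D + c.
  apply: le_trans hE _; rewrite lerD2r; apply: ler_wpM2r => //.
  have := ler_wpM2l (mulr_ge0 (ler0n R 544) lk) ln_servers_le.
  by move=> /le_trans; apply; rewrite le_eqVlt; apply/orP; left; apply/eqP; ring.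
(* 16 = 2 * 8: the factor 2 of [mup], and [7 * a <= 8] for rounding and scaling. *)
apply: (@le_trans _ _ (16 * E)); last first.
  have -> : 16 * (544 * 4) * ln k%:R ^+ 2 * D + 16 * c = 16 * (544 * 4 * ln k%:R ^+ 2 * D + c) by ring.
  by apply: ler_wpM2l.
rewrite mulr_sumr; apply: ler_sum => j _; rewrite mkseqS; set s := mkseq r j.
have [_ _ /(_ (pb s))[_ _]] := qP ((s, r j), p s); rewrite /= /S tree_moveZ ?(ltW a0)// => h.
apply: (@le_trans _ _ (\sum_N \sum_N' 2 * (p s N * ka s (r j) N N' *
    tmove (counts R N) (counts R N')))).
  apply: ler_sum => N _; apply: ler_sum => N' _; rewrite !mulrA.
  apply: ler_wpM2r; first exact: tree_move_ge0.
  by apply: ler_wpM2r => //; exact: ka0.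
under eq_bigr do rewrite -mulr_sumr.
rewrite -mulr_sumr; have := tree_move_ge0 (m s) (m (rcons s (r j))).
move: h; rewrite -/(ka s (r j)); set x := \sum_N _; set y := tmove _ _ => h y0.
have := ler_wpM2r y0 a_le; lra.
Qed.

End RoundedChain.

(** * Realizing the chain on the unit interval *)

Section UnitInterval.
Variable R : realType.
Local Open Scope classical_set_scope.

Lemma unit_interval_measurable : measurable [set x : R | 0 <= x < 1].
Proof.
have -> : [set x : R | 0 <= x < 1] = `[0, 1[%classic by apply/seteqP; split => x /=; rewrite in_itv.
exact: measurable_itv.
Qed.

Definition unit_uniform := mrestr (@lebesgue_measure R) unit_interval_measurable.

HB.instance Definition _ := Measure.on unit_uniform.

Lemma unit_uniform_itv (a b : R) : 0 <= a -> a <= b -> b <= 1 ->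
  unit_uniform [set x : R | 0 <= x < 1 /\ a <= x < b] = (b - a)%:E.
Proof.
move=> a0 ab b1; rewrite /unit_uniform /mrestr.
have -> : [set x : R | 0 <= x < 1 /\ a <= x < b] `&` [set x | 0 <= x < 1] = `[a, b[%classic.
  apply/seteqP; split => x /=; rewrite in_itv/=; first by case=> -[].
  by move=> /andP[ax xb]; rewrite ax xb (le_trans a0 ax) (lt_le_trans xb b1).
rewrite lebesgue_measure_itv/= lte_fin; case: ltP => // ba.
have -> : a = b by apply/eqP; rewrite eq_le ab ba.
by rewrite subrr.
Qed.

Let unit_uniformT : unit_uniform setT = 1%E.
Proof.
have := unit_uniform_itv (lexx 0) ler01 (lexx 1); rewrite subr0 => <-.
rewrite /unit_uniform /mrestr setTI; congr lebesgue_measure.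
by apply/seteqP; split => x /= => [h|[]].
Qed.

HB.instance Definition _ :=
  @Measure_isProbability.Build _ _ _ unit_uniform unit_uniformT.

End UnitInterval.

Section Realization.
Variables (R : realType) (X : Type) (S : finType) (a : S).
Variable kappa : seq X -> X -> S -> S -> R.
Hypothesis kappa_ge0 : forall s r b b', 0 <= kappa s r b b'.
Hypothesis kappa_sum : forall s r b, \sum_b' kappa s r b b' = 1.
Local Notation mu := (chain_law a kappa).
Local Open Scope classical_set_scope.

(** Consecutive intervals of lengths [v b], in the enumeration order of [S], partition [0, 1). *)
Lemma quantile (v : S -> R) : (forall b, 0 <= v b) -> \sum_b v b = 1 ->
  exists lo : S -> R, (forall b, 0 <= lo b /\ lo b + v b <= 1) /\
    forall u, 0 <= u < 1 -> exists b, forall b', (lo b' <= u < lo b' + v b') = (b' == b).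
Proof.
move=> v0 v1; pose C m := \sum_(j < #|S| | (j < m)%N) v (enum_val j).
have CS (j : 'I_#|S|) : C j.+1 = C j + v (enum_val j).
  rewrite /C (bigD1 j)//= addrC; congr (_ + _); apply: eq_bigl => i.
  by rewrite ltnS -val_eqE/=; lia.
have C_le m m' : (m <= m')%N -> C m <= C m'.
  move=> mm; rewrite /C big_mkcond [leRHS]big_mkcond; apply: ler_sum => j _.
  by case: ifP => // jm; rewrite ?(leq_trans jm mm)//; case: ifP.
have Cn : C #|S| = 1.
  rewrite -v1 (reindex (@enum_val S predT)) /C; last first.
    by apply: onW_bij; exact: enum_val_bij.
  by apply: eq_bigl => j; rewrite ltn_ord.
have loS b : C (enum_rank b).+1 = C (enum_rank b) + v b by rewrite CS enum_rankK.
exists (fun b => C (enum_rank b)); split.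
  by move=> b; split; [apply: sumr_ge0|rewrite -loS -Cn; apply: C_le].
move=> u /andP[u0 u1].
have exm : exists m, u < C m by exists #|S|; rewrite Cn.
case: (ex_minnP exm) => -[|m] um mmin.
  by move: um; rewrite /C big_pred0_eq ltNge u0.
have mS : (m < #|S|)%N.
  by have := mmin _ (_ : u < C #|S|); rewrite Cn => /(_ u1).
have mu_ : C m <= u by rewrite leNgt; apply/negP => /mmin; rewrite ltnn.
exists (enum_val (Ordinal mS)) => b; rewrite -loS.
apply/idP/eqP => [/andP[h1 h2]|->]; last by rewrite enum_valK mu_ um.
rewrite -[b]enum_rankK; congr enum_val; apply: val_inj => /=.
apply/eqP; rewrite eqn_leq; apply/andP; split.
  rewrite leqNgt; apply/negP => /C_le h.
  by have := lt_le_trans um (le_trans h h1); rewrite ltxx.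
rewrite leqNgt; apply/negP => /C_le h.
by have := lt_le_trans h2 (le_trans h mu_); rewrite ltxx.
Qed.

(** One uniform variable drives the chain for all request sequences at once. Expected costs involve
    only the joint law of two consecutive states. *)
Theorem chain_realization : exists Z : measurableTypeR R -> seq X -> S,
  [/\ forall u, Z u [::] = a,
    forall u s r, 0 < kappa s r (Z u s) (Z u (rcons s r)),
    forall s b, measurable [set u | Z u s = b] &
    forall s r b b', @unit_uniform R [set u | Z u s = b /\ Z u (rcons s r) = b'] =
      (mu s b * kappa s r b b')%:E].
Proof.
have /boolp.choice[lo loP] : forall e : seq X * X * S, exists lo : S -> R,
    (forall b, 0 <= lo b /\ lo b + kappa e.1.1 e.1.2 e.2 b <= 1) /\
    forall u, 0 <= u < 1 -> exists b, forall b',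
      (lo b' <= u < lo b' + kappa e.1.1 e.1.2 e.2 b') = (b' == b).
  by move=> [[s r] b]; apply: quantile.
have /boolp.choice[pick pickP] : forall e : seq X * X * S * R, exists b, 0 <= e.2 < 1 ->
    forall b', (lo e.1 b' <= e.2 < lo e.1 b' + kappa e.1.1.1 e.1.1.2 e.1.2 b') = (b' == b).
  move=> [e u]/=; have [h|h] := boolP (0 <= u < 1); last by exists a.
  by have [_ /(_ _ h)[b hb]] := loP e; exists b.
(* Besides the state, keep a variable that is uniform on the unit interval given the
   past: the position inside the subinterval picked by the last transition. *)
pose step s r (c : S * R) : S * R := let b' := pick (s, r, c.1, c.2) in
  (b', (c.2 - lo (s, r, c.1) b') / kappa s r c.1 b').
(* Points outside [0, 1) have measure 0; the default 0 makes the pathwise properties hold for them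
   too. *)
pose V u := history (a, if 0 <= u < 1 then u else 0) step.
have VS u s r : V u (rcons s r) = step s r (V u s) by rewrite /V history_rcons.
have pick_in s r b u : 0 <= u < 1 -> let b' := pick (s, r, b, u) in
    lo (s, r, b) b' <= u < lo (s, r, b) b' + kappa s r b b'.
  by move=> u01 /=; rewrite (pickP (s, r, b, u))/=.
have V01 u s : 0 <= (V u s).2 < 1.
  elim/last_ind: s => [|s r IH].
    by rewrite /V /history/=; case: ifP; rewrite // lexx ltr01.
  rewrite VS /=; have /andP[h1 h2] := pick_in s r (V u s).1 _ IH.
  have k0 : 0 < kappa s r (V u s).1 (pick (s, r, (V u s).1, (V u s).2)).
    by have := le_lt_trans h1 h2; rewrite ltrDl.
  by rewrite ltr_pdivrMr// mul1r divr_ge0 ?subr_ge0 ?ltrBlDl// ltW.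
pose E s b c d := [set u | [/\ (V u s).1 = b & c <= (V u s).2 < d]].
(* The event is a union, over the previous state, of preimages under the affine rescaling of the
   picked subinterval. *)
have E_step s r b' c d : 0 <= c -> d <= 1 ->
    E (rcons s r) b' c d = \bigcup_(b in [set: S]) E s b
      (lo (s, r, b) b' + kappa s r b b' * c) (lo (s, r, b) b' + kappa s r b b' * d).
  move=> c0 d1; apply/seteqP; split => u.
    move=> []; rewrite VS /= => bE; have := pick_in s r (V u s).1 _ (V01 u s).
    rewrite bE; set b := (V u s).1; set x := (V u s).2 => /andP[h1 h2].
    have k0 : 0 < kappa s r b b' by have := le_lt_trans h1 h2; rewrite ltrDl.
    rewrite ler_pdivlMr// ltr_pdivrMr// => /andP[h3 h4]; exists b => //=; split => //.
    by rewrite -/x; apply/andP; split; lra.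
  move=> [b _ [/= bE /andP[h1 h2]]]; rewrite /E/= VS /step /= bE.
  have k0 : 0 < kappa s r b b'.
    rewrite lt_neqAle kappa_ge0 andbT; apply/eqP => k0.
    by have := le_lt_trans h1 h2; rewrite -k0 !mul0r ltxx.
  have : b' = pick (s, r, b, (V u s).2).
    apply/eqP; rewrite -(pickP (s, r, b, (V u s).2) (V01 u s))/=.
    have := ler_wpM2l (ltW k0) d1; have := mulr_ge0 (ltW k0) c0.
    by move=> *; apply/andP; split; lra.
  move=> <-; split => //; rewrite ler_pdivlMr// ltr_pdivrMr//.
  by apply/andP; split; lra.
have E0 b c d : 0 <= c -> d <= 1 -> E [::] b c d `&` [set u | 0 <= u < 1] =
    if a == b then [set u | 0 <= u < 1 /\ c <= u < d] else set0.
  move=> c0 d1; rewrite /E /V /history/=; apply/seteqP; split => u /=.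
    by move=> [[-> h] u01]; rewrite eqxx/=; split => //; rewrite u01 in h.
  case: eqP => // ab [u01 h]; rewrite u01; split => //.
have bnd s r b b' c d : 0 <= c -> c <= d -> d <= 1 ->
    [/\ 0 <= lo (s, r, b) b' + kappa s r b b' * c,
      lo (s, r, b) b' + kappa s r b b' * c <= lo (s, r, b) b' + kappa s r b b' * d &
      lo (s, r, b) b' + kappa s r b b' * d <= 1].
  move=> c0 cd d1; have [/(_ b')[/= l0 l1] _] := loP (s, r, b); have k0 := kappa_ge0 s r b b'.
  split; [by rewrite addr_ge0// mulr_ge0|by rewrite lerD2l ler_wpM2l|].
  by apply: le_trans l1; rewrite lerD2l ler_piMr.
have E_meas s b c d : 0 <= c -> c <= d -> d <= 1 -> measurable (E s b c d).
  elim/last_ind: s b c d => [|s r IH] b c d c0 cd d1; last first.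
    rewrite E_step//; apply: fin_bigcup_measurable; first exact: finite_finset.
    by move=> b' _; have [h1 h2 h3] := bnd s r b' b c d c0 cd d1; exact: IH.
  have -> : E [::] b c d = E [::] b c d `&` [set u | 0 <= u < 1] `|`
      E [::] b c d `\` [set u | 0 <= u < 1] by rewrite setUIDK.
  rewrite E0//; apply: measurableU.
    case: eqP => // _; rewrite (_ : [set _ | _] =
        [set u : R | 0 <= u < 1] `&` `[c, d[%classic).
      by apply: measurableI; [exact: unit_interval_measurable|exact: measurable_itv].
    by apply/seteqP; split => u /=; rewrite in_itv.
  have [h|h] := pselect (a = b /\ c <= 0 < d).
    rewrite (_ : _ `\` _ = ~` [set u : R | 0 <= u < 1]).
      by apply: measurableC; exact: unit_interval_measurable.
    apply/seteqP; split => u /=; [by case|move=> h1; split => //].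
    by rewrite /E/= /V /history/=; move/negP/negbTE: h1 => ->; case: h.
  rewrite (_ : _ `\` _ = set0)//; apply/seteqP; split => u //= [[]].
  by rewrite /V /history/= => h1 h2 /negP/negbTE h3; rewrite h3 in h2; apply: h.
have E_prob s b c d : 0 <= c -> c <= d -> d <= 1 ->
    @unit_uniform R (E s b c d) = (mu s b * (d - c))%:E.
  elim/last_ind: s b c d => [|s r IH] b c d c0 cd d1; last first.
    rewrite E_step// measure_fin_bigcup//; first last.
    - by move=> b' _; have [h1 h2 h3] := bnd s r b' b c d c0 cd d1; exact: E_meas.
    - by move=> b1 b2 _ _ [u [[<- _] [<- _]]].
    - exact: finite_finset.
    rewrite (@fsbigE _ _ _ _ _ (index_enum S)) ?index_enum_uniq//; last first.
      by move=> i _; rewrite mem_index_enum.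
    rewrite chain_law_rcons mulr_suml -sumEFin.
    apply: eq_big => [i|b' _]; first by rewrite classical_sets.in_setT.
    have [h1 h2 h3] := bnd s r b' b c d c0 cd d1; apply: etrans (IH _ _ _ h1 h2 h3) _.
    by congr EFin; ring.
  have -> : @unit_uniform R (E [::] b c d) =
      @unit_uniform R (E [::] b c d `&` [set u | 0 <= u < 1]).
    rewrite /unit_uniform /mrestr; congr (lebesgue_measure _).
    by apply/seteqP; split => u [] //= [].
  rewrite E0// [mu _ _]/(b == a)%:R eq_sym; case: eqP => _.
    by rewrite mul1r; apply: unit_uniform_itv.
  by rewrite measure0 mul0r.
exists (fun u s => (V u s).1); split => //.
- move=> u s r; rewrite VS /=; have /andP[h1 h2] := pick_in s r (V u s).1 _ (V01 u s).
  by have := le_lt_trans h1 h2; rewrite ltrDl.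
- move=> s b; rewrite (_ : [set _ | _] = E s b 0 1); first exact: E_meas.
  by apply/seteqP; split => u /= => [h|[]//]; split => //; exact: V01.
move=> s r b b'; rewrite (_ : [set _ | _] = E s b (lo (s, r, b) b')
    (lo (s, r, b) b' + kappa s r b b')).
  have [/(_ b')[/= l0 l1] _] := loP (s, r, b); have k0 := kappa_ge0 s r b b'.
  by rewrite E_prob ?lerDl// addrC addKr.
apply/seteqP; split => u /= [bE]; last first.
  move=> h; split => //; rewrite VS /= bE; apply/esym/eqP.
  by rewrite -(pickP (s, r, b, (V u s).2) (V01 u s)).
rewrite VS /= bE => <-; split => //; exact: pick_in (V01 u s).
Qed.

End Realization.

(** * Realizing count moves by server moves *)

Section Matching.
Variables (R : realType) (X : finType) (H : nat) (par : nat -> X -> X) (o : X).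
Variable w : nat -> R.
Hypotheses (H_gt0 : (0 < H)%N) (par_root : forall x, par H.-1 x = o).
Hypothesis w_gt0 : forall n, 0 < w n.
Local Notation ms := (mass par).
Local Notation an := (anc par).
Implicit Types f : X -> int.

(** The value of [tree_move] for a single server: at each level where the ancestors differ, one node
    loses it and another gains it. *)
Definition tree_dist (a b : X) : R := \sum_(n < H) w n * (2 * (an n a != an n b)%:R).

Lemma tree_dist_ge0 a b : 0 <= tree_dist a b.
Proof.
by apply: sumr_ge0 => n _; apply: mulr_ge0; [exact: ltW|rewrite mulr_ge0 ?ler0n].
Qed.

Lemma tree_distxx a : tree_dist a a = 0.
Proof. by rewrite /tree_dist big1// => n _; rewrite eqxx !mulr0. Qed.

Lemma tree_dist_triangle b a c : tree_dist a c <= tree_dist a b + tree_dist b c.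
Proof.
rewrite /tree_dist -big_split/=; apply: ler_sum => n _; rewrite -mulrDr -mulrDr.
apply: ler_wpM2l; first exact: ltW.
apply: ler_wpM2l; rewrite // -natrD ler_nat.
by case: eqVneq => // ac; do 2! case: eqVneq => //=; move: ac => /[swap] <- /[swap] <-; rewrite eqxx.
Qed.

Lemma mass_pos_descend f n x : 0 < ms f n x ->
  exists2 a, an n a = x & forall m, (m <= n)%N -> 0 < ms f m (an m a).
Proof.
elim: n x => [|n IH] x fx.
  by exists x => // m; rewrite leqn0 => /eqP ->.
have [y yx fy] : exists2 y, par n y = x & 0 < ms f n y.
  apply: contrapT => h; move: fx; rewrite massS ltNge; apply/negP; rewrite negbK.
  apply: sumr_le0 => y /eqP yx; rewrite leNgt; apply/negP => fy; apply: h; by exists y.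
have [a ay am] := IH y fy; exists a; first by rewrite /= ay.
move=> m; rewrite leq_eqVlt => /orP[/eqP->|]; last by rewrite ltnS; exact: am.
by rewrite /= ay yx.
Qed.

Lemma massN f n x : ms (fun y => - f y) n x = - ms f n x.
Proof. by rewrite /mass sumrN. Qed.

(** At the highest level with a nonzero mass, siblings sum to 0, so both signs occur among them;
    each sign is followed down to a leaf. *)
Lemma transport_pair f x0 : \sum_x f x = 0 -> f x0 != 0 ->
  exists n a b, [/\ an n.+1 a = an n.+1 b, forall m, (m <= n)%N -> 0 < ms f m (an m a) &
    forall m, (m <= n)%N -> ms f m (an m b) < 0].
Proof.
move=> f0 fx0; pose P n := (n <= H)%N && [exists x, ms f n x != 0].
have exP : exists n, P n.
  by exists 0%N; apply/existsP; exists x0; rewrite /mass/= (big_pred1 x0).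
have PH n : P n -> (n <= H)%N by case/andP.
case: (ex_maxnP exP PH) => n /andP[nH /existsP[x fx]] nmax.
have {}nH : (n < H)%N.
  rewrite ltn_neqAle nH andbT; apply/eqP => nE; move: fx.
  by rewrite nE (mass_root H_gt0 par_root) f0 if_same eqxx.
have up p : ms f n.+1 p = 0.
  apply/eqP/negPn/negP => fp; suff /nmax : P n.+1 by rewrite ltnn.
  by rewrite /P nH; apply/existsP; exists p.
have sib (g : X -> int) y : ms g n.+1 (par n y) = 0 -> 0 < ms g n y ->
    exists2 z, par n z = par n y & ms g n z < 0.
  rewrite massS => g0 gy; apply: contrapT => h; move: g0; rewrite (bigD1 y)//=.
  apply/eqP; rewrite gt_eqF//; apply: ltr_pwDl => //; apply: sumr_ge0 => z /andP[/eqP zy _].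
  by rewrite leNgt; apply/negP => gz; apply: h; exists z.
have [y fy] : exists y, 0 < ms f n y.
  have [|] := ltrP 0 (ms f n x); first by exists x.
  rewrite le_eqVlt (negbTE fx)/= => fx'.
  have [||z _] := sib (fun y => - f y) x; rewrite ?massN ?up ?oppr0 ?oppr_gt0//.
  by rewrite oppr_lt0 => fz; exists z.
have [z zy fz] := sib f y (up _) fy.
have [a ay am] := mass_pos_descend fy.
have [|b bz bm] := @mass_pos_descend (fun y => - f y) n z; first by rewrite massN oppr_gt0.
exists n, a, b; split => //; first by rewrite /= ay bz.
by move=> m mn; have := bm m mn; rewrite massN oppr_gt0.
Qed.

Definition mass_norm f : R := \sum_(n < H) w n * \sum_x `|(ms f n x)%:~R|.

(** Every node left by the server has a positive surplus and every node entered a negative one, so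
    each of these integers loses 1 in absolute value. *)
Lemma mass_norm_move f n a b : an n.+1 a = an n.+1 b ->
  (forall m, (m <= n)%N -> 0 < ms f m (an m a)) ->
  (forall m, (m <= n)%N -> ms f m (an m b) < 0) ->
  mass_norm (fun x => f x - (x == a)%:R + (x == b)%:R) + tree_dist a b <= mass_norm f.
Proof.
move=> ab fa fb; rewrite /mass_norm -big_split/=; apply: ler_sum => m _.
rewrite -mulrDr; apply: ler_wpM2l; first exact: ltW.
have msE x : ms (fun x => f x - (x == a)%:R + (x == b)%:R) m x =
    ms f m x - (an m a == x)%:R + (an m b == x)%:R.
  have E c : \sum_(l | an m l == x) (l == c)%:R = (an m c == x)%:R :> int.
    rewrite big_mkcond (bigD1 c)//= eqxx big1 ?addr0; first by case: ifP.
    by move=> l /negbTE->; case: ifP.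
  by rewrite /mass big_split/= sumrB !E.
have [e|ne] := eqVneq (an m a) (an m b).
  rewrite mulr0 addr0; apply: ler_sum => x _; rewrite msE e -addrA addNr addr0//.
have mn : (m <= n)%N.
  by rewrite leqNgt; apply: contra ne => nm; apply/eqP; exact: anc_eq nm ab.
have -> : 2 * true%:R = \sum_x ((an m a == x)%:R + (an m b == x)%:R) :> R.
  by rewrite big_split/= !sum_delta mulr1.
rewrite -big_split/=; apply: ler_sum => x _; rewrite msE.
rewrite -!intr_norm -[X in _ + (X + _)]mulrz_nat -[X in _ + (_ + X)]mulrz_nat -!intrD ler_int.
case: eqVneq => [<-|_].
  by rewrite eq_sym (negbTE ne) addr0; have := fa m mn; lia.
by case: eqVneq => [<-|_]; rewrite ?subr0 ?addr0 ?add0r//; have := fb m mn; lia.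
Qed.

Variable k : nat.
Implicit Types rho : k.-tuple X.

Definition occ rho (x : X) : nat := count_mem x rho.

Lemma occE rho x : occ rho x = (\sum_(i < k) (tnth rho i == x))%N.
Proof. by rewrite /occ -sum1_count big_tuple big_mkcond. Qed.

Lemma sum_occ rho : (\sum_x occ rho x = k)%N.
Proof.
under eq_bigr do rewrite occE.
rewrite exchange_big/= -[RHS]card_ord -sum1_card; apply: eq_bigr => i _.
by rewrite (bigD1 (tnth rho i))//= eqxx big1// => x; rewrite eq_sym => /negbTE->.
Qed.

Definition config_tree_dist rho rho' : R :=
  \sum_(i < k) tree_dist (tnth rho i) (tnth rho' i).

(** Greedy: a server moves between leaves given by [transport_pair], the decrease of [mass_norm]
    pays for the move, and the total surplus decreases. *)
Theorem matching rho (N : X -> nat) : (\sum_x N x = k)%N ->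
  exists2 rho', occ rho' = N & config_tree_dist rho rho' <=
    tree_move H par w (fun x => (occ rho x)%:R) (fun x => (N x)%:R).
Proof.
move=> Nk.
have moveE rho1 : tree_move H par w (fun x => (occ rho1 x)%:R) (fun x => (N x)%:R) =
    mass_norm (fun x => (occ rho1 x)%:Z - (N x)%:Z).
  apply: eq_bigr => n _; congr (_ * _); apply: eq_bigr => x _.
  rewrite distrC; congr (`|_|); rewrite /mass -sumrB rmorph_sum/=; apply: eq_bigr => l _.
  by rewrite rmorphB.
rewrite moveE; have [c] := ubnP (\sum_x (occ rho x - N x)%N)%N.
elim: c rho => // c IH rho; rewrite ltnS => rc.
have [E|] := pselect (occ rho = N).
  exists rho => //; rewrite /config_tree_dist big1 => [|i _]; last exact: tree_distxx.
  apply: sumr_ge0 => n _; apply: mulr_ge0; first exact: ltW.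
  exact: sumr_ge0.
move=> neq; pose f x : int := (occ rho x)%:Z - (N x)%:Z.
have [x0 fx0] : exists x0, f x0 != 0.
  apply: contrapT => h; apply: neq; apply/funext => x; apply/eqP.
  rewrite -eqz_nat -subr_eq0; apply/negPn/negP => fx; apply: h; by exists x.
have f0 : \sum_x f x = 0.
  by rewrite /f sumrB -!(big_morph Posz PoszD erefl) sum_occ Nk subrr.
have [n [a [b [ab fa fb]]]] := transport_pair f0 fx0.
have fa0 : 0 < f a by have := fa 0%N (leq0n _); rewrite /mass/= (big_pred1 a).
have fb0 : f b < 0 by have := fb 0%N (leq0n _); rewrite /mass/= (big_pred1 b).
have a_in : a \in rho.
  rewrite -has_pred1 has_count; apply: leq_ltn_trans (leq0n (N a)) _.
  by move: fa0; rewrite subr_gt0 ltz_nat.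
have [i ia] := tnthP _ _ a_in.
have anb : a != b by apply: contraTneq fa0 => ->; rewrite -leNgt ltW.
pose rho1 := [tuple if j == i then b else tnth rho j | j < k].
have occ1 x : (occ rho1 x)%:Z = (occ rho x)%:Z - (x == a)%:R + (x == b)%:R.
  rewrite !occE (bigD1 i)//= [X in _ = Posz X - _ + _](bigD1 i)//= tnth_mktuple eqxx -ia.
  have -> : (\sum_(j < k | j != i) (tnth rho1 j == x) =
      \sum_(j < k | j != i) (tnth rho j == x))%N.
    by apply: eq_bigr => j /negbTE ji; rewrite tnth_mktuple ji.
  rewrite ![x == _]eq_sym; rewrite !natz.
  by move: (\sum_(j < k | _) _)%N => S; case: (a == x); case: (b == x); lia.
have [|rho' occ' h] := IH rho1.
  apply: leq_trans rc; rewrite (bigD1 a)//= [leqRHS](bigD1 a)//=.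
  rewrite -addSn; apply: leq_add.
    have := occ1 a; rewrite eqxx (negbTE anb); move: fa0; rewrite /f.
    by move: (occ rho1 a) (occ rho a) (N a) => *; lia.
  apply: leq_sum => x xa; have := occ1 x; rewrite (negbTE xa).
  have := fb0; rewrite /f; case: eqVneq => [->|_].
    by move: (occ rho1 b) (occ rho b) (N b) => *; lia.
  by move: (occ rho1 x) (occ rho x) (N x) => *; lia.
exists rho' => //.
apply: le_trans (mass_norm_move ab fa fb).
have -> : (fun x => f x - (x == a)%:R + (x == b)%:R) =
    (fun x => (occ rho1 x)%:Z - (N x)%:Z).
  by apply/funext => x; rewrite occ1 /f; ring.
apply: le_trans (lerD h (lexx _)).
rewrite /config_tree_dist (bigD1 i)//= [leRHS]addrC [X in _ <= _ + X](bigD1 i)//= addrA.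
apply: lerD.
  by rewrite tnth_mktuple eqxx -ia; exact: tree_dist_triangle.
by apply: ler_sum => j /negbTE ji; rewrite tnth_mktuple ji.
Qed.

End Matching.

(** * The randomized algorithm on a levelled tree *)

Lemma measurable_prop d (Omega : measurableType d) (Q : Prop) :
  measurable [set _ : Omega | Q]%classic.
Proof.
have [q|nq] := pselect Q; [rewrite (_ : mkset _ = setT)|rewrite (_ : mkset _ = set0)] => //;
  by apply/seteqP; split.
Qed.

Lemma measurable_pair_level d (Omega : measurableType d) (S S' : Type)
    (Y : Omega -> S) (Y' : Omega -> S') :
  (forall b, measurable [set u | Y u = b]%classic) ->
  (forall b, measurable [set u | Y' u = b]%classic) ->
  forall e, measurable [set u | (Y u, Y' u) = e]%classic.
Proof.
move=> mY mY' [b b'].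
rewrite (_ : [set _ | _]%classic = ([set u | Y u = b] `&` [set u | Y' u = b'])%classic).
  exact: measurableI.
by apply/seteqP; split => u /= [-> ->].
Qed.

Section FiniteValued.
Variables (R : realType) (d : measure_display) (Omega : measurableType d).
Variables (S : finType) (Y : Omega -> S).
Local Open Scope classical_set_scope.
Hypothesis Y_meas : forall b, measurable [set u | Y u = b].

Lemma finite_valued_measurable (Q : S -> Prop) : measurable [set u | Q (Y u)].
Proof.
rewrite (_ : [set _ | _] = \bigcup_(b in [set b | Q b]) [set u | Y u = b]).
  by apply: fin_bigcup_measurable; [exact: finite_finset|move=> b _; exact: Y_meas].
by apply/seteqP; split => u /=; [by exists (Y u)|move=> [b Qb ->]].
Qed.

Lemma finite_valued_measurable_fun d' (T : measurableType d') (g : S -> T) :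
  measurable_fun setT (fun u => g (Y u)).
Proof. by move=> _ U _; rewrite setTI; exact: finite_valued_measurable (fun b => U (g b)). Qed.

Lemma integral_finite_valued (mu : {measure set Omega -> \bar R}) (g : S -> R) :
  (forall b, 0 <= g b) -> (\int[mu]_u (g (Y u))%:E =
    \sum_b (g b)%:E * mu [set u | Y u = b])%E.
Proof.
move=> g0; pose f b u : \bar R := ((g b)%:E * (\1_[set u | Y u = b] u)%:E)%E.
have indE b u : \1_[set u | Y u = b] u = (Y u == b)%:R :> R.
  rewrite indicE; congr (_%:R).
  by congr nat_of_bool; apply/idP/eqP => [|h]; rewrite in_setE.
have fE b u : f b u = (g b * (Y u == b)%:R)%:E by rewrite /f indE -EFinM.
transitivity (\int[mu]_u \sum_b f b u)%E.
  apply: eq_integral => u _; rewrite (bigD1 (Y u))//= big1 ?fE ?eqxx ?mulr1 ?adde0//.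
  by move=> b; rewrite eq_sym => /negbTE bY; rewrite fE bY mulr0.
have ind_meas b : measurable_fun setT (fun u => (\1_[set u | Y u = b] u)%:E : \bar R).
  rewrite (_ : (fun u => _) = (fun u => ((Y u == b)%:R)%:E)).
    exact: (finite_valued_measurable_fun (fun y => ((y == b)%:R)%:E : \bar R)).
  by apply/funext => u; rewrite indE.
rewrite ge0_integral_sum//; first last.
- by move=> b u _; rewrite fE lee_fin mulr_ge0.
- move=> b; rewrite (_ : f b = (fun u => (g b * (Y u == b)%:R)%:E)).
    exact: (finite_valued_measurable_fun (fun y => (g b * (y == b)%:R)%:E : \bar R)).
  by apply/funext => u; rewrite fE.
apply: eq_bigr => b _; rewrite ge0_integralZl_EFin//.
by rewrite integral_indic// setIT.
Qed.

End FiniteValued.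

Section LevelTreeAlgorithm.
Variables (R : realType) (X : finType) (H : nat) (par : nat -> X -> X) (o : X).
Variables (k : nat) (w : nat -> R).
Hypotheses (H_gt0 : (0 < H)%N) (par_root : forall x, par H.-1 x = o).
Hypotheses (k_ge2 : (2 <= k)%N) (w_gt0 : forall n, 0 < w n).
Hypothesis w_geo : forall n, \sum_(m < n.+1) w m <= 2 * w n.
Hypothesis w_double : forall n, 2 * w n <= w n.+1.
Local Notation F := {ffun X -> 'I_k.+2}.
Local Notation tmove := (tree_move H par w).
Local Notation cdist := (config_tree_dist H par w).
Local Notation U := (@unit_uniform R).
Local Open Scope classical_set_scope.

Lemma tree_move_occ (rho rho' : k.-tuple X) :
  tmove (fun x => (occ rho x)%:R) (fun x => (occ rho' x)%:R) <= cdist rho rho'.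
Proof.
rewrite /config_tree_dist exchange_big/=; apply: ler_sum => n _.
rewrite -mulr_sumr; apply: ler_wpM2l; first exact: ltW.
have mE (rho1 : k.-tuple X) x : mass par (fun x => (occ rho1 x)%:R : R) n x =
    \sum_(i < k) (anc par n (tnth rho1 i) == x)%:R.
  rewrite /mass; under eq_bigr do rewrite occE natr_sum.
  rewrite exchange_big/=; apply: eq_bigr => i _.
  rewrite big_mkcond (bigD1 (tnth rho1 i))//= eqxx big1 ?addr0; first by case: ifP.
  by move=> l; rewrite eq_sym => /negbTE->; case: ifP.
apply: (@le_trans _ _ (\sum_x \sum_(i < k)
    `|(anc par n (tnth rho' i) == x)%:R - (anc par n (tnth rho i) == x)%:R|)).
  by apply: ler_sum => x _; rewrite !mE -sumrB; exact: ler_norm_sum.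
rewrite exchange_big/=; apply: ler_sum => i _.
move: (anc par n (tnth rho i)) (anc par n (tnth rho' i)) => a b.
have [<-|_] := eqVneq a b; first by rewrite big1 ?mulr0// => x _; rewrite subrr normr0.
rewrite mulr1; apply: (@le_trans _ _ (\sum_x ((b == x)%:R + (a == x)%:R))).
  by apply: ler_sum => x _; rewrite (le_trans (ler_normB _ _))// !ger0_norm.
by rewrite big_split/= !sum_delta.
Qed.

(** The random counts are followed by deterministic matchings, whose cost is at most the movement of
    the counts. *)
Theorem level_tree_algorithm (rho0 : k.-tuple X) :
  exists (A : measurableTypeR R -> seq X -> k.-tuple X) (c : R),
  [/\ forall u, A u [::] = rho0, forall u s r, r \in A u (rcons s r),
    forall s rho, measurable [set u | A u s = rho] &
    forall (r : nat -> X) (rho : nat -> k.-tuple X), rho 0%N = rho0 ->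
      (forall t, r t \in rho t.+1) -> forall t,
      (\sum_(j < t) \int[U]_u (cdist (A u (mkseq r j)) (A u (mkseq r j.+1)))%:E <=
        (16 * (544 * 4) * ln k%:R ^+ 2 *
          (\sum_(j < t) cdist (rho j) (rho j.+1)) + c)%:E)%E].
Proof.
have occ_le (rho : k.-tuple X) x : (occ rho x <= k)%N.
  by rewrite /occ -[leqRHS](size_tuple rho) count_size.
pose N0 : F := [ffun x => inord (occ rho0 x)].
have N0E x : N0 x = occ rho0 x :> nat by rewrite ffunE inordK// ltnS leqW.
have N0k : \sum_x (N0 x : nat) = k by under eq_bigr do rewrite N0E; exact: sum_occ.
have [ka [c [ka0 ka1 kt kr kc]]] :=
  rounded_chain H_gt0 par_root k_ge2 w_gt0 w_geo w_double N0k.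
have [Z [Z0 Zk Zm Zp]] := chain_realization N0 ka0 ka1.
(* Properties known on the support of the chain law thereby hold for every [u], not only almost
   surely. *)
have Z_pos u s : 0 < chain_law N0 ka s (Z u s).
  elim/last_ind: s => [|s r IH]; first by rewrite Z0 /chain_law /history/= eqxx.
  rewrite chain_law_rcons (bigD1 (Z u s))//=; apply: ltr_pwDl.
    by apply: mulr_gt0 => //; exact: Zk.
  by apply: sumr_ge0 => b _; apply: mulr_ge0 => //; exact: chain_law_ge0.
have /boolp.choice[mt mtP] : forall e : k.-tuple X * F, exists rho' : k.-tuple X,
    \sum_x (e.2 x : nat) = k -> occ rho' = (fun x => e.2 x : nat) /\
      cdist e.1 rho' <= tmove (fun x => (occ e.1 x)%:R) (counts R e.2).
  move=> [rho N]/=; have [Nk|] := eqVneq (\sum_x (N x : nat)) k; last by move=> /eqP h; exists rho.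
  have [rho' h1 h2] := matching H_gt0 par_root w_gt0 rho Nk.
  by exists rho' => _; split.
pose A (u : measurableTypeR R) := history rho0 (fun s r rho => mt (rho, Z u (rcons s r))).
have AS u s r : A u (rcons s r) = mt (A u s, Z u (rcons s r)) by rewrite /A history_rcons.
have occA u s : occ (A u s) = (fun x => Z u s x : nat).
  elim/last_ind: s => [|s r IH]; first by apply/funext => x; rewrite Z0 N0E.
  by rewrite AS; have [] := mtP (A u s, Z u (rcons s r)) (kt _ _ (Z_pos u _)).
have A_meas s rho : measurable [set u | A u s = rho].
  elim/last_ind: s rho => [|s r IH] rho; first exact: measurable_prop (rho0 = rho).
  have m2 := measurable_pair_level IH (Zm (rcons s r)).
  have := finite_valued_measurable m2 (fun e => mt e = rho).
  by congr measurable; apply/seteqP; split => u /=; rewrite AS.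
exists A, c; split => //.
- move=> u s r; rewrite -has_pred1 has_count -/(occ _ _) occA.
  exact: kr (Z_pos u (rcons s r)).
move=> r rho rho00 rho_r t.
have rocc t' : (0 < occ (rho t'.+1) (r t'))%N by rewrite /occ -has_count has_pred1.
have := kc r (fun j => occ (rho j)) _ (fun j => sum_occ (rho j)) rocc t.
rewrite rho00 => /(_ (funext (fun x => esym (N0E x)))) => kc'.
have L0 : 0 <= 16 * (544 * 4) * ln k%:R ^+ 2 :> R.
  apply: mulr_ge0; last by rewrite exprn_ge0// ln_ge0// ler1n ltnW.
  by apply: mulr_ge0; [exact: ler0n|apply: mulr_ge0; exact: ler0n].
apply: (@le_trans _ _ (\sum_(j < t) (\sum_N \sum_N' chain_law N0 ka (mkseq r j) N *
    ka (mkseq r j) (r j) N N' * tmove (counts R N) (counts R N'))%:E)%E); last first.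
  rewrite sumEFin lee_fin; apply: le_trans kc' _; rewrite lerD2r; apply: ler_wpM2l => //.
  by apply: ler_sum => j _; exact: tree_move_occ.
apply: lee_sum => j _; rewrite mkseqS; set s := mkseq r j.
have m2 := measurable_pair_level (Zm s) (Zm (rcons s (r j))).
have m3 := measurable_pair_level (A_meas s) (A_meas (rcons s (r j))).
pose g (e : F * F) := tmove (counts R e.1) (counts R e.2).
have g0 e : 0 <= g e by exact: tree_move_ge0.
apply: (@le_trans _ _ (\int[U]_u (g (Z u s, Z u (rcons s (r j))))%:E)%E).
  apply: ge0_le_integral => //.
  - move=> u _; rewrite lee_fin; apply: sumr_ge0 => i _; exact: tree_dist_ge0.
  - exact: (finite_valued_measurable_fun m3 (fun e => (cdist e.1 e.2)%:E : \bar R)).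
  - exact: (finite_valued_measurable_fun m2 (fun e => (g e)%:E : \bar R)).
  move=> u _; rewrite lee_fin AS.
  have [_] := mtP (A u s, Z u (rcons s (r j))) (kt _ _ (Z_pos u _)).
  by rewrite /= occA.
have -> : (\int[U]_u (g (Z u s, Z u (rcons s (r j))))%:E = \sum_e (g e)%:E *
    U [set u | (Z u s, Z u (rcons s (r j))) = e])%E.
  exact: (integral_finite_valued m2 _ g0).
rewrite pair_big/= -sumEFin.
apply: lee_sum => -[N N'] _ /=.
rewrite (_ : [set _ | _] = [set u | Z u s = N /\ Z u (rcons s (r j)) = N']).
  by rewrite Zp -EFinM lee_fin mulrC.
by apply/seteqP; split => u /= [-> ->].
Qed.

End LevelTreeAlgorithm.

(** * Embedding an ultrametric into a levelled tree *)

Section Ultrametric.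
Variables (R : realType) (X : finType) (d : X -> X -> R).
Hypotheses (d_xx : forall x, d x x = 0) (dC : forall x y, d x y = d y x).
Hypothesis d_ge0 : forall x y, 0 <= d x y.
Hypothesis d_ultra : forall x y z c, d x y <= c -> d y z <= c -> d x z <= c.
Implicit Types (x y : X) (c : R).

(** Canonical: in an ultrametric any two points of a closed ball define the same ball, hence the
    same [pick]. *)
Definition ball_rep c x : X := odflt x [pick y | d x y <= c].

Lemma ball_rep_near c x : 0 <= c -> d x (ball_rep c x) <= c.
Proof. by move=> c0; rewrite /ball_rep; case: pickP => //= _; rewrite d_xx. Qed.

Lemma ball_rep_eqE c x y : 0 <= c -> (ball_rep c x == ball_rep c y) = (d x y <= c).
Proof.
move=> c0; apply/eqP/idP => [E|xy].
  by apply: d_ultra (ball_rep_near x c0) _; rewrite E dC ball_rep_near.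
rewrite /ball_rep (@eq_pick _ _ (fun z => d y z <= c)) => [|z]; last first.
  by apply/idP/idP; apply: d_ultra; rewrite // dC.
by case: pickP => // /(_ y); rewrite d_xx c0.
Qed.

Lemma ball_rep_dist x y x' y' : d x x' = 0 -> d y y' = 0 -> d x' y' = d x y.
Proof.
have le a b a' b' : d a a' = 0 -> d b b' = 0 -> d a' b' <= d a b.
  move=> aa bb; apply: (@d_ultra _ b); last by rewrite bb d_ge0.
  by apply: (@d_ultra _ a); rewrite // dC aa d_ge0.
by move=> xx yy; apply/eqP; rewrite eq_le !le// dC.
Qed.

(** [theta] is the inverse of 1 plus the sum of all inverse distances, where the convention
    [0^-1 = 0] makes pairs at distance 0 harmless. *)
Lemma scale_exists : exists (theta : R) (H : nat), [/\ 0 < theta, (0 < H)%N,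
  forall x y, 0 < d x y -> theta <= d x y & forall x y, d x y <= theta * 2 ^+ H].
Proof.
pose M := 1 + \sum_(e : X * X) (d e.1 e.2)^-1.
have iv0 (e : X * X) : 0 <= (d e.1 e.2)^-1 by rewrite invr_ge0.
have M0 : 0 < M by rewrite ltr_pwDl// sumr_ge0.
pose D := \sum_(e : X * X) d e.1 e.2.
have D0 : 0 <= D * M by apply: mulr_ge0; [exact: sumr_ge0|exact: ltW].
exists M^-1, (Num.bound (D * M)).+1; split => //; first by rewrite invr_gt0.
  move=> x y xy; rewrite -[leRHS]invrK lef_pV2 ?posrE ?invr_gt0//.
  rewrite /M (bigD1 (x, y))//= addrCA lerDl; apply: addr_ge0 => //.
  by apply: sumr_ge0 => e _.
move=> x y; apply: (@le_trans _ _ D).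
  by rewrite /D (bigD1 (x, y))//= lerDl; apply: sumr_ge0.
rewrite mulrC ler_pdivlMr//; apply: (le_trans (ltW (archi_boundP D0))).
by rewrite -natrX ler_nat ltnW// (leq_trans (ltn_expl _ (ltnSn 1)))// leq_exp2l.
Qed.

Variables (theta : R) (H : nat).
Hypotheses (theta_gt0 : 0 < theta) (H_gt0 : (0 < H)%N).
Hypothesis theta_le : forall x y, 0 < d x y -> theta <= d x y.
Hypothesis dist_le : forall x y, d x y <= theta * 2 ^+ H.

Definition weight n : R := theta * 2 ^+ n.
Definition ball_par n x := ball_rep (weight n.+1) x.

Lemma weight_gt0 n : 0 < weight n.
Proof. by rewrite mulr_gt0 ?exprn_gt0. Qed.

Lemma weightS n : weight n.+1 = 2 * weight n.
Proof. by rewrite /weight exprS mulrCA. Qed.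

Lemma weight_geo n : \sum_(m < n.+1) weight m <= 2 * weight n.
Proof.
elim: n => [|n IH]; first by rewrite big_ord_recr big_ord0/= add0r ler_peMl ?ler1n// ltW// weight_gt0.
rewrite big_ord_recr/= weightS; have := weight_gt0 n; lra.
Qed.

Lemma weight_double n : 2 * weight n <= weight n.+1.
Proof. by rewrite weightS. Qed.

Lemma ball_par_root x y : ball_par H.-1 x = ball_par H.-1 y.
Proof.
by rewrite /ball_par prednK//; apply/eqP; rewrite ball_rep_eqE ?dist_le// ltW// weight_gt0.
Qed.

Lemma anc_ball n x : anc ball_par n.+1 x = ball_rep (weight n.+1) x.
Proof.
elim: n => //= n IH; have w0 m := ltW (weight_gt0 m).
rewrite IH /ball_par; apply/eqP; rewrite ball_rep_eqE// dC.
by apply: le_trans (ball_rep_near _ (w0 _)) _; rewrite [leRHS]weightS ler_peMl// ler1n.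
Qed.

Local Notation tdist := (tree_dist H ball_par weight).

(** If [n.+1] is the first level whose weight reaches [d x y], the points are separated at level
    [n], which contributes [2 * weight n = weight n.+1]. If already [weight 0] does, level 0
    suffices. *)
Lemma le_tree_dist x y : d x y <= tdist x y.
Proof.
have [/eqP->|] := boolP (d x y == 0); first by apply: tree_dist_ge0; exact: weight_gt0.
move=> dn0; have dp : 0 < d x y by rewrite lt_neqAle eq_sym dn0 d_ge0.
have xy : x != y by apply: contraNneq dn0 => ->; rewrite d_xx.
suff [n nH /andP[dn an]] : exists2 n, (n < H)%N &
    (d x y <= 2 * weight n) && (anc ball_par n x != anc ball_par n y).
  rewrite /tree_dist (bigD1 (Ordinal nH))//= an mulr1 [_ * 2]mulrC; apply: le_trans dn _.
  rewrite lerDl; apply: sumr_ge0 => m _; apply: mulr_ge0; first exact/ltW/weight_gt0.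
  by rewrite mulr_ge0.
have exn : exists n, d x y <= weight n by exists H; exact: dist_le.
case: (ex_minnP exn) => -[|n] dn nmin.
  by exists 0%N => //; rewrite xy andbT (le_trans dn)// ler_peMl ?ler1n// ltW// weight_gt0.
have dw : weight n < d x y by rewrite ltNge; apply/negP => /nmin; rewrite ltnn.
exists n; first exact: nmin.
rewrite -weightS dn/=; case: n dw {nmin dn} => [|n] dw //.
by rewrite !anc_ball ball_rep_eqE -?ltNge// ltW// weight_gt0.
Qed.

Lemma weight_sum_le c n : 0 <= c -> \sum_(m < n) (weight m <= c)%R%:R * weight m <= 2 * c.
Proof.
move=> c0; elim: n => [|n IH]; first by rewrite big_ord0 mulr_ge0.
have [nc|nc] := leP (weight n) c; last by rewrite big_ord_recr/= [weight n <= c]leNgt nc mul0r addr0.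
apply: (@le_trans _ _ (2 * weight n)); last by rewrite ler_wpM2l.
apply: le_trans (weight_geo n); apply: ler_sum => m _.
by case: (weight m <= c); rewrite ?mul1r// mul0r ltW// weight_gt0.
Qed.

(** Distinct points at distance 0 are apart in the tree, hence the representatives. Separating
    levels have weight at most [d x y], at level 0 by the choice of [theta]; 4 is the geometric sum
    times the 2 of [tree_dist]. *)
Lemma tree_dist_rep_le x y : tdist (ball_rep 0 x) (ball_rep 0 y) <= 4 * d x y.
Proof.
have [/eqP d0|] := boolP (d x y == 0).
  have /eqP-> : ball_rep 0 x == ball_rep 0 y by rewrite ball_rep_eqE// d0.
  by rewrite tree_distxx d0 mulr0.
move=> dn0; have dp : 0 < d x y by rewrite lt_neqAle eq_sym dn0 d_ge0.
have r0 z : d z (ball_rep 0 z) = 0.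
  by apply/eqP; rewrite eq_le d_ge0 andbT ball_rep_near.
apply: (@le_trans _ _ (2 * \sum_(m < H) (weight m <= d x y)%R%:R * weight m)); last first.
  have := weight_sum_le H (d_ge0 x y); lra.
rewrite mulr_sumr; apply: ler_sum => n _.
rewrite mulrC -mulrA; apply: ler_wpM2l => //.
apply: ler_wpM2r; first exact/ltW/weight_gt0.
rewrite ler_nat; case: eqVneq => // an; rewrite lt0b.
case: (n : nat) an => [_|m]; first by rewrite /weight expr0 mulr1 theta_le.
rewrite !anc_ball => /negPf; move/negbT.
rewrite ball_rep_eqE ?(ball_rep_dist (r0 x) (r0 y)) -?ltNge; first exact: ltW.
exact/ltW/weight_gt0.
Qed.

End Ultrametric.

(** * The algorithm on a finite ultrametric space *)

Lemma server_const_gt0 (R : realType) : 0 < 4 * (16 * (544 * 4)) :> R.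
Proof.
have h n : 0 < n.+1%:R :> R := ltr0Sn R n.
exact: (mulr_gt0 (h 3) (mulr_gt0 (h 15) (mulr_gt0 (h 543) (h 3)))).
Qed.

Section UltrametricAlgorithm.
Variables (R : realType) (X : finType) (d : X -> X -> R).
Hypotheses (d_xx : forall x, d x x = 0) (dC : forall x y, d x y = d y x).
Hypothesis d_ge0 : forall x y, 0 <= d x y.
Hypothesis d_ultra : forall x y z c, d x y <= c -> d y z <= c -> d x z <= c.
Variable k : nat.
Hypothesis k_ge2 : (2 <= k)%N.
Local Notation U := (@unit_uniform R).
Local Notation rep := (ball_rep d 0).
Local Open Scope classical_set_scope.

Let alpha : R := 4 * (16 * (544 * 4)) * ln k%:R ^+ 2.

Let alpha_gt0 : 0 < alpha.
Proof.
apply: mulr_gt0; first exact: server_const_gt0.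
by rewrite exprn_gt0// ln_gt0// ltr1n.
Qed.

Lemma rep_dist0 x : d x (rep x) = 0.
Proof. by apply/eqP; rewrite eq_le d_ge0 andbT ball_rep_near. Qed.

Definition rep_config (rho : config k X) : config k X := [tuple of map rep rho].

(* [rep r] is at distance 0 from [r], so the replacement is free. *)
Definition lift_config r (rho : config k X) : config k X :=
  [tuple of map (fun y => if y == rep r then r else y) rho].

Lemma ultrametric_algorithm (rho0 : config k X) :
  exists (A : measurableTypeR R -> seq X -> config k X) (c : R),
  [/\ 0 < c, forall u, A u [::] = rho0, forall u s r, r \in A u (rcons s r),
    forall s rho, measurable [set u | A u s = rho] &
    forall r : nat -> X, (\int[U]_u trajectory_cost d (fun t => A u (mkseq r t)) <=
      alpha%:E * offline_opt d rho0 r + c%:E)%E].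
Proof.
have [theta [H [th0 H0 th_le d_le]]] := scale_exists d_ge0.
have k_gt0 : (0 < k)%N by exact: ltnW.
pose par := ball_par d theta; pose w := weight theta : nat -> R.
pose o := par H.-1 (tnth rho0 (Ordinal k_gt0)).
have par_o x : par H.-1 x = o by exact: ball_par_root.
have [A [c [A0 Ar Am Ac]]] := level_tree_algorithm H0 par_o k_ge2 (weight_gt0 th0)
  (weight_geo th0) (weight_double theta) (rep_config rho0).
(* The tree algorithm sees only representatives; [last r s'] is the current request. Before any
   request the configuration must be [rho0] itself. *)
pose B u s := if s is r :: s' then lift_config (last r s') (A u (map rep s)) else rho0.
have Brcons u s r : B u (rcons s r) = lift_config r (A u (rcons (map rep s) (rep r))).
  by rewrite -map_rcons; case: s => //= y s; rewrite last_rcons.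
have lift0 r y : d y (if y == rep r then r else y) = 0.
  by case: eqP => [->|//]; rewrite dC rep_dist0.
have BA u s i : d (tnth (A u (map rep s)) i) (tnth (B u s) i) = 0.
  case: s => [|r s]; first by rewrite A0 tnth_map dC rep_dist0.
  by rewrite /B tnth_map lift0.
pose cost r j u := config_dist d (B u (mkseq r j.+1)) (B u (mkseq r j)).
have cost_le r j u : cost r j u <=
    config_tree_dist H par w (A u (mkseq (rep \o r) j)) (A u (mkseq (rep \o r) j.+1)).
  have mkE j' : mkseq (rep \o r) j' = map rep (mkseq r j') by rewrite /mkseq map_comp.
  rewrite (mkE j) (mkE j.+1); apply: ler_sum => i _; rewrite dC.
  have -> := ball_rep_dist dC d_ge0 d_ultra (BA u (mkseq r j) i) (BA u (mkseq r j.+1) i).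
  exact: (le_tree_dist d_xx dC d_ge0 d_ultra th0 H0 d_le).
have cost_ge0 r j u : 0 <= cost r j u by apply: sumr_ge0 => i _.
have Bm s rho : measurable [set u | B u s = rho].
  case: s => [|r s]; first exact: measurable_prop (rho0 = rho).
  exact: (finite_valued_measurable (Am (map rep (r :: s)))
            (fun rho' => lift_config (last r s) rho' = rho)).
have cost_meas r j : measurable_fun setT (fun u => (cost r j u)%:E).
  have m2 := measurable_pair_level (Bm (mkseq r j.+1)) (Bm (mkseq r j)).
  exact: (finite_valued_measurable_fun m2 (fun e => (config_dist d e.1 e.2)%:E : \bar R)).
exists B, (`|c| + 1); split => //.
- move=> u s r; rewrite Brcons; apply/mapP; exists (rep r); first exact: Ar.
  by rewrite eqxx.
(* Positivity of [alpha] brings it inside the infimum, which leaves a single offline trajectory to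
   compare with. *)
move=> r; rewrite -leeBlDr// -ereal_inf_pZl//; apply: le_ereal_inf_tmp.
move=> _ [_ [rho [rho00 rho_r] <-] <-]; rewrite leeBlDr//.
rewrite /trajectory_cost integral_nneseries//; first last.
- by move=> j u _; rewrite lee_fin; exact: cost_ge0.
- by move=> j; exact: cost_meas.
apply: lime_le.
  by apply: is_cvg_nneseries => j _ _; apply: integral_ge0 => u _; rewrite lee_fin; exact: cost_ge0.
apply: nearW => t; rewrite big_mkord.
pose rho' j := rep_config (rho j).
have rho'0 : rho' 0%N = rep_config rho0 by rewrite /rho' rho00.
have rho'_r j : (rep \o r) j \in rho' j.+1 by apply: map_f; exact: rho_r.
apply: (@le_trans _ _ (\sum_(j < t) \int[U]_u
    (config_tree_dist H par w (A u (mkseq (rep \o r) j)) (A u (mkseq (rep \o r) j.+1)))%:E)%E).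
  apply: lee_sum => j _; apply: ge0_le_integral => //.
  - by move=> u _; rewrite lee_fin; exact: cost_ge0.
  - exact: cost_meas.
  - have m2 := measurable_pair_level (Am (mkseq (rep \o r) j)) (Am (mkseq (rep \o r) j.+1)).
    exact: (finite_valued_measurable_fun m2
      (fun e => (config_tree_dist H par w e.1 e.2)%:E : \bar R)).
  - by move=> u _; rewrite lee_fin; exact: cost_le.
apply: le_trans (Ac (rep \o r) rho' rho'0 rho'_r t) _.
rewrite EFinD; apply: leeD; last by rewrite lee_fin (le_trans (ler_norm c))// lerDl.
apply: (@le_trans _ _ (alpha%:E * \sum_(0 <= j < t) (config_dist d (rho j.+1) (rho j))%:E)%E); last first.
  apply: lee_wpmul2l; first by rewrite lee_fin ltW.
  by apply: nneseries_lim_ge => j _ _; rewrite lee_fin; apply: sumr_ge0.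
rewrite big_mkord sumEFin -EFinM lee_fin /alpha.
rewrite -[4 * _ * _]mulrA [4 * _]mulrC -[_ * 4 * _]mulrA; apply: ler_wpM2l.
  apply: mulr_ge0; last by rewrite exprn_ge0// ln_ge0// ler1n ltnW.
  by apply: mulr_ge0; [exact: ler0n|apply: mulr_ge0; exact: ler0n].
rewrite mulr_sumr; apply: ler_sum => j _; rewrite mulr_sumr; apply: ler_sum => i _.
by rewrite !tnth_map [d (tnth _ _) _]dC; apply: tree_dist_rep_le.
Qed.

End UltrametricAlgorithm.

(** * Hierarchically separated trees *)

Section HST.
Variables (R : realType) (T : rooted_tree) (w : T -> R).
Hypothesis w_ge0 : forall v, 0 <= w v.
Hypothesis w_mono : forall u v, ancestor u v -> w v <= w u.
Implicit Types u v x y : T.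

Lemma root_ancestor v : ancestor (tree_root T) v.
Proof. by have [n <-] := to_root v; exact: fconnect_iter. Qed.

Lemma depth_min v m : iter m (@parent T) v = tree_root T -> (depth v <= m)%N.
Proof.
move=> vm; rewrite leqNgt; apply/negP => mv.
have := findex_iter (ltn_trans mv (findex_max (root_ancestor v))).
by rewrite vm => E; rewrite /depth E ltnn in mv.
Qed.

Lemma iter_root n : iter n (@parent T) (tree_root T) = tree_root T.
Proof. by elim: n => //= n ->; exact: parent_root. Qed.

(** Going up from a vertex other than the root strictly decreases the depth. *)
Lemma ancestor_eq x y : ancestor y x -> (depth x <= depth y)%N -> x = y.
Proof.
move=> yx; have := iter_findex yx; move: (findex _ x y) => n <- {y yx}.
case: n => // n xn.
suff : iter n.+1 (@parent T) x = tree_root T.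
  move=> E; move: xn; rewrite E (_ : depth (tree_root T) = 0%N); last first.
    by apply/eqP; rewrite -leqn0; exact: depth_min.
  by rewrite leqn0 => /eqP d0; have := iter_findex (root_ancestor x); rewrite -/(depth x) d0.
have E := iter_findex (root_ancestor x); rewrite -/(depth x) in E.
have [xn1|xn1] := leqP (depth x) n.+1.
  by rewrite -(subnK xn1) iterD E iter_root.
exfalso; have : (depth (iter n.+1 (@parent T) x) <= depth x - n.+1)%N.
  by apply: depth_min; rewrite -iterD subnK// ltnW.
by move=> /(leq_trans xn); rewrite leqNgt -subn_gt0 subKn// ltnW.
Qed.

Lemma ancestor_chain x y v : ancestor x v -> ancestor y v -> ancestor x y \/ ancestor y x.
Proof.
move=> xv yv; have := iter_findex xv; have := iter_findex yv.
move: (findex _ v x) (findex _ v y) => n m <- <-.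
have [nm|/ltnW nm] := leqP n m; [right|left]; rewrite -(subnK nm) iterD; exact: fconnect_iter.
Qed.

(** Ancestors of a vertex form a chain, so the deepest common ancestor lies below all the others and
    has the least weight. *)
Lemma lcaP u v : [/\ ancestor (lca u v) u, ancestor (lca u v) v &
  forall x, ancestor x u -> ancestor x v -> w (lca u v) <= w x].
Proof.
rewrite /lca; case: arg_maxnP => [|y /andP[yu yv] ymax]; first by rewrite !root_ancestor.
split => // x xu xv; have [xy|yx] := ancestor_chain xu yu; first exact: w_mono.
have xy : (depth x <= depth y)%N by apply: ymax; rewrite xu xv.
by rewrite (ancestor_eq yx xy).
Qed.

Lemma hst_distC (l l' : leaf T) : hst_dist w l l' = hst_dist w l' l.
Proof.
rewrite /hst_dist eq_sym; case: eqP => // _.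
have [a1 a2 a3] := lcaP (val l) (val l'); have [b1 b2 b3] := lcaP (val l') (val l).
by apply/eqP; rewrite eq_le a3// b3.
Qed.

Lemma hst_dist_ge0 (l l' : leaf T) : 0 <= hst_dist w l l'.
Proof. by rewrite /hst_dist; case: ifP. Qed.

(** The two given common ancestors both lie above [y], so they are comparable, and the upper one is
    a common ancestor of [x] and [z]. *)
Lemma hst_dist_ultra (x y z : leaf T) c :
  hst_dist w x y <= c -> hst_dist w y z <= c -> hst_dist w x z <= c.
Proof.
rewrite /hst_dist; case: (eqVneq x y) => [->//|xy]; case: (eqVneq y z) => [<-|yz].
  by rewrite (negbTE xy).
move=> h1 h2; case: eqP => [_|_]; first by apply: le_trans h1; exact: w_ge0.
have [a1 a2 _] := lcaP (val x) (val y); have [b1 b2 _] := lcaP (val y) (val z).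
have [_ _ m] := lcaP (val x) (val z).
have [h|h] := ancestor_chain a2 b1.
  by apply: le_trans h1; apply: m => //; exact: connect_trans b2 h.
by apply: le_trans h2; apply: m => //; exact: connect_trans a1 h.
Qed.

End HST.

Local Open Scope classical_set_scope.
Local Open Scope ring_scope.

Theorem theorem1p1 (R : realType) :
  exists2 C : R, 0 < C &
    forall (k : nat) (T : rooted_tree) (w : T -> R),
      (2 <= k)%N -> is_HST w ->
      exists (disp : measure_display) (Omega : measurableType disp)
        (P : probability Omega R) (A : Omega -> online_algorithm k (leaf T)),
        randomized_online_algorithm P A /\
        competitive (hst_dist w) P A (C * (ln k%:R) ^+ 2).
Proof.
exists (4 * (16 * (544 * 4))).
  exact: server_const_gt0.
move=> k T w k2 [tau tau1 [w0 wm _]].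
have d_xx (l : leaf T) : hst_dist w l l = 0 by rewrite /hst_dist eqxx.
(* One algorithm per initial configuration, all on the same probability space. *)
have /boolp.choice[A AP] := ultrametric_algorithm d_xx (hst_distC wm) (hst_dist_ge0 w0)
  (hst_dist_ultra w0 wm) k2.
exists _, (measurableTypeR R), (@unit_uniform R), (fun u rho0 s => A rho0 u s); split.
  split => [rho0 s rho|rho0]; first by have [c [_ _ _ Am _]] := AP rho0; exact: Am.
  apply: aeW => u; have [c [_ A0 Ar _ _]] := AP rho0; split; [exact: A0|exact: Ar].
by move=> rho0; have [c [c0 _ _ _ Ac]] := AP rho0; exists c.
Qed.
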